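(* There exists a randomized algorithm that, given as input integers $k\ge 0$ and $t\ge 1$ and an $n$-vertex graph $G$ with $\mathrm{iocp}(G)\le k$, returns in time $O_{k,t}(n^{k+4})$ an independent set of $G$ whose size is at least $\alpha(G)-n/t$ with probability at least $1/2$.
   Context: All graphs are finite and simple; $\alpha(G)$ is the maximum size of an independent set in $G$. The induced odd cycle packing number $\mathrm{iocp}(G)$ of a graph $G$ is the maximum integer $k$ such that $G$ contains an induced subgraph consisting of $k$ pairwise vertex-disjoint odd cycles (triangles count as odd cycles). $O_{k,t}(\cdot)$ means the hidden constant may depend on $k$ and $t$. *)

(* Defs.v *)
From mathcomp Require Import all_boot all_order all_algebra.
Set Implicit Arguments.
Unset Strict Implicit.
Unset Printing Implicit Defensive.

Import Order.TTheory GRing.Theory Num.Theory.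

Record sgraph (n : nat) := SGraph {
  adj :> rel 'I_n;
  adj_sym : symmetric adj;
  adj_irr : irreflexive adj }.

Definition independent n (G : sgraph n) (S : {set 'I_n}) : bool :=
  [forall x in S, forall y in S, ~~ G x y].

Definition alpha n (G : sgraph n) : nat :=
  \max_(S : {set 'I_n} | independent G S) #|S|.

(* The subgraph induced by [A] is a cycle of odd length: [s] lists [A] in
   cyclic order, and the edges inside [A] are exactly the pairs of cyclically
   consecutive vertices of [s] (in particular the cycle has no chord). *)
Definition induces_odd_cycle n (G : sgraph n) (A : {set 'I_n}) : bool :=
  [&& 2 < #|A|, odd #|A| &
   [exists s : #|A|.-tuple 'I_n,
     [&& uniq s, A == [set x in s] &
      [forall x in A, forall y in A,
         G x y == (y == next s x) || (x == next s y)]]]].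

(* [P] is the family of the vertex sets of the connected components of an
   induced subgraph of [G] all of whose components are odd cycles. *)
Definition induced_odd_cycle_packing n (G : sgraph n) (P : {set {set 'I_n}})
  : bool :=
  [&& [forall A in P, induces_odd_cycle G A], trivIset P &
   [forall A in P, forall B in P, (A != B) ==>
     [forall x in A, forall y in B, ~~ G x y]]].

Definition iocp n (G : sgraph n) : nat :=
  \max_(P : {set {set 'I_n}} | induced_odd_cycle_packing G P) #|P|.

(* Algorithms are while programs over the store of a randomized word RAM:
   registers and a random-access memory, whose cells hold [w]-bit words, with
   arithmetic modulo [2 ^ w].  The word size [w] is a parameter of the
   semantics that is not given to the program. *)

Inductive binop := Add | Sub | Mul | Div | Mod | Lt | Eq.

Inductive expr :=
  | Const of nat
  | Reg of nat
  | Read of expr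
  | Bin of binop & expr & expr.

Inductive cmd :=
  | Skip
  | Assign of nat & expr      (* register := value *)
  | Store of expr & expr      (* memory[address] := value *)
  | Rand of nat & expr        (* register := uniform element of {0, ..., m-1} *)
  | Seq of cmd & cmd
  | If of expr & cmd & cmd    (* a nonzero value means true *)
  | While of expr & cmd.

Record store := MkStore { regs : nat -> nat; mem : nat -> nat }.

(* Subtraction is truncated at 0; division by 0 yields 0. *)
Definition binop_fun (o : binop) : nat -> nat -> nat :=
  match o with
  | Add => addn
  | Sub => subn
  | Mul => muln
  | Div => divn
  | Mod => modn
  | Lt => fun a b => nat_of_bool (a < b)
  | Eq => fun a b => nat_of_bool (a == b)
  end.

Fixpoint eval (w : nat) (s : store) (e : expr) : nat :=
  match e with
  | Const c => c %% 2 ^ w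
  | Reg x => regs s x
  | Read a => mem s (eval w s a)
  | Bin o a b => binop_fun o (eval w s a) (eval w s b) %% 2 ^ w
  end.

Definition upd (f : nat -> nat) (x v : nat) : nat -> nat :=
  fun y => if y == x then v else f y.

Definition set_reg (s : store) (x v : nat) : store :=
  MkStore (upd (regs s) x v) (mem s).

Definition set_mem (s : store) (a v : nat) : store :=
  MkStore (regs s) (upd (mem s) a v).

(* The commands still to be executed, and the current store; the computation
   has halted when no command is left. *)
Definition config : Type := (seq cmd * store)%type.

(* The successors of a configuration; the machine moves to a uniformly random
   entry of this list.  Only [Rand] makes it longer than one; [Rand] with bound
   0 behaves as with bound 1.  A move costs one unit of time: the expressions
   in it have bounded size, as the program does not depend on the input. *)
Definition step (w : nat) (c : config) : seq config :=
  let: (K, s) := c in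
  match K with
  | [::] => [::]
  | Skip :: K' => [:: (K', s)]
  | Assign x e :: K' => [:: (K', set_reg s x (eval w s e))]
  | Store a e :: K' => [:: (K', set_mem s (eval w s a) (eval w s e))]
  | Rand x e :: K' =>
      [seq (K', set_reg s x j) | j <- iota 0 (maxn 1 (eval w s e))]
  | Seq c1 c2 :: K' => [:: (c1 :: c2 :: K', s)]
  | If e c1 c2 :: K' =>
      [:: ((if eval w s e != 0 then c1 else c2) :: K', s)]
  | While e c1 :: K' =>
      [:: (if eval w s e != 0 then c1 :: While e c1 :: K' else K', s)]
  end.

(* The probability that the machine started in [c] halts after at most [T]
   moves in a store satisfying [E].  As every step has finitely many equally
   likely outcomes, this is 1 iff each possible run does so. *)
Fixpoint prob (w T : nat) (c : config) (E : pred store) : rat :=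
  if c.1 is [::] then ((E c.2)%:R)%R
  else if T is T'.+1 then
    ((\sum_(c' <- step w c) prob w T' c' E) / (size (step w c))%:R)%R
  else 0%R.

(* Input: n, k, t are in registers 0, 1, 2, and the adjacency matrix of the
   graph is in memory, row by row; everything else is 0. *)
Definition init_store (w k t n : nat) (G : sgraph n) : store :=
  MkStore
    (fun x => nth 0 [:: n; k; t] x %% 2 ^ w)
    (fun a => [exists i : 'I_n, exists j : 'I_n, (a == i * n + j) && G i j]
              %% 2 ^ w).

(* Output: the vertex set whose characteristic vector is in the first n memory
   cells. *)
Definition output (n : nat) (s : store) : {set 'I_n} :=
  [set v : 'I_n | mem s v != 0].

(* Main.v *)
(* Fix an optimal independent set I, which may be assumed to have at least n/t
   vertices, and let D = 4t(k+1), L = 10D, E = LD.  One trial deletes the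
   neighbourhoods of S = 2E^2 uniformly random vertices.  With probability
   bounded below all of them lie in I; then I survives, while a vertex with
   more than n/E neighbours in I (a heavy vertex) survives with probability at
   most (1 - 1/E)^S, so probably at most h = n/E of these are left.  Then come k
   rounds, each of which reduces iocp.  A round deletes j shortest odd cycles
   of length < L, one after the other, for a random j <= 2h.  As a cycle through
   a heavy vertex can be deleted at most h times, with probability at least 1/2
   the next shortest odd cycle C contains no heavy vertex.  If C is shorter than
   L, deleting its neighbourhood costs at most n/D vertices of I, and C can be
   added to every induced odd cycle packing of what is left.  Otherwise one
   deletes a layer of radius d + 1 <= D around C and a layer of radius
   3D + b + 1 <= 4D around a vertex of C; what remains near C is bipartite, so
   that C again enlarges every packing, and random d, b < D are likely enough to
   hit layers with at most n/D vertices of I.  Finally iocp = 0 means bipartite,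
   and there an auction with D price levels finds an independent set within n/D
   of the optimum in time O(D n^3) instead of a maximum matching algorithm.
   Each trial succeeds with probability at least 1/R for a constant R, and R
   independent trials are made; their number and cost make the running time
   O(n^4).
   All random numbers are drawn at the start, uniformly below a common multiple
   B of all moduli needed, so that the rest is a deterministic function. *)

(* The program may depend neither on [k] and [t] nor on [n] and the word size, so it computes its
   own parameters, and all intermediate values must fit into a word. This shapes the main program:
   counters run downward and levels replace prices, so that it never stores anything larger than
   what it already holds. The constants follow from the loss budget. A cycle of fewer than L light
   vertices has at most L n/E = n/D neighbours in I, whence E = LD. Per round the at most 2h deleted
   cycles cost 2hL <= 2n/D and the final deletion 2n/D; with n/D for the auction the total is (4k +
   1) n/D <= n/t. S = 2E^2 gives (1 - 1/E)^S <= 1/(1 + 2E), so that Markov's inequality with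
   threshold n/E gives up at most half of the probability that the sample lies in I. Every candidate
   is checked before it replaces the best set found so far; so the output is always independent, and
   a failed trial does no harm. Closed walks stand in for cycles: they are found by dynamic
   programming, and a shortest odd one is automatically an induced cycle. *)
Require Import Defs.
From mathcomp Require Import all_boot all_order all_algebra.
From mathcomp Require Import zify ring lra.
Set Implicit Arguments.
Unset Strict Implicit.
Unset Printing Implicit Defensive.
Import Order.TTheory GRing.Theory Num.Theory.

(** * A structured language compiled to the machine *)

Section Prob.
Local Open Scope ring_scope.

Variable w : nat.
Implicit Types (E : pred store) (c : config).

Lemma prob_ge0 T c E : 0 <= prob w T c E.
Proof.
elim: T c => [|T IH] [[|x K] s] /=; rewrite ?ler0n //.
by rewrite divr_ge0 ?ler0n // sumr_ge0.
Qed.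

Lemma avg_le1 (A : Type) (l : seq A) (f : A -> rat) :
  (forall x, f x <= 1) -> (\sum_(x <- l) f x) / (size l)%:R <= 1.
Proof.
move=> f1; case: l => [|a l]; first by rewrite big_nil mul0r ler01.
rewrite ler_pdivrMr ?ltr0n // mul1r -sum1_size natr_sum.
by apply: ler_sum.
Qed.

Lemma prob_le1 T c E : prob w T c E <= 1.
Proof.
by elim: T c => [|T IH] [[|x K] s] /=; rewrite ?lern1 ?leq_b1 //; apply: avg_le1.
Qed.

Lemma prob_monoS T c E : prob w T c E <= prob w T.+1 c E.
Proof.
elim: T c => [|T IH] [[|x K] s] //.
  by rewrite [X in X <= _]/=; apply: prob_ge0.
rewrite [X in X <= _]/= [X in _ <= X]/=.
by apply: ler_wpM2r; [rewrite invr_ge0 ler0n | apply: ler_sum => i _; apply: IH].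
Qed.

Lemma prob_mono T T' c E : (T <= T')%N -> prob w T c E <= prob w T' c E.
Proof.
move/subnK <-; elim: (T' - T)%N => [|d IH] //.
by rewrite addSn; apply: le_trans IH (prob_monoS _ _ _).
Qed.

Lemma prob_nil T s E : prob w T ([::], s) E = (E s)%:R.
Proof. by case: T. Qed.

Lemma prob_det T x K s c' E :
  step w (x :: K, s) = [:: c'] -> prob w T.+1 (x :: K, s) E = prob w T c' E.
Proof.
move=> H; have -> : prob w T.+1 (x :: K, s) E =
  (\sum_(c <- step w (x :: K, s)) prob w T c E) / (size (step w (x :: K, s)))%:R by [].
by rewrite H big_seq1 divr1.
Qed.

End Prob.

Section Reach.
Variable w : nat.

(** Determinism and exact cost in one equation. Quantifying over the continuation, the event and the
    remaining time lets fragments be composed by rewriting. *)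
Definition reach (c : cmd) (s : store) (n : nat) (s' : store) : Prop :=
  forall K E T, prob w (T + n) (c :: K, s) E = prob w T (K, s') E.

Lemma reach_skip s : reach Skip s 1 s.
Proof. by move=> K E T; rewrite addn1 (@prob_det w _ _ _ _ ((K, s))). Qed.

Lemma reach_assign x e s : reach (Assign x e) s 1 (set_reg s x (eval w s e)).
Proof. by move=> K E T; rewrite addn1 (@prob_det w _ _ _ _ ((K, set_reg s x (eval w s e)))). Qed.

Lemma reach_store a e s :
  reach (Store a e) s 1 (set_mem s (eval w s a) (eval w s e)).
Proof.
by move=> K E T; rewrite addn1 (@prob_det w _ _ _ _ ((K, set_mem s (eval w s a) (eval w s e)))).
Qed.

Lemma reach_seq c1 c2 s1 s2 s3 n1 n2 :
  reach c1 s1 n1 s2 -> reach c2 s2 n2 s3 -> reach (Seq c1 c2) s1 (n1 + n2).+1 s3.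
Proof.
move=> H1 H2 K E T; rewrite addnS (@prob_det w _ _ _ _ ((c1 :: c2 :: K, s1))) //.
by rewrite (addnC n1) addnA H1 H2.
Qed.

Lemma reach_if e c1 c2 s s' n :
  reach (if eval w s e != 0 then c1 else c2) s n s' -> reach (If e c1 c2) s n.+1 s'.
Proof.
move=> H K E T; rewrite addnS.
by rewrite (@prob_det w _ _ _ _ (((if eval w s e != 0 then c1 else c2) :: K, s))) // H.
Qed.

Lemma reach_while0 e c s : eval w s e = 0 -> reach (While e c) s 1 s.
Proof.
by move=> H K E T; rewrite addn1 (@prob_det w _ _ _ _ ((K, s))) //= H.
Qed.

Lemma reach_while1 e c s1 s2 s3 n1 n2 : eval w s1 e != 0 ->
  reach c s1 n1 s2 -> reach (While e c) s2 n2 s3 ->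
  reach (While e c) s1 (n1 + n2).+1 s3.
Proof.
move=> He H1 H2 K E T; rewrite addnS (@prob_det w _ _ _ _ ((c :: While e c :: K, s1))) /= ?He //.
by rewrite (addnC n1) addnA H1 H2.
Qed.

End Reach.

(* A variable [x] lives in register [2x]; odd registers count loop iterations.
   Arrays are interleaved above the input: cell [i] of array [a < 16] has
   address [n ^ 2 + 16 i + a]. *)
Record hstate := HState { vs : nat -> nat; ar : nat -> nat -> nat }.

Inductive hexp :=
  | HC of nat
  | HV of nat
  | HA of nat & hexp
  | HB of binop & hexp & hexp.

Inductive stm :=
  | SSet of nat & hexp
  | SPut of nat & hexp & hexp
  | SSeq of stm & stm
  | SIf of hexp & stm & stm
  | SNop
  | SFor of nat & nat & stm.   (* variable, read-only limit variable, body *)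

(** [eqn] instead of [==]: on literal variable numbers it reduces by computation, which discharges
    most side conditions about programs. *)
Definition setv (s : hstate) x v :=
  HState (fun y => if eqn y x then v else vs s y) (ar s).

Definition seta (s : hstate) a i v :=
  HState (vs s) (fun b j => if eqn b a then if j == i then v else ar s b j
                            else ar s b j).

Fixpoint hev (s : hstate) (e : hexp) : nat :=
  match e with
  | HC c => c
  | HV x => vs s x
  | HA a e => ar s a (hev s e)
  | HB o e1 e2 => binop_fun o (hev s e1) (hev s e2)
  end.

Fixpoint run (p : stm) (s : hstate) : hstate :=
  match p with
  | SSet x e => setv s x (hev s e)
  | SPut a i e => seta s a (hev s i) (hev s e)
  | SSeq p q => run q (run p s)
  | SIf e p q => if hev s e == 0 then run q s else run p s
  | SNop => s
  | SFor x y p => foldl (fun s i => run p (setv s x i)) s (iota 0 (vs s y))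
  end.

Definition fiter x p s i := foldl (fun s i => run p (setv s x i)) s (iota 0 i).

Lemma fiterS x p s i : fiter x p s i.+1 = run p (setv (fiter x p s i) x i).
Proof. by rewrite /fiter -addn1 iotaD foldl_cat. Qed.

Lemma run_for x y p s : run (SFor x y p) s = fiter x p s (vs s y).
Proof. by []. Qed.

(** A syntactic frame condition: for a concrete program it is decided by computation, so invariants
    need not mention untouched variables. *)
Fixpoint keepv (x : nat) (p : stm) : bool :=
  match p with
  | SSet y _ => ~~ eqn x y
  | SSeq p q | SIf _ p q => keepv x p && keepv x q
  | SFor y _ p => ~~ eqn x y && keepv x p
  | _ => true
  end.

Fixpoint keepa (a : nat) (p : stm) : bool :=
  match p with
  | SPut b _ _ => ~~ eqn a b
  | SSeq p q | SIf _ p q => keepa a p && keepa a q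
  | SFor _ _ p => keepa a p
  | _ => true
  end.

Lemma run_keepv x p s : keepv x p -> vs (run p s) x = vs s x.
Proof.
elim: p s => //= [y e|p IHp q IHq|e p IHp q IHq|y z p IHp] s.
- by move/negPf->.
- by case/andP=> Hp Hq; rewrite IHq // IHp.
- by case/andP=> Hp Hq; case: ifP => _; [rewrite IHq|rewrite IHp].
case/andP=> /negPf Hy Hp; move: (iota _ _) => l; elim: l s => //= i l IH s.
by rewrite IH IHp //= Hy.
Qed.

Lemma run_keepa a p s : keepa a p -> ar (run p s) a = ar s a.
Proof.
elim: p s => //= [b i e|p IHp q IHq|e p IHp q IHq|y z p IHp] s.
- by move/negPf->.
- by case/andP=> Hp Hq; rewrite IHq // IHp.
- by case/andP=> Hp Hq; case: ifP => _; [rewrite IHq|rewrite IHp].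
move=> Hp; move: (iota _ _) => l; elim: l s => //= i l IH s.
by rewrite IH IHp.
Qed.

Fixpoint ecomp (e : hexp) : expr :=
  match e with
  | HC c => Const c
  | HV x => Reg x.*2
  | HA a e => Read (Bin Add (Reg 6) (Bin Add (Bin Mul (Const 16) (ecomp e)) (Const a)))
  | HB o e1 e2 => Bin o (ecomp e1) (ecomp e2)
  end.

Definition acomp a e :=
  Bin Add (Reg 6) (Bin Add (Bin Mul (Const 16) (ecomp e)) (Const a)).

Definition loopbody d x (c : cmd) :=
  Seq (Assign x.*2 (Reg d.*2.+1))
    (Seq c (Assign d.*2.+1 (Bin Add (Reg d.*2.+1) (Const 1)))).

Fixpoint comp (d : nat) (p : stm) : cmd :=
  match p with
  | SSet x e => Assign x.*2 (ecomp e)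
  | SPut a i e => Store (acomp a i) (ecomp e)
  | SSeq p q => Seq (comp d p) (comp d q)
  | SIf e p q => If (ecomp e) (comp d p) (comp d q)
  | SNop => Skip
  | SFor x y p =>
      Seq (Assign d.*2.+1 (Const 0))
        (While (Bin Lt (Reg d.*2.+1) (Reg y.*2)) (loopbody d x (comp d.+1 p)))
  end.

Fixpoint ewf (e : hexp) : bool :=
  match e with
  | HA a e => (a < 16) && ewf e
  | HB _ e1 e2 => ewf e1 && ewf e2
  | _ => true
  end.

Fixpoint wf (ro : pred nat) (p : stm) : bool :=
  match p with
  | SSet x e => ~~ ro x && ewf e
  | SPut a i e => [&& a < 16, ewf i & ewf e]
  | SSeq p q => wf ro p && wf ro q
  | SIf e p q => [&& ewf e, wf ro p & wf ro q]
  | SNop => true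
  | SFor x y p => [&& ~~ ro x, ro y & wf ro p]
  end.

Lemma run_ro ro x p s : wf ro p -> ro x -> vs (run p s) x = vs s x.
Proof.
move=> Hp Hx; apply: run_keepv; elim: p Hp => //=.
- by move=> y e /andP[Hy _]; apply: contra Hy => /eqnP <-.
- by move=> p IHp q IHq /andP[/IHp-> /IHq->].
- by move=> e p IHp q IHq /and3P[_ /IHp-> /IHq->].
- move=> y z p IHp /and3P[Hy _ /IHp->]; rewrite andbT.
  by apply: contra Hy => /eqnP <-.
Qed.

(* [tcost] counts machine steps; [nu] gives the values of the loop limits. *)
Fixpoint tcost (nu : nat -> nat) (p : stm) : nat :=
  match p with
  | SSeq p q => (tcost nu p + tcost nu q).+1
  | SIf _ p q => (tcost nu p + tcost nu q).+1
  | SFor x y p => (nu y * (tcost nu p + 6)) + 4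
  | _ => 1
  end.

Section Safety.
Variable W : nat.

(** [run] computes with unbounded integers; this condition ensures that reduction modulo [W] never
    acts. *)
Fixpoint esafe (s : hstate) (e : hexp) : bool :=
  match e with
  | HC c => c < W
  | HV _ => true
  | HA a e => esafe s e && (vs s 3 + (16 * hev s e + a) < W)
  | HB o e1 e2 => [&& esafe s e1, esafe s e2 & hev s (HB o e1 e2) < W]
  end.

Fixpoint safe (s : hstate) (p : stm) : Prop :=
  match p with
  | SSet x e => esafe s e
  | SPut a i e => esafe s i && esafe s e && (vs s 3 + (16 * hev s i + a) < W)
  | SSeq p q => safe s p /\ safe (run p s) q
  | SIf e p q => esafe s e /\ if hev s e == 0 then safe s q else safe s p
  | SNop => True
  | SFor x y p => vs s y < W /\
      forall i, i < vs s y -> safe (setv (fiter x p s i) x i) p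
  end.
End Safety.

Section Compile.
Variables (w : nat) (ro : pred nat) (nu : nat -> nat).
Hypothesis Hw : 16 < 2 ^ w.
Hypothesis ro3 : ro 3.

(** Odd registers and the cells below the base [vs s 3] are left free: the former hold loop counters
    and scratch values, the latter the input and finally the output. *)
Definition sim (s : hstate) (m : store) : Prop :=
  (forall x, regs m x.*2 = vs s x) /\
  (forall a i, a < 16 -> Defs.mem m (vs s 3 + (16 * i + a)) = ar s a i).

Lemma acomp_ok s m a e : a < 16 -> regs m 6 = vs s 3 -> eval w m (ecomp e) = hev s e ->
  vs s 3 + (16 * hev s e + a) < 2 ^ w ->
  eval w m (acomp a e) = vs s 3 + (16 * hev s e + a).
Proof.
move=> Ha H6 He Hb /=; rewrite He H6.
rewrite (modn_small (m := 16)) // (modn_small (m := a)); last by apply: leq_trans Hw; lia.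
by rewrite (modn_small (m := 16 * _)) ?(modn_small (m := _ + a)) ?modn_small //; lia.
Qed.

Lemma ecomp_ok s m e : sim s m -> ewf e -> esafe (2 ^ w) s e ->
  eval w m (ecomp e) = hev s e.
Proof.
move=> [Hr Hm]; elim: e => [c|x|a e IH|o e1 IH1 e2 IH2].
- by move=> _ /= H; rewrite modn_small.
- by move=> _ _ /=; rewrite Hr.
- move=> /= /andP[Ha /IH He] /andP[/He E Hb].
  have /= -> := acomp_ok Ha (Hr 3) E Hb.
  exact: Hm.
- move=> /= /andP[/IH1 E1 /IH2 E2] /and3P[/E1-> /E2-> H].
  by rewrite modn_small.
Qed.

(** A loop at nesting depth [d] counts in register 2d + 1, so code compiled at depth [d] must
    preserve the counters of all enclosing loops. *)
Definition temps d (m m' : store) := forall i, i < d -> regs m' i.*2.+1 = regs m i.*2.+1.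

Lemma sim_setv s m x v : ~~ ro x -> sim s m -> sim (setv s x v) (set_reg m x.*2 v).
Proof.
move=> Hx [Hr Hm]; split=> [y|a i Ha] /=.
  rewrite /upd (_ : (y.*2 == x.*2) = eqn y x); first by rewrite Hr.
  by rewrite eqnE; apply/eqP/eqP; lia.
have -> : eqn 3 x = false by apply: contraNF Hx => /eqnP <-.
exact: Hm.
Qed.

Lemma temps_trans d m1 m2 m3 : temps d m1 m2 -> temps d m2 m3 -> temps d m1 m3.
Proof. by move=> H1 H2 i Hi; rewrite H2 // H1. Qed.

Lemma sim_temp s m d v : sim s m -> sim s (set_reg m d.*2.+1 v).
Proof.
move=> [Hr Hm]; split=> //= x; rewrite /upd ifF //.
by apply/eqP; lia.
Qed.

Lemma comp_ok d p s m : wf ro p -> (forall y, ro y -> vs s y = nu y) ->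
  safe (2 ^ w) s p -> sim s m ->
  exists t m', [/\ t <= tcost nu p, sim (run p s) m', temps d m m' &
                reach w (comp d p) m t m'].
Proof.
elim: p d s m => [x e|a i e|p IHp q IHq|e p IHp q IHq||x y p IHp] d s m.
- move=> /= /andP[Hx He] _ Hs Hm; exists 1, (set_reg m x.*2 (hev s e)); split=> //.
  + exact: sim_setv.
  + move=> i _ /=; rewrite /upd ifF //; apply/eqP; lia.
  + by rewrite -(ecomp_ok Hm He Hs); apply: reach_assign.
- move=> /= /and3P[Ha Hi He] _ /andP[/andP[Hsi Hse] Hb] Hm.
  exists 1, (set_mem m (vs s 3 + (16 * hev s i + a)) (hev s e)); split=> //.
  + case: Hm => Hr Hm; split=> // b j Hb' /=.
    rewrite /upd eqnE; case: (b =P a) => [->|nba]; last first.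
      by rewrite ifF ?Hm //; apply/eqP; lia.
    case: (j =P hev s i) => [->|nj]; first by rewrite eqxx.
    by rewrite ifF ?Hm //; apply/eqP; lia.
  + rewrite -(ecomp_ok Hm He Hse).
    rewrite -(acomp_ok Ha _ (ecomp_ok Hm Hi Hsi) Hb); last by apply: (proj1 Hm 3).
    exact: reach_store.
- move=> /= /andP[Hp Hq] Hro [Sp Sq] Hm.
  have [t1 [m1 [L1 M1 T1 R1]]] := IHp d _ _ Hp Hro Sp Hm.
  have Hro1 y : ro y -> vs (run p s) y = nu y.
    by move=> Hy; rewrite (run_ro _ Hp Hy) Hro.
  have [t2 [m2 [L2 M2 T2 R2]]] := IHq d _ _ Hq Hro1 Sq M1.
  exists (t1 + t2).+1, m2; split=> //; first by rewrite ltnS leq_add.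
    exact: temps_trans T1 T2.
  exact: reach_seq R1 R2.
- move=> /= /and3P[He Hp Hq] Hro [Se Spq] Hm.
  case: ifP Spq => Ee Spq.
    have [t1 [m1 [L1 M1 T1 R1]]] := IHq d _ _ Hq Hro Spq Hm.
    exists t1.+1, m1; split=> //; first by rewrite ltnS; lia.
    by apply: reach_if; rewrite (ecomp_ok Hm He Se) Ee.
  have [t1 [m1 [L1 M1 T1 R1]]] := IHp d _ _ Hp Hro Spq Hm.
  exists t1.+1, m1; split=> //; first by rewrite ltnS; lia.
  by apply: reach_if; rewrite (ecomp_ok Hm He Se) Ee.
- by move=> _ _ _ Hm; exists 1, m; split=> //; apply: reach_skip.
move=> /= /and3P[Hx Hy Hp] Hro [Ey Sp] Hm.
rewrite -/(run (SFor x y p) s) run_for.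
have Rof i z : ro z -> vs (fiter x p s i) z = vs s z.
  move=> Hz; elim: i => [|i IH] //; rewrite fiterS (run_ro _ Hp Hz) /= IH.
  by rewrite ifF //; apply: contraNF Hx => /eqnP <-.
have Loop j : forall i m, i + j = vs s y -> sim (fiter x p s i) m ->
    regs m d.*2.+1 = i -> exists t m', [/\ t <= j * (tcost nu p + 6) + 1,
      sim (fiter x p s (vs s y)) m', temps d m m' &
      reach w (While (Bin Lt (Reg d.*2.+1) (Reg y.*2)) (loopbody d x (comp d.+1 p))) m t m'].
  elim: j => [|j IHj] i m1 Eij Hm1 Em.
    exists 1, m1; split=> //; first by rewrite -Eij addn0.
    apply: reach_while0 => /=; rewrite Em (proj1 Hm1) (Rof _ _ Hy).
    by rewrite (_ : i < vs s y = false) ?mod0n //; lia.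
  set m2 := set_reg m1 x.*2 i.
  have Hm2 : sim (setv (fiter x p s i) x i) m2 by apply: sim_setv.
  have Hi : i < vs s y by lia.
  have Hro2 z : ro z -> vs (setv (fiter x p s i) x i) z = nu z.
    move=> Hz /=; rewrite ifF ?Rof ?Hro //.
    by apply: contraNF Hx => /eqnP <-.
  have [t3 [m3 [L3 M3 T3 R3]]] := IHp d.+1 _ _ Hp Hro2 (Sp i Hi) Hm2.
  have Em3 : regs m3 d.*2.+1 = i.
    by rewrite T3 // /m2 /= /upd ifF ?Em //; apply/eqP; lia.
  set m4 := set_reg m3 d.*2.+1 i.+1.
  have M4 : sim (fiter x p s i.+1) m4 by rewrite fiterS; apply: sim_temp.
  have E4 : regs m4 d.*2.+1 = i.+1 by rewrite /m4 /= /upd eqxx.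
  have Eij' : i.+1 + j = vs s y by lia.
  have [t5 [m5 [L5 M5 T5 R5]]] := IHj i.+1 m4 Eij' M4 E4.
  exists ((1 + (t3 + 1).+1).+1 + t5).+1, m5; split=> //.
  + by rewrite mulSn; lia.
  + move=> z Hz; rewrite (T5 _ Hz) /m4 /= /upd ifF; last by apply/eqP; lia.
    rewrite T3; last by lia.
    by rewrite /m2 /= /upd ifF //; apply/eqP; lia.
  + apply: (reach_while1 (s2 := m4)) => //.
      rewrite /= Em (proj1 Hm1) (Rof _ _ Hy) Hi modn_small //.
      by apply: leq_trans Hw.
    apply: (reach_seq (s2 := m2)).
      by have:= reach_assign w x.*2 (Reg d.*2.+1) m1; rewrite [eval _ _ _]/= Em.
    apply: reach_seq R3 _.
    have:= reach_assign w d.*2.+1 (Bin Add (Reg d.*2.+1) (Const 1)) m3.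
    rewrite [eval _ _ _]/= Em3 (modn_small (m := 1)); last by lia.
    by rewrite addn1 modn_small //; lia.
have H0 : sim (fiter x p s 0) (set_reg m d.*2.+1 0) by apply: sim_temp.
have [|t [m' [L1 M1 T1 R1]]] := Loop (vs s y) 0 _ (add0n _) H0.
  by rewrite /= /upd eqxx.
exists (1 + t).+1, m'; split=> //.
- by rewrite -(Hro _ Hy); lia.
- by move=> z Hz; rewrite (T1 _ Hz) /= /upd ifF //; apply/eqP; lia.
apply: reach_seq R1.
by have:= reach_assign w d.*2.+1 (Const 0) m; rewrite [eval _ _ _]/= mod0n.
Qed.

End Compile.

(** * Overflow and running time *)

(* A [small] expression is at most 2 or at most some stored value.  If only
   such values are assigned, the store stays bounded by its initial maximum,
   and only intermediate results can be larger. *)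
Fixpoint small (e : hexp) : bool :=
  match e with
  | HC c => c <= 2
  | HV _ | HA _ _ => true
  | HB (Defs.Sub | Defs.Div | Defs.Mod) e1 _ => small e1
  | HB (Defs.Lt | Defs.Eq) _ _ => true
  | HB (Defs.Add | Defs.Mul) _ _ => false
  end.

(** Exponent of a power of X above the value of [e] and all its intermediate results. An array
    access adds two, since n^2 + 16 i + a < X^(d + 2) when i < X^d. *)
Fixpoint edeg (e : hexp) : nat :=
  match e with
  | HC _ | HV _ => 1
  | HA _ e => (edeg e).+2
  | HB _ e1 e2 => (edeg e1 + edeg e2).+1
  end.

Fixpoint eokc (e : hexp) : bool :=
  match e with
  | HC c => c <= 2
  | HV _ => true
  | HA a e => (a < 16) && eokc e
  | HB _ e1 e2 => eokc e1 && eokc e2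
  end.

(** Conditions and array indices may be larger than [small] expressions, because they are never
    stored. *)
Fixpoint nogrow (m : nat) (p : stm) : bool :=
  match p with
  | SSet _ e => [&& small e, eokc e & edeg e <= m]
  | SPut a i e => [&& small e, a < 16, eokc i, eokc e, (edeg i).+2 <= m & edeg e <= m]
  | SSeq p q => nogrow m p && nogrow m q
  | SIf e p q => [&& eokc e, edeg e <= m, nogrow m p & nogrow m q]
  | SNop => true
  | SFor _ _ p => nogrow m p
  end.

Definition bounded M (s : hstate) : Prop :=
  (forall x, vs s x <= M) /\ (forall a i, ar s a i <= M).

Section Bounds.
Variables (M X W m : nat).
Hypotheses (HM : 1 < M) (HMX : M < X) (HX : 16 <= X) (HW : X ^ m <= W) (Hm : 0 < m).

Lemma small_le s e : bounded M s -> small e -> hev s e <= M.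
Proof.
case=> Hv Ha; elim: e => [c|x|a e _|o e1 IH1 e2 _] //=; first by move=> /leq_trans->.
case: o => //= H1; try (by apply: leq_trans (IH1 H1); rewrite ?leq_subr ?leq_div ?leq_mod).
  by case: (_ < _); lia.
by case: (_ == _); lia.
Qed.

Lemma pow_pos d : 0 < X ^ d. Proof. by rewrite expn_gt0; lia. Qed.

Lemma addr_lt s a i d : bounded M s -> a < 16 -> i < X ^ d ->
  vs s 3 + (16 * i + a) < X ^ d.+2.
Proof.
case=> Hv _ Ha Hi; have := Hv 3; have := pow_pos d; rewrite !expnS.
move: (X ^ d) Hi => y Hi Hy H3.
have: 16 * i + 16 <= X * y by apply: leq_trans (leq_mul HX Hi); lia.
have: X <= X * y by rewrite leq_pmulr.
have: X * y + X * y <= X * (X * y) by rewrite addnn -mul2n leq_mul2r; lia.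
lia.
Qed.

Lemma hev_lt s e : bounded M s -> eokc e -> hev s e < X ^ edeg e.
Proof.
move=> Hb; case: (Hb) => Hv Ha.
elim: e => [c|x|a e _|o e1 IH1 e2 IH2] /=.
- by rewrite expn1; lia.
- by rewrite expn1 => _; apply: leq_ltn_trans HMX.
- move=> _; apply: leq_ltn_trans (Ha _ _) _; apply: leq_trans HMX _.
  by rewrite !expnS leq_pmulr // muln_gt0 pow_pos; lia.
case/andP=> /IH1 H1 /IH2 H2; rewrite expnS expnD.
move: (hev s e1) (hev s e2) (pow_pos (edeg e1)) (pow_pos (edeg e2)) H1 H2 => a b.
move: (X ^ edeg e1) (X ^ edeg e2) => A B A0 B0 H1 H2.
have HAB : A <= A * B by rewrite leq_pmulr.
have HBA : B <= A * B by rewrite leq_pmull.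
have H2X : A * B + A * B <= X * (A * B) by rewrite addnn -mul2n leq_mul2r; lia.
have HAB2 : 2 <= A * B + A * B by lia.
case: o => /=.
- lia.
- lia.
- apply: leq_ltn_trans (leq_mul (ltnW H1) (ltnW H2)) _; lia.
- by have := leq_div a b; lia.
- by have := leq_mod a b; lia.
- by case: (a < b) => /=; lia.
- by case: (a == b) => /=; lia.
Qed.

Lemma pow_le d : d <= m -> X ^ d <= W.
Proof. by move=> Hd; apply: leq_trans HW; apply: leq_pexp2l => //; lia. Qed.

Lemma X_le_W : X <= W. Proof. by have := pow_le Hm; rewrite expn1. Qed.

Lemma esafe_ok s e : bounded M s -> eokc e -> edeg e <= m -> esafe W s e.
Proof.
move=> Hb; have XW := X_le_W; elim: e => [c|x|a e IH|o e1 IH1 e2 IH2] //=.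
- by lia.
- case/andP=> Ha He Hd; rewrite IH //=; last by lia.
  apply: leq_trans (pow_le Hd); apply: addr_lt => //; exact: hev_lt.
case/andP=> H1 H2 Hd; rewrite IH1 ?IH2 //=; try lia.
by apply: leq_trans (pow_le Hd); apply: (@hev_lt s (HB o e1 e2)) => //=; rewrite H1.
Qed.

Lemma bounded_setv s x v : bounded M s -> v <= M -> bounded M (setv s x v).
Proof. by case=> Hv Ha Hx; split=> // y /=; case: ifP. Qed.

Lemma safe_ok p s : nogrow m p -> bounded M s -> safe W s p /\ bounded M (run p s).
Proof.
elim: p s => [x e|a i e|p IHp q IHq|e p IHp q IHq||x y p IHp] s //=.
- case/and3P=> Hs He Hd Hb; split; first exact: esafe_ok.
  by apply: bounded_setv => //; apply: small_le.
- case/and5P=> Hs Ha Hi He /andP[Hdi Hde] Hb; split.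
    rewrite !esafe_ok //=; last by lia.
    by apply: leq_trans (pow_le Hdi); apply: addr_lt => //; apply: hev_lt.
  case: (Hb) => Hv Har; split=> // b j /=.
  by case: ifP => // _; case: ifP => // _; apply: small_le.
- case/andP=> Hp Hq Hb; have [Sp Bp] := IHp s Hp Hb.
  by have [Sq Bq] := IHq _ Hq Bp.
- case/and4P=> He Hd Hp Hq Hb; split.
    by split; [exact: esafe_ok | case: ifP => _; [case: (IHq s)|case: (IHp s)]].
  by case: ifP => _; [case: (IHq s)|case: (IHp s)].
move=> Hp Hb; have Hy := (proj1 Hb) y; have XW := X_le_W.
have Bi i : i <= vs s y -> bounded M (fiter x p s i).
  elim: i => [|i IH] // Hi; rewrite fiterS.
  by apply: (proj2 (IHp _ Hp _)); apply: bounded_setv (IH _) _; lia.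
split; last exact: Bi.
split; first by lia.
move=> i Hi; apply: (proj1 (IHp _ Hp _)); apply: bounded_setv (Bi _ _) _; lia.
Qed.

End Bounds.

Fixpoint ndeg (dg : nat -> nat) (p : stm) : nat :=
  match p with
  | SSeq p q | SIf _ p q => maxn (ndeg dg p) (ndeg dg q)
  | SFor _ y p => dg y + ndeg dg p
  | _ => 0
  end.

Fixpoint ncst (c : nat) (p : stm) : nat :=
  match p with
  | SSeq p q | SIf _ p q => (ncst c p + ncst c q).+1
  | SFor _ _ p => c * (ncst c p + 6) + 4
  | _ => 1
  end.

(** Replacing the limits by monomials makes the degree of the running time computable from the
    program text. *)
Lemma tcost_le (dg : nat -> nat) c N nu p : 0 < N -> (forall y, nu y <= c * N ^ dg y) ->
  tcost nu p <= ncst c p * N ^ ndeg dg p.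
Proof.
move=> HN Hnu.
have P d : 0 < N ^ d by rewrite expn_gt0 HN.
move: p; have two p q : (tcost nu p <= ncst c p * N ^ ndeg dg p) ->
    (tcost nu q <= ncst c q * N ^ ndeg dg q) ->
    (tcost nu p + tcost nu q).+1 <=
      (ncst c p + ncst c q).+1 * N ^ maxn (ndeg dg p) (ndeg dg q).
  move=> Hp Hq; rewrite mulSn mulnDl -[X in X < _]add0n -addSn leq_add //.
  by apply: leq_add; [apply: leq_trans Hp _ | apply: leq_trans Hq _];
     rewrite leq_mul2l leq_pexp2l ?orbT // ?leq_maxl ?leq_maxr.
elim=> //=.
- by move=> p IHp q IHq; apply: two.
- by move=> _ p IHp q IHq; apply: two.
move=> x y p IHp; rewrite expnD mulnDl leq_add //; last first.
  by rewrite leq_pmulr // muln_gt0 !P.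
have H6 : tcost nu p + 6 <= (ncst c p + 6) * N ^ ndeg dg p.
  by rewrite mulnDl leq_add // leq_pmulr.
by apply: leq_trans (leq_mul (Hnu y) H6) _; rewrite mulnACA.
Qed.

(** * Shortest odd closed walks *)

(** The last hit, with default 0, because a program loop that overwrites one variable at each hit
    computes exactly this. *)
Definition pick_last n (P : pred nat) : nat :=
  foldl (fun acc x => if P x then x else acc) 0 (iota 0 n).

Lemma pick_lastS n P :
  pick_last n.+1 P = if P n then n else pick_last n P.
Proof. by rewrite /pick_last -addn1 iotaD foldl_cat. Qed.

Lemma pick_lastP n (P : pred nat) : has P (iota 0 n) -> P (pick_last n P).
Proof.
elim: n => [|n IH] //; rewrite pick_lastS -addn1 iotaD has_cat /= orbF add0n.
by case: ifP => // _; rewrite orbF.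
Qed.

Section Walks.
Variables (n : nat) (e : rel nat).
Hypotheses (e_sym : symmetric e) (e_lt : forall x y, e x y -> x < n).

(** The recursion appends the last edge and tests all predecessors below [n]: it is the recurrence
    by which the program fills row after row of a table. *)
Fixpoint walk (v j u : nat) : bool :=
  if j is j'.+1 then has (fun x => walk v j' x && e x u) (iota 0 n) else u == v.

Lemma walkSP v j u : reflect (exists2 x, walk v j x & e x u) (walk v j.+1 u).
Proof.
apply: (iffP hasP) => [[x _ /andP[]]|[x Hx He]]; first by exists x.
by exists x; [rewrite mem_iota add0n (e_lt He) | apply/andP].
Qed.

Lemma walk_cat v i x j y : walk v i x -> walk x j y -> walk v (i + j) y.
Proof.
move=> Hx; elim: j y => [|j IH] y; first by move=> /eqP->; rewrite addn0.
by case/walkSP=> z /IH Hz He; rewrite addnS; apply/walkSP; exists z.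
Qed.

Lemma walk1 x y : e x y -> walk x 1 y.
Proof. by move=> H; apply/walkSP; exists x => /=. Qed.

Lemma walk_rev v j u : walk v j u -> walk u j v.
Proof.
elim: j u => [|j IH] u; first by rewrite /= eq_sym.
case/walkSP=> x /IH Hx He; rewrite -add1n; apply: walk_cat Hx.
by apply: walk1; rewrite e_sym.
Qed.

Lemma walk_lt v j u : 0 < j -> walk v j u -> u < n.
Proof. by case: j => // j _ /walkSP[x _ He]; apply: (@e_lt u x); rewrite e_sym. Qed.

Lemma path_wk x p : path e x p -> walk x (size p) (last x p).
Proof.
elim/last_ind: p => [|p y IH]; first by rewrite /= eqxx.
rewrite rcons_path last_rcons size_rcons => /andP[/IH H He].
by apply/walkSP; exists (last x p).
Qed.

Lemma walk_path v j u : walk v j u -> exists p, [/\ path e v p, last v p = u & size p = j].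
Proof.
elim: j u => [|j IH] u; first by move=> /eqP->; exists [::].
case/walkSP=> x /IH[p [Hp Hl Hs]] He; exists (rcons p u).
by rewrite rcons_path last_rcons size_rcons Hp Hl He Hs.
Qed.

(** Justifies a table of bounded length: whatever is reachable at all shows up in the rows up to
    n. *)
Lemma walk_short v j u : walk v j u -> exists2 i, i <= n & walk v i u.
Proof.
case/walk_path=> p [/shortenP[q Hq Hu _] Hl _].
exists (size q); last by rewrite -Hl; apply: path_wk.
have Hs : {subset q <= iota 0 n}.
  move=> y; rewrite mem_iota /= add0n; elim: q v Hq {Hu Hl} => //= z q IH v /andP[He Hq].
  rewrite inE => /orP[/eqP->|]; last exact: IH Hq.
  by apply: (@e_lt z v); rewrite e_sym.
case/andP: Hu => _ Hu.
by have := uniq_leq_size Hu Hs; rewrite size_iota.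
Qed.

(** Backtracking through the walk table: entry [i] is adjacent to the entry before it and reached
    from [v] by a walk of length len - i. [cyc] restores the forward order. *)
Fixpoint cyc_rev (v len i : nat) : nat :=
  if i is i'.+1 then pick_last n (fun x => walk v (len - i) x && e x (cyc_rev v len i'))
  else v.

Definition cyc v len q := cyc_rev v len (len - q).

Section Cyc.
Variables (v len : nat).
Hypothesis Hv : walk v len v.

Lemma cyc_wk q : q <= len -> walk v q (cyc v len q).
Proof.
move=> Hq; rewrite /cyc -{1}(subKn Hq); move: (len - q) (leq_subr q len) => i.
elim: i => [|i IH] Hi; first by rewrite subn0.
have Hi' : i <= len by lia.
have := IH Hi'; rewrite (_ : len - i = (len - i.+1).+1); last by lia.
move=> H; suff /andP[] : (fun x => walk v (len - i.+1) x && e x (cyc_rev v len i)) (cyc_rev v len i.+1) by [].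
exact: (pick_lastP H).
Qed.

Lemma cyc_e q : q < len -> e (cyc v len q) (cyc v len q.+1).
Proof.
move=> Hq; have := cyc_wk Hq; rewrite /cyc (_ : len - q = (len - q.+1).+1); last by lia.
move: (len - q.+1) (subKn Hq) => i Ei; rewrite -Ei => H.
suff /andP[] : (fun x => walk v (len - i.+1) x && e x (cyc_rev v len i)) (cyc_rev v len i.+1) by [].
apply: (@pick_lastP n (fun x => walk v (len - i.+1) x && e x (cyc_rev v len i))).
by rewrite (_ : len - i = (len - i.+1).+1) in H; last by lia.
Qed.

Lemma cyc_len : cyc v len len = v. Proof. by rewrite /cyc subnn. Qed.

Lemma cyc_0 : cyc v len 0 = v.
Proof. by have /eqP := cyc_wk (leq0n len). Qed.

Lemma cyc_lt q : 0 < len -> q <= len -> cyc v len q < n.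
Proof.
move=> Hl Hq; case: (ltnP 0 q) => [H|]; first exact: walk_lt (cyc_wk Hq).
by rewrite leqn0 => /eqP->; rewrite cyc_0; apply: walk_lt Hv.
Qed.

Lemma cyc_arc p q : p <= q <= len -> walk (cyc v len p) (q - p) (cyc v len q).
Proof.
move=> /andP[/subnKC <-]; rewrite addKn; elim: (q - p) => [|d IH] H; first by rewrite addn0 /=.
apply/walkSP; exists (cyc v len (p + d)); first by apply: IH; lia.
by rewrite addnS; apply: cyc_e; lia.
Qed.

Hypothesis Hodd : odd len.
Hypothesis Hmin : forall u j, odd j -> walk u j u -> len <= j.

(** The walk followed by the arc back is an odd closed walk, and [len] is the least length of
    one. *)
Lemma arc_odd p q l : p <= q <= len -> walk (cyc v len p) l (cyc v len q) ->
  odd (l + (q - p)) -> len <= l + (q - p).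
Proof.
move=> Hpq Hl Ho; apply: (Hmin (u := cyc v len p)) => //.
exact: walk_cat Hl (walk_rev (cyc_arc Hpq)).
Qed.

(** Since [len] is odd, closing the walk through the complementary arc, of length len - (q - p),
    gives the other parity. *)
Lemma arc_even p q l : p <= q <= len -> walk (cyc v len p) l (cyc v len q) ->
  ~~ odd (l + (q - p)) -> q - p <= l.
Proof.
move=> /andP[Hpq Hq] Hl Ho; suff : len <= l + (len - q + p) by lia.
apply: (Hmin (u := cyc v len p)); first by lia.
apply: walk_cat Hl _; apply: (@walk_cat _ _ v).
  by rewrite -{2}cyc_len; apply: cyc_arc; rewrite Hq /=.
by apply: cyc_wk; lia.
Qed.

(** A repetition is a walk of length 0 between two positions; according to parity, one of the two
    arcs would be an odd closed walk that is too short. *)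
Lemma cyc_inj p q : p < q < len -> cyc v len p != cyc v len q.
Proof.
move=> /andP[Hp Hq]; apply/negP => /eqP E.
have W : walk (cyc v len p) 0 (cyc v len q) by rewrite /= E.
have Hpq : p <= q <= len by lia.
have := arc_odd Hpq W; have := arc_even Hpq W.
by case: (odd _) => /= H1 H2; [have := H2 isT | have := H1 isT]; lia.
Qed.

(** An edge is a walk of length 1. In the odd case the arc has length at least len - 1, which leaves
    only the closing edge; in the even case it has length 1. *)
Lemma cyc_chord p q : p < q < len -> e (cyc v len p) (cyc v len q) ->
  (q == p.+1) || ((p == 0) && (q == len.-1)).
Proof.
move=> /andP[Hp Hq] /walk1 W.
have Hpq : p <= q <= len by lia.
have := arc_odd Hpq W; have := arc_even Hpq W.
by case: (odd _) => /= H1 H2; [have := H2 isT | have := H1 isT]; lia.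
Qed.

End Cyc.

Fixpoint ball (z : pred nat) (i u : nat) : bool :=
  if i is i'.+1 then ball z i' u || has (fun x => ball z i' x && e x u) (iota 0 n)
  else z u.

(** Index [i] is the sphere of radius i + 1, the one entered by every edge that leaves the ball of
    radius [i]. *)
Definition layer z i u := ball z i.+1 u && ~~ ball z i u.

Lemma ball_le (z : pred nat) i j u : i <= j -> ball z i u -> ball z j u.
Proof. by move/subnK<-; elim: (j - i) => [|d IH] // /IH; rewrite addSn /= => ->. Qed.

Lemma ball_e (z : pred nat) i x u : ball z i x -> e x u -> ball z i.+1 u.
Proof.
move=> Hx He /=; apply/orP; right; apply/hasP; exists x; last by apply/andP.
by rewrite mem_iota add0n (e_lt He).
Qed.

Lemma ballP (z : pred nat) i u : reflect (exists x j, [/\ z x, j <= i & walk x j u]) (ball z i u).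
Proof.
apply: (iffP idP) => [|[x [j [Hz Hj Hw]]]].
  elim: i u => [|i IH] u /=; first by move=> Hu; exists u, 0; split=> //=.
  case/orP=> [/IH[x [j [Hz Hj Hw]]]|/hasP[y _ /andP[/IH[x [j [Hz Hj Hw]]] He]]].
    by exists x, j; split=> //; lia.
  by exists x, j.+1; split=> //; apply/walkSP; exists y.
apply: ball_le Hj _; elim: j u Hw => [|j IH] u; first by move=> /eqP->.
by case/walkSP=> y /IH Hy; apply: ball_e.
Qed.

End Walks.

(** * Induced odd cycle packings *)

Definition nat_adj n (G : sgraph n) : rel nat := fun x y =>
  [exists i : 'I_n, exists j : 'I_n, [&& val i == x, val j == y & G i j]].

Definition induced (g : rel nat) (a : pred nat) : rel nat :=
  fun x y => [&& a x, a y & g x y].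

Section Graph.
Variables (n : nat) (G : sgraph n).
Let g := nat_adj G.

Lemma nat_adj_ord (i j : 'I_n) : g (val i) (val j) = G i j.
Proof.
apply/existsP/idP => [[i' /existsP[j' /and3P[/eqP/val_inj-> /eqP/val_inj->]]]|H] //.
by exists i; apply/existsP; exists j; rewrite !eqxx.
Qed.

Lemma nat_adjP (x y : nat) : reflect (exists i j : 'I_n, [/\ x = i, y = j & G i j]) (g x y).
Proof.
apply: (iffP idP) => [/existsP[i /existsP[j /and3P[/eqP<- /eqP<- H]]]|[i [j [-> -> H]]]].
  by exists i, j.
by rewrite nat_adj_ord.
Qed.

Lemma nat_adj_sym : symmetric g.
Proof.
suff H x y : g x y -> g y x by move=> x y; apply/idP/idP; apply: H.
by case/nat_adjP=> i [j [-> -> H]]; rewrite nat_adj_ord adj_sym.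
Qed.

Lemma nat_adj_irr x : g x x = false.
Proof.
apply/negbTE/negP => /nat_adjP[i [j [-> /val_inj <-]]].
by rewrite adj_irr.
Qed.

Lemma nat_adj_lt x y : g x y -> x < n.
Proof. by case/nat_adjP=> i [j [-> _ _]]. Qed.

Lemma induced_sym a : symmetric (induced g a).
Proof. by move=> x y; rewrite /induced nat_adj_sym andbCA. Qed.

Lemma induced_lt a x y : induced g a x y -> x < n.
Proof. by case/and3P=> _ _ /nat_adj_lt. Qed.

(** Packings of the whole graph that lie inside [a]: this avoids renumbering the vertices of the
    induced subgraph to make it an [sgraph]. *)
Definition iocp_le (a : pred nat) k := forall P : {set {set 'I_n}},
  induced_odd_cycle_packing G P ->
  (forall A, A \in P -> forall x : 'I_n, x \in A -> a x) -> #|P| <= k.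

Lemma iocp_leT k : iocp G <= k -> iocp_le xpredT k.
Proof.
move=> Hk P HP _; apply: leq_trans Hk.
exact: (@leq_bigmax_cond _ _ (fun P : {set {set 'I_n}} => #|P|) _ HP).
Qed.

Lemma iocp_le_sub (a a' : pred nat) k :
  (forall x, a' x -> a x) -> iocp_le a k -> iocp_le a' k.
Proof. by move=> Ha H P HP HA; apply: H => // A HAP x Hx; apply/Ha/(HA A). Qed.

Section OddCycle.
Variables (A : {set 'I_n}).
Hypothesis HA : induces_odd_cycle G A.

Lemma ioc_tuple : exists s : seq 'I_n, [/\ uniq s, A =i s, 2 < size s, odd (size s) &
  forall x y, x \in s -> y \in s -> G x y = (y == next s x) || (x == next s y)].
Proof.
case/and3P: HA => H2 Ho /existsP[s /and3P[Hu /eqP HAs /forallP H]].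
have HAi x : x \in A = (x \in (s : seq _)) by rewrite {1}HAs inE.
exists s; rewrite size_tuple; split=> // x y Hx Hy.
have := H x; rewrite HAi Hx => /forallP/(_ y).
by rewrite HAi Hy => /eqP.
Qed.

Lemma ioc_nbr x : x \in A -> exists2 y, y \in A & G x y.
Proof.
case: ioc_tuple => s [Hu HAs _ _ H] Hx.
exists (next s x); first by rewrite HAs mem_next -HAs.
by rewrite H ?mem_next -?HAs ?eqxx.
Qed.

Lemma ioc_wk (a : pred nat) x : (forall y : 'I_n, y \in A -> a y) -> x \in A ->
  exists2 j, odd j & walk n (induced g a) x j x.
Proof.
case: ioc_tuple => s [Hu HAs Hs Ho H] Ha Hx.
exists (size s) => //.
have Hc : fcycle (next s) s by apply: cycle_next.
have He : cycle (induced g a) (map val s).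
  rewrite cycle_map; apply: (@sub_in_cycle _ (mem s) (frel (next s))) Hc; last exact/allP.
  move=> y z Hy Hz /= /eqP E; rewrite /induced /= !Ha ?HAs //= nat_adj_ord.
  by rewrite H // E eqxx.
have := Hx; rewrite HAs => Hxs.
have Hvs : val x \in map val s by apply: map_f.
case: (rot_to Hvs) => i p Ep.
move: He; rewrite -(rot_cycle i) Ep /= => /path_wk.
rewrite last_rcons size_rcons => /(_ n (@induced_lt a)).
have -> : (size p).+1 = size s.
  by have := size_rot i (map val s); rewrite Ep size_map.
by [].
Qed.
End OddCycle.

(** [A0] can be added to every packing inside [a']; the empty packing already yields 0 < k. *)
Lemma packing_extend (a a' : pred nat) k (A0 : {set 'I_n}) :
  induces_odd_cycle G A0 -> (forall x : 'I_n, x \in A0 -> a x) ->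
  (forall x u : 'I_n, x \in A0 -> a' u -> ~~ G x u) ->
  (forall x, a' x -> a x) -> iocp_le a k -> 0 < k /\ iocp_le a' k.-1.
Proof.
move=> HA0 Ha0 Hn Ha' Hk.
have Main P : induced_odd_cycle_packing G P ->
    (forall A, A \in P -> forall x : 'I_n, x \in A -> a' x) -> #|P| < k.
  case/and3P=> /forallP Hioc /trivIsetP Htriv /forallP Hadj HP.
  have Hioc' A : A \in P -> induces_odd_cycle G A by apply/implyP.
  (* A common vertex would be adjacent to its neighbour on the cycle [A0], although no edge joins
     [A0] to [a']. *)
  have Hdis A x : A \in P -> x \in A -> x \notin A0.
    move=> HAP Hx; apply/negP => Hx0.
    have [y Hy Hxy] := ioc_nbr HA0 Hx0.
    by have := Hn y x Hy (HP A HAP x Hx); rewrite adj_sym Hxy.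
  have HA0P : A0 \notin P.
    apply/negP => H; case/and3P: HA0 => H2 _ _.
    have /card_gt0P[x Hx] : 0 < #|A0| by lia.
    by move: (Hdis A0 x H Hx); rewrite Hx.
  have <- : #|A0 |: P| = #|P|.+1 by rewrite cardsU1 HA0P.
  apply: Hk; last first.
    move=> A; rewrite !inE => /orP[/eqP->|HAP] x Hx; first exact: Ha0.
    exact/Ha'/(HP A).
  apply/and3P; split.
  - apply/forallP => A; apply/implyP; rewrite !inE => /orP[/eqP->|] //; exact: Hioc'.
  - apply/trivIsetP => A B; rewrite !inE => /orP[/eqP->|HAP] /orP[/eqP->|HBP].
    + by rewrite eqxx.
    + move=> _; rewrite disjoint_sym; apply/pred0P => x /=; apply/negP => /andP[Hx].
      by apply/negP; apply: Hdis Hx.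
    + move=> _; apply/pred0P => x /=; apply/negP => /andP[Hx].
      by apply/negP; apply: Hdis Hx.
    + exact: Htriv.
  - apply/forallP => A; apply/implyP; rewrite !inE => HAP.
    apply/forallP => B; apply/implyP; rewrite !inE => HBP; apply/implyP => HAB.
    apply/forallP => x; apply/implyP => Hx; apply/forallP => y; apply/implyP => Hy.
    case/orP: HAP => [/eqP EA|HAP]; case/orP: HBP => [/eqP EB|HBP].
    + by rewrite EA EB eqxx in HAB.
    + by apply: Hn (HP B HBP y Hy); rewrite -EA.
    + by rewrite adj_sym; apply: Hn (HP A HAP x Hx); rewrite -EB.
    + have := Hadj A; rewrite HAP => /forallP/(_ B); rewrite HBP HAB.
      by move=> /forallP/(_ x); rewrite Hx => /forallP/(_ y); rewrite Hy.
split; last by move=> P H1 H2; have := Main P H1 H2; lia.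
suff : #|(set0 : {set {set 'I_n}})| < k by lia.
apply: Main => [|A]; last by rewrite inE.
apply/and3P; split.
- by apply/forallP => A; rewrite inE.
- by apply/trivIsetP => A B; rewrite inE.
- by apply/forallP => A; rewrite inE.
Qed.

Section MinWalk.
Variables (a : pred nat) (v len : nat).
Let e := induced g a.
Hypothesis Hv : walk n e v len v.
Hypothesis Hodd : odd len.
Hypothesis Hmin : forall u j, odd j -> walk n e u j u -> len <= j.
Let c := cyc n e v len.

Let es : symmetric e := @induced_sym a.
Let el : forall x y, e x y -> x < n := @induced_lt a.

Lemma len_gt2 : 2 < len.
Proof.
suff : len <> 1 by move: Hodd; case: len => [|[|[]]].
move=> E; have E0 : cyc n e v len 0 = v := cyc_0 Hv.
have E1 : cyc n e v len 1 = v by rewrite -[in X in cyc _ _ _ _ X]E cyc_len.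
have := cyc_e Hv (q := 0); rewrite E0 E1 E => /(_ isT).
by rewrite /e /induced nat_adj_irr !andbF.
Qed.

Lemma c_lt q : q <= len -> c q < n.
Proof. by move=> Hq; apply: (cyc_lt es el Hv) => //; have := len_gt2; lia. Qed.

Lemma c_e q : q < len -> e (c q) (c q.+1).
Proof. exact: cyc_e. Qed.

Lemma c_a q : q <= len -> a (c q).
Proof.
move=> Hq; case: (ltnP q len) => [/c_e/and3P[]//|H].
have -> : q = len.-1.+1 by lia.
by have /c_e/and3P[] : len.-1 < len by lia.
Qed.

Lemma v_lt : v < n.
Proof. by have := c_lt (leqnn len); rewrite /c cyc_len. Qed.

Definition cycset : {set 'I_n} := [set x : 'I_n | has (fun q => c q == x) (iota 0 len)].

Lemma cycsetP (x : 'I_n) : reflect (exists2 q, q < len & c q = x) (x \in cycset).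
Proof.
rewrite inE; apply: (iffP hasP) => [[q]|[q Hq E]].
  by rewrite mem_iota => Hq /eqP; exists q.
by exists q; rewrite ?mem_iota ?E.
Qed.

(** The minimality of [len] excludes repetitions and chords alike, so a shortest odd closed walk
    runs around an induced cycle. *)
Lemma cycset_ioc : induces_odd_cycle G cycset.
Proof.
pose o q : 'I_n := insubd (Ordinal v_lt) (c q).
have oE q : q < len -> val (o q) = c q.
  by move=> Hq; rewrite /o val_insubd c_lt // ltnW.
pose s := [seq o q | q <- iota 0 len].
have ss : size s = len by rewrite size_map size_iota.
have us : uniq s.
  rewrite map_inj_in_uniq ?iota_uniq // => p q.
  rewrite !mem_iota !add0n /= => Hp Hq E.
  have {}E : c p = c q by rewrite -!oE // E.
  case: (ltngtP p q) => // H.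
    by have := @cyc_inj _ _ es el _ _ Hv Hodd Hmin p q; rewrite H Hq -/c E eqxx => /(_ isT).
  by have := @cyc_inj _ _ es el _ _ Hv Hodd Hmin q p; rewrite H Hp -/c E eqxx => /(_ isT).
have sE x : (x \in cycset) = (x \in s).
  apply/cycsetP/mapP => [[q Hq E]|[q]].
    by exists q; rewrite ?mem_iota //; apply: val_inj; rewrite oE.
  by rewrite mem_iota => Hq ->; exists q; rewrite ?oE.
have cs : #|cycset| = len by rewrite (eq_card sE) (card_uniqP us).
have nxt q : q < len -> next s (o q) = o (if q.+1 < len then q.+1 else 0).
  move=> Hq; have l0 : 0 < len by lia.
  have nthE i : i < len -> nth (o 0) s i = o i.
    by move=> Hi; rewrite (nth_map 0) ?size_iota // nth_iota.
  rewrite next_nth; have -> : o q \in s by apply: map_f; rewrite mem_iota.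
  have Es : s = o 0 :: behead s by rewrite /s; case: (len) l0.
  have -> : index (o q) s = q by rewrite -{1}nthE // index_uniq // ss.
  rewrite {1}Es; case: ifP => Hq1; rewrite nth_behead; first exact: nthE.
  by rewrite nth_default // ss leqNgt Hq1.
have GE p q : p < q < len -> G (o p) (o q) = (q == p.+1) || ((p == 0) && (q == len.-1)).
  move=> /andP[Hp Hq]; rewrite -nat_adj_ord !oE //; last by lia.
  apply/idP/idP => [Hg|].
    apply: (@cyc_chord _ _ es el _ _ Hv Hodd Hmin); rewrite ?Hp //.
    by rewrite /e /induced -/c !c_a //; lia.
  case/orP=> [/eqP->|/andP[/eqP-> /eqP->]].
    by have /c_e/and3P[] : p < len by lia.
  rewrite nat_adj_sym; have /c_e/and3P[_ _] : len.-1 < len by lia.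
  rewrite prednK /c; last by lia.
  by rewrite cyc_len (cyc_0 Hv).
apply/and3P; rewrite cs; split; [exact: len_gt2|exact: Hodd|].
have st : size s == #|cycset| by rewrite ss cs.
rewrite -{}cs; apply/existsP; exists (Tuple st); rewrite /= us /=; apply/andP; split.
  by apply/eqP/setP => x; rewrite sE inE.
apply/forallP => x; apply/implyP; rewrite sE => /mapP[p].
rewrite mem_iota add0n => /= Hp ->.
apply/forallP => y; apply/implyP; rewrite sE => /mapP[q].
rewrite mem_iota add0n => /= Hq ->.
have oI i j : i < len -> j < len -> (o i == o j) = (i == j).
  move=> Hi Hj; apply/eqP/eqP => [E|->] //.
  have := us; have /(_ i j) := @uniqP _ (o 0) s us; rewrite !inE ss => /(_ Hi Hj).
  by rewrite !(nth_map 0) ?size_iota // !nth_iota // !add0n => /(_ E) -> _.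
have H2 := len_gt2.
rewrite !nxt // !oI //; try by case: ifP; lia.
case: (ltngtP p q) => Hpq.
- rewrite GE ?Hpq //; apply/eqP; do 2!case: ifP; lia.
- rewrite adj_sym GE ?Hpq //; apply/eqP; do 2!case: ifP; lia.
- rewrite Hpq adj_irr; apply/eqP; case: ifP; lia.
Qed.

Lemma cycset_a (x : 'I_n) : x \in cycset -> a x.
Proof. by case/cycsetP=> q Hq <-; apply: c_a; apply: ltnW. Qed.

Lemma iocp_short (a' : pred nat) k :
  (forall x, a' x -> a x) -> (forall q u, q < len -> a' u -> ~~ g (c q) u) ->
  iocp_le a k -> 0 < k /\ iocp_le a' k.-1.
Proof.
move=> Ha' Hn; apply: packing_extend cycset_ioc cycset_a _ Ha'.
by move=> x u /cycsetP[q Hq E] Hu; rewrite -nat_adj_ord /= -E; apply: Hn.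
Qed.

(* What is left around the cycle is coloured by the parity of the distance to
   [v] near [v], and by that of the position on the cycle plus the distance to
   it elsewhere; a monochromatic edge would give an odd closed walk shorter
   than [len]. *)
Section Long.
Variables (D L d b : nat) (a' : pred nat).
Hypotheses (HL : 10 * D <= L) (Hlen : L <= len) (Hd : d < D) (Hb : b < D).
Let zC : pred nat := fun u => has (fun q => c q == u) (iota 0 len).
Hypothesis Ha' : forall u, a' u ->
  [&& a u, ~~ layer n e zC d u & ~~ layer n e (pred1 v) (3 * D + b) u].

Let e' := induced g a'.
Lemma e'_e x y : e' x y -> e x y.
Proof. by case/and3P=> /Ha'/and3P[Hx _ _] /Ha'/and3P[Hy _ _] Hg; apply/and3P. Qed.

Let near u := ball n e (pred1 v) (3 * D + b) u.
Let ins u := ball n e zC d u.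
(** Existence of an odd representation rather than the parity of a chosen one: if none is odd, all
    are even, so [nearP] and [farP] always supply one of parity [f u]. *)
Let f u := if near u then has (fun j => walk n e v j u && odd j) (iota 0 (3 * D + b).+1)
  else has (fun q => has (fun j => walk n e (c q) j u && odd (q + j)) (iota 0 d.+1)) (iota 0 len).

(** The only way out of the ball is through the sphere that [a'] avoids; [ins_e] holds for the same
    reason. *)
Lemma near_e x u : e' x u -> near x -> near u.
Proof.
move=> He Hx; have := ball_e el Hx (e'_e He).
by case/and3P: He => _ /Ha'/and3P[_ _]; rewrite /layer negb_and negbK => /orP[/negPf->|].
Qed.

Lemma ins_e x u : e' x u -> ins x -> ins u.
Proof.
move=> He Hx; have := ball_e el Hx (e'_e He).
by case/and3P: He => _ /Ha'/and3P[_ H _]; move: H; rewrite /layer negb_and negbK => /orP[/negPf->|].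
Qed.

Lemma nearP u : near u -> exists j, [/\ j <= 3 * D + b, walk n e v j u & odd j = f u].
Proof.
move=> Hu; rewrite /f Hu; case: hasP => [[j]|Hn].
  by rewrite mem_iota => Hj /andP[Hw Ho]; exists j; split; rewrite ?Ho //; lia.
case/(ballP el): Hu => x [j [/eqP-> Hj Hw]]; exists j; split=> //.
by apply/negP => Ho; case: Hn; exists j; rewrite ?mem_iota ?Hw.
Qed.

Lemma farP u : ins u -> ~~ near u -> exists q j,
  [/\ q < len, j <= d, walk n e (c q) j u & odd (q + j) = f u].
Proof.
move=> Hi Hu; rewrite /f (negPf Hu); case: hasP => [[q]|Hn].
  rewrite mem_iota => Hq /hasP[j]; rewrite mem_iota => Hj /andP[Hw Ho].
  by exists q, j; split; rewrite ?Ho //; lia.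
case/(ballP el): Hi => x [j [/hasP[q]]]; rewrite mem_iota => Hq /eqP Ex Hj Hw.
exists q, j; split=> //; first by rewrite Ex.
apply/negP => Ho; case: Hn; exists q; first by rewrite mem_iota.
by apply/hasP; exists j; rewrite ?mem_iota // Ex Hw.
Qed.

(** Origin of the radius 3D. Equal parities make the walk closed by the arc odd, so q' - q >= len -
    1 - j - j', which forces q <= j + j' <= 2d; hence [u] is reached from [v] in q + j <= 3d
    steps. *)
Lemma far_arc q q' j j' u u' : q <= q' -> q' < len -> j <= d -> j' <= d ->
  walk n e (c q) j u -> walk n e (c q') j' u' -> e u u' -> odd (q + j) = odd (q' + j') ->
  near u.
Proof.
move=> Hqq Hq' Hj Hj' Hw Hw' He Ho.
have W : walk n e (c q) (j + (1 + j')) (c q').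
  apply: (walk_cat el Hw); apply: (walk_cat el (walk1 el He)).
  exact: walk_rev Hw'.
have Hl := @arc_odd _ _ es el _ _ Hv Hmin q q' _ _ W.
have {}Hl : len <= j + (1 + j') + (q' - q) by apply: Hl; lia.
apply/(ballP el); exists v, (q + j); split; rewrite /= ?eqxx //; first by lia.
by apply: (walk_cat el) Hw; apply: cyc_wk => //; lia.
Qed.

Lemma f_e u u' : ins u -> e' u u' -> ins u' /\ f u' = ~~ f u.
Proof.
move=> Hi He; have Hi' := ins_e He Hi; split=> //.
have He1 := e'_e He.
have He' : e' u' u by rewrite /e' induced_sym.
suff E : f u <> f u' by case: (f u) (f u') E => [] [].
move=> E; case Hu: (near u).
  have [j [Hj Hw Ho]] := nearP Hu.
  have [j' [Hj' Hw' Ho']] := nearP (near_e He Hu).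
  have W : walk n e v (j + (1 + j')) v.
    apply: (walk_cat el Hw); apply: (walk_cat el (walk1 el He1)).
    exact: walk_rev Hw'.
  (* Both lengths are at most 3D + b < 4D, so this odd closed walk is shorter than 8D < L. *)
  have : len <= j + (1 + j') by apply: Hmin W; lia.
  lia.
have Hu' : ~~ near u' by apply/negP => /(near_e He'); rewrite Hu.
have [q [j [Hq Hj Hw Ho]]] := farP Hi (negbT Hu).
have [q' [j' [Hq' Hj' Hw' Ho']]] := farP Hi' Hu'.
case: (leqP q q') => Hqq.
  by have := far_arc Hqq Hq' Hj Hj' Hw Hw' He1; rewrite Hu Ho Ho' E => /(_ erefl).
have He1' := e'_e He'.
have := far_arc (ltnW Hqq) Hq Hj' Hj Hw' Hw He1'.
by rewrite (negPf Hu') Ho Ho' E => /(_ erefl).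
Qed.

(** On [ins] the colour [f] alternates along edges, so no odd cycle inside [a'] meets [ins]. A
    packing therefore lies in [a2], where no neighbour of the cycle is left, and [iocp_short]
    applies. *)
Lemma iocp_long k : iocp_le a k -> 0 < k /\ iocp_le a' k.-1.
Proof.
move=> Hk; pose a2 u := a' u && ~~ ins u.
have [||k0 H2] := @iocp_short a2 k _ _ Hk.
- by move=> x /andP[/Ha'/and3P[]].
- move=> q u Hq /andP[Hau /negP Hi]; apply/negP => Hg; apply: Hi.
  apply/(ballP el).
  have Hz q' : q' < len -> zC (c q').
    by move=> Hq'; apply/hasP; exists q'; rewrite ?mem_iota //=.
  have He : e (c q) u.
    by rewrite /e /induced c_a ?(ltnW Hq) //=; case/and3P: (Ha' Hau) => ->.
  move: Hau => /Ha'/and3P[_ Hl _].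
  (* For d = 0 the deleted sphere consists of the neighbours of the cycle, so a surviving neighbour
     must lie on the cycle itself. *)
  case: (posnP d) => [d0|dpos]; last first.
    by exists (c q), 1; split; [exact: Hz|exact: dpos|exact: walk1].
  move: Hl; rewrite d0 /layer; rewrite negb_and negbK.
  rewrite (@ball_e _ _ el zC 0 (c q) u (Hz q Hq) He) /= => Hz'.
  by exists u, 0; split=> //=.
split=> // P HP Ha; apply: H2 => // A HAP x Hx; rewrite /a2 (Ha A) //=.
apply/negP => Hi.
have [j Ho Hw] := ioc_wk (let: And3 H _ _ := and3P HP in implyP (forallP H A) HAP) (Ha A HAP) Hx.
have alt i u : walk n e' x i u -> ins u /\ f u = f x (+) odd i.
  elim: i u => [|i IH] u; first by move=> /eqP->; rewrite addbF.
  case/(walkSP (@induced_lt a'))=> y /IH[Hy Ey] He.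
  by have [Hu ->] := f_e Hy He; rewrite Ey /= addbN.
by have [_] := alt _ _ Hw; rewrite Ho; case: (f x).
Qed.
End Long.
End MinWalk.

(** A shortest odd closed walk would give a packing with one member. *)
Lemma iocp0_no_odd (a : pred nat) v len : iocp_le a 0 -> walk n (induced g a) v len v -> ~~ odd len.
Proof.
move=> Hk Hw; apply/negP => Ho.
pose P l := odd l && has (fun u => walk n (induced g a) u l u) (iota 0 n).
have Hex : exists l, P l.
  exists len; rewrite /P Ho; apply/hasP; exists v => //.
  have := walk_lt (@induced_sym a) (@induced_lt a) _ Hw; rewrite mem_iota add0n; apply.
  by case: len Ho {Hw}.
case: (ex_minnP Hex) => m /andP[Hm /hasP[u _ Hu]] Hmin.
have Hmin' x j : odd j -> walk n (induced g a) x j x -> m <= j.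
  move=> Hj Hx; apply: Hmin; rewrite /P Hj; apply/hasP; exists x => //.
  have := walk_lt (@induced_sym a) (@induced_lt a) _ Hx; rewrite mem_iota add0n; apply.
  by case: j Hj {Hx}.
by have [] := @iocp_short a u m Hu Hm Hmin' (fun x => false) 0 _ _ Hk.
Qed.
End Graph.

(** * Approximate independent sets in bipartite graphs *)

Lemma pigeon (D n : nat) (f : nat -> nat) : 0 < D -> \sum_(0 <= i < D) f i <= n ->
  exists2 i, i < D & D * f i <= n.
Proof.
move=> HD Hs; case: (boolP (has (fun i => D * f i <= n) (iota 0 D))) => [/hasP[i]|/hasPn Hn].
  by rewrite mem_iota => Hi Hf; exists i.
have : \sum_(0 <= i < D) n.+1 <= \sum_(0 <= i < D) D * f i.
  rewrite big_seq_cond [X in _ <= X]big_seq_cond; apply: leq_sum => i.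
  rewrite andbT mem_index_iota => Hi.
  by have := Hn i; rewrite mem_iota Hi -ltnNge => ->.
rewrite sum_nat_const_nat subn0 -big_distrr /= leq_mul2l.
by lia.
Qed.

Lemma sum_count_disj (T : Type) (D : nat) (P : nat -> pred T) (Q : pred T) s :
  (forall x i j, P i x -> P j x -> i = j) -> (forall i x, P i x -> Q x) ->
  \sum_(0 <= i < D) count (P i) s <= count Q s.
Proof.
move=> Hd HQ; elim: s => [|x s IH] /=; first by rewrite big1.
rewrite big_split /=; apply: leq_add IH.
elim: D => [|D IH]; first by rewrite big_nil.
rewrite big_nat_recr //=; case HD: (P D x); last by rewrite addn0.
rewrite big_nat_cond big1 ?(HQ _ _ HD) // => i /andP[/andP[_ Hi] _].
by case Hx: (P i x) => //; have := Hd _ _ _ HD Hx; lia.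
Qed.

Lemma count_split (T : Type) (P Q : pred T) s :
  count Q s = count (fun x => P x && Q x) s + count (fun x => ~~ P x && Q x) s.
Proof. by elim: s => //= x s ->; case: (P x) => /=; lia. Qed.

Lemma count_le_map (P Q : pred nat) (f : nat -> nat) s : uniq s ->
  (forall x y, x \in s -> y \in s -> P x -> P y -> f x = f y -> x = y) ->
  (forall x, x \in s -> P x -> (f x \in s) && Q (f x)) ->
  count P s <= count Q s.
Proof.
move=> Hu Hf HQ; rewrite -!size_filter -(size_map f (filter P s)); apply: uniq_leq_size.
  rewrite map_inj_in_uniq ?filter_uniq // => x y; rewrite !mem_filter.
  by move=> /andP[Px xs] /andP[Py ys]; apply: Hf.
move=> y /mapP[x]; rewrite !mem_filter => /andP[Px xs] ->.
by rewrite andbC HQ.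
Qed.

(** Spheres of different radii are disjoint, so D of them share at most n vertices. *)
Lemma exists_light_layer n e (z I : pred nat) (D s : nat) : 0 < D ->
  exists2 d, d < D & D * count (fun u => I u && layer n e z (s + d) u) (iota 0 n) <= n.
Proof.
move=> HD; apply: pigeon => //; apply: leq_trans (sum_count_disj (Q := xpredT) _ _ _ _) _ => //.
  suff H x i j : i < j -> ~~ (layer n e z (s + i) x && layer n e z (s + j) x).
    move=> x i j /andP[_ Hi] /andP[_ Hj].
    by case: (ltngtP i j) => // /(H x); rewrite Hi Hj.
  move=> Hij; apply/negP => /andP[/andP[Hi _] /andP[_ /negP[]]].
  by apply: ball_le Hi; lia.
by rewrite count_predT size_iota.
Qed.

(* [D - lev] are the prices at the end of an auction in which the vertices of
   colour 0 bid for those of colour 1, and [mate] the matching.  The threshold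
   [th] turns it into an independent set, which loses only the matched pairs
   whose price is at the threshold. *)
Section Konig.
Variables (n D : nat) (g : rel nat) (a I : pred nat) (col mate lev : nat -> nat).
Hypotheses (g_sym : symmetric g) (g_lt : forall x y, g x y -> x < n).
Let e := induced g a.
Hypothesis a_col : forall x y, e x y ->
  ((col x == 0) && (col y == 1)) || ((col x == 1) && (col y == 0)).
Hypothesis I_ind : forall x y, I x -> I y -> ~~ g x y.

(** Unmatched is encoded by [mate x] >= n; a matching edge is recorded only at its end of colour
    0. *)
Definition mate_ok := forall x, x < n -> mate x < n -> e x (mate x) /\ col x = 0.
Definition mate_inj := forall x x', x < n -> x' < n -> mate x < n -> mate x = mate x' -> x = x'.
Definition lev_ok := forall y, y < n -> lev y < D -> exists2 x, x < n & mate x = y.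
(** The slackness condition of the auction: the mate had the largest level among the neighbours of
    [x] and lost one unit by the bid; other levels only fall, and its own falls again only when [x]
    is displaced. *)
Definition mate_lev := forall x y, x < n -> mate x < n -> e x y -> lev y <= lev (mate x) + 1.
Definition mate_end := forall x y, e x y -> col x = 0 -> n <= mate x -> lev y = 0.

Definition candidate (th u : nat) := a u &&
  (if col u == 1 then th < lev u else ~~ has (fun y => e u y && (th < lev y)) (iota 0 n)).

Let es x y : e x y = e y x. Proof. by rewrite /e /induced g_sym andbCA. Qed.
Let el x y : e x y -> y < n. Proof. by rewrite es => /and3P[_ _ /g_lt]. Qed.

Lemma cand_ind th x y : candidate th x -> candidate th y -> ~~ g x y.
Proof.
move=> /andP[Hx Cx] /andP[Hy Cy]; apply/negP => Hg.
have He : e x y by rewrite /e /induced Hx Hy.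
have Hyx : e y x by rewrite es.
case/orP: (a_col He) => /andP[/eqP Ex /eqP Ey].
  move: Cx Cy; rewrite Ex Ey /= => /hasPn/(_ y); rewrite mem_iota add0n (el He) He /=.
  by move=> /(_ isT)/negPf->.
move: Cx Cy; rewrite Ex Ey /= => Hl /hasPn/(_ x); rewrite mem_iota add0n (el Hyx) Hyx Hl /=.
by move=> /(_ isT).
Qed.

Hypotheses (H1 : mate_ok) (H2 : mate_inj) (H3 : lev_ok) (H4 : mate_lev) (H5 : mate_end).
Let mt x := mate x < n.

(** Each matching edge has an end outside [I]: [x] is sent to its mate if it lies in [I] and to
    itself otherwise, injectively. *)
Lemma ind_matching : count (fun u => I u && a u) (iota 0 n) + count mt (iota 0 n)
  <= count a (iota 0 n).
Proof.
rewrite (count_split I a).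
rewrite leq_add2l; apply: (@count_le_map _ _ (fun x => if I x then mate x else x)).
- exact: iota_uniq.
- move=> x y; rewrite !mem_iota !add0n /= => Hx Hy Mx My.
  have [Ex Cx] := H1 Hx Mx; have [Ey Cy] := H1 Hy My.
  case: (I x); case: (I y) => E //.
  + exact: (H2 Hx Hy Mx E).
  + by move: (a_col Ex); rewrite E Cx Cy.
  + by move: (a_col Ey); rewrite -E Cx Cy.
- move=> x; rewrite !mem_iota !add0n /= => Hx Mx; have [Ex Cx] := H1 Hx Mx.
  case/and3P: (Ex) => ax am gx.
  case Ix: (I x); rewrite ?Ix ?Hx //= (el Ex) am andbT /=.
  by apply/negP => Im; have := I_ind Ix Im; rewrite gx.
Qed.

(** All cover vertices are matched: those of colour 1 by [lev_ok], their level being below D, those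
    of colour 0 by [mate_end], as they see a positive level. An edge counts twice only if lev (mate
    x) <= th < lev y <= lev (mate x) + 1, so its level is exactly [th]. *)
Lemma cover_le th : th < D ->
  count (fun u => a u && ~~ candidate th u) (iota 0 n) <=
  count mt (iota 0 n) + count (fun x => mt x && (lev (mate x) == th)) (iota 0 n).
Proof.
move=> Hth.
pose A x := mt x && (lev (mate x) <= th).
pose B x := mt x && has (fun y => e x y && (th < lev y)) (iota 0 n).
apply: (@leq_trans (count A (iota 0 n) + count B (iota 0 n))).
  rewrite -!size_filter -(size_map mate (filter A _)) -size_cat.
  apply: uniq_leq_size; first by rewrite filter_uniq ?iota_uniq.
  move=> u; rewrite mem_filter mem_iota add0n mem_cat => /andP[/andP[au]].
  rewrite /candidate au /=; case: ifP => Cu.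
    rewrite -leqNgt => Hl Hu; apply/orP; left.
    have [|x Hx Ex] := H3 Hu; first by lia.
    by apply/mapP; exists x; rewrite // mem_filter mem_iota /A /mt Ex Hu Hl Hx.
  rewrite negbK => Hb Hu; apply/orP; right.
  rewrite mem_filter mem_iota Hu /B Hb !andbT /mt.
  case/hasP: Hb => y _ /andP[He Hl]; rewrite ltnNge; apply/negP => Hm.
  have C0 : col u = 0 by case/orP: (a_col He) => /andP[/eqP E _] //; rewrite E in Cu.
  by rewrite (H5 He C0 Hm) in Hl.
rewrite -count_predUI; apply: leq_add.
  by apply: sub_count => x /= /orP[] /andP[].
have Hs : {in iota 0 n, forall x, predI A B x -> mt x && (lev (mate x) == th)}.
  move=> x; rewrite mem_iota add0n /= => Hx /andP[/andP[Mx Hl] /andP[_ /hasP[y _ /andP[He Hy]]]].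
  by rewrite Mx /=; have := H4 Hx Mx He; lia.
rewrite -!size_filter; apply: uniq_leq_size; first by rewrite filter_uniq ?iota_uniq.
by move=> x; rewrite !mem_filter => /andP[Hx Hi]; rewrite Hi andbT; apply: Hs.
Qed.

(** Distinct thresholds double-count disjoint sets of edges, so for one of the D thresholds at most
    n/D edges count twice. *)
Lemma konig : 0 < D -> exists2 th, th < D &
  D * count (fun u => I u && a u) (iota 0 n) <= D * count (candidate th) (iota 0 n) + n.
Proof.
move=> HD.
have [|th Hth Hl] := @pigeon D n (fun th => count (fun x => mt x && (lev (mate x) == th)) (iota 0 n)) HD.
  apply: leq_trans (sum_count_disj (Q := xpredT) _ _ _ _) _ => //.
    by move=> x i j /andP[_ /eqP->] /andP[_ /eqP->].
  by rewrite count_predT size_iota.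
exists th => //.
have Hc : count a (iota 0 n) = count (candidate th) (iota 0 n) +
    count (fun u => a u && ~~ candidate th u) (iota 0 n).
  rewrite (count_split (candidate th) a); congr addn; apply: eq_count => u /=; last exact: andbC.
  by apply: andb_idr => /andP[].
have := ind_matching; have := cover_le Hth; rewrite {}Hc => Hb Ha.
apply: leq_trans (leq_add (leqnn _) Hl); rewrite -mulnDr leq_mul2l; lia.
Qed.
End Konig.

(** * The program *)

#[local] Arguments run : simpl never.

Local Notation "p ;; q" := (SSeq p q) (at level 60, right associativity).
Local Notation "# x" := (HV x) (at level 1, x at level 0).
Local Notation eadd := (HB Defs.Add).
Local Notation esub := (HB Defs.Sub).
Local Notation emul := (HB Defs.Mul).
Local Notation emod := (HB Defs.Mod).
Local Notation elt := (HB Defs.Lt).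
Local Notation eeq := (HB Defs.Eq).

Lemma run_seq p q s : run (p ;; q) s = run q (run p s). Proof. by []. Qed.
Lemma run_set x e s : run (SSet x e) s = setv s x (hev s e). Proof. by []. Qed.
Lemma run_put a i e s : run (SPut a i e) s = seta s a (hev s i) (hev s e). Proof. by []. Qed.
Lemma run_nop s : run SNop s = s. Proof. by []. Qed.
Lemma run_if e p q s : run (SIf e p q) s = if hev s e == 0 then run q s else run p s.
Proof. by []. Qed.

(** The loop rule with the frame built in: the step may assume that whatever the body syntactically
    preserves still has its value from before the loop. *)
Lemma for_frame (I : nat -> hstate -> Prop) x y p s :
  I 0 s ->
  (forall i s', i < vs s y -> (forall z, keepv z (SFor x y p) -> vs s' z = vs s z) ->
     (forall b, keepa b p -> ar s' b = ar s b) -> I i s' ->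
     I i.+1 (run p (setv s' x i))) ->
  I (vs s y) (run (SFor x y p) s).
Proof.
move=> H0 HS; rewrite run_for.
pose J i s' := [/\ forall z, keepv z (SFor x y p) -> vs s' z = vs s z,
   forall b, keepa b p -> ar s' b = ar s b & I i s'].
have JS i s' : i < vs s y -> J i s' -> J i.+1 (run p (setv s' x i)).
  move=> Hi [Hv Ha HI]; split; last exact: HS.
  - move=> z Hz; have /andP[/negPf Ez Kz] := Hz.
    by rewrite run_keepv //= Ez Hv.
  - by move=> b Hb; rewrite run_keepa // Ha.
suff [] : J (vs s y) (fiter x p s (vs s y)) by [].
have: vs s y <= vs s y by [].
elim: {1 3 4}(vs s y) => [|i IH] Hi; first by split.
by rewrite fiterS; apply: JS => //; apply/IH/ltnW.
Qed.

(* The read-only variables 0, ..., 13 hold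
   n, k, t, n^2, D, L, S, R, 2h+1, B, n+1, 4D, 3D, Q. *)
Local Notation xn := 0. Local Notation xk := 1. Local Notation xD := 4.
Local Notation xL := 5. Local Notation xS := 6. Local Notation xR := 7. Local Notation xH := 8.
Local Notation xN := 10. Local Notation xD4 := 11. Local Notation xD3 := 12. Local Notation xQ := 13.
Local Notation xu := 20. Local Notation xx := 21. Local Notation xv := 22. Local Notation xj := 23.
Local Notation xacc := 24. Local Notation xlen := 25. Local Notation xv0 := 26. Local Notation xp := 27.
Local Notation xcur := 28. Local Notation xnxt := 29. Local Notation xptr := 30. Local Notation xjj := 31.
Local Notation xdd := 32. Local Notation xbb := 33. Local Notation xg := 34. Local Notation xi := 35.
Local Notation xq := 36. Local Notation xbl := 37. Local Notation xbx := 38. Local Notation xby := 39.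
Local Notation xth := 40. Local Notation xflag := 41. Local Notation xcnt := 42. Local Notation xbc := 43.
Local Notation xtr := 44. Local Notation xy := 45. Local Notation xsm := 46. Local Notation xi2 := 47.
Local Notation aADJ := 0. Local Notation aRND := 1. Local Notation aA := 2. Local Notation aW := 3.
Local Notation aCYC := 4. Local Notation aCOL := 5. Local Notation aMATE := 6. Local Notation aLEV := 7.
Local Notation aCAND := 8. Local Notation aBEST := 9. Local Notation aZ := 10. Local Notation aZN := 11.
Local Notation aDEL := 12.

Definition ro : pred nat := fun x => x < 20.

Definition eidx x u := eadd (emul x #xn) u.
(** Flags are 0 or 1, so products serve as conjunctions. *)
Definition eE x u := emul (emul (HA aA x) (HA aA u)) (HA aADJ (eidx x u)).

Definition pAny acc y lim cond :=
  SSet acc (HC 0) ;; SFor y lim (SIf cond (SSet acc (HC 1)) SNop).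

Definition pWalk0 src := SFor xu xn (SPut aW #xu (eeq #xu #src)).

Definition pWalkRow :=
  SFor xu xn (
    pAny xacc xx xn (emul (HA aW (eidx #xj #xx)) (eE #xx #xu)) ;;
    SPut aW (eidx (eadd #xj (HC 1)) #xu) #xacc).

Definition pWalk src lim := pWalk0 src ;; SFor xj lim pWalkRow.

(** [xlen] equal to the limit means that nothing was found. The second half rebuilds the table for
    the best start and backtracks with a falling index. *)
Definition pFind lim :=
  SSet xlen #lim ;; SSet xv0 (HC 0) ;;
  SFor xv xn (
    pWalk xv lim ;;
    SFor xj lim (
      SIf (emul (emul (eeq (emod #xj (HC 2)) (HC 1)) (HA aW (eidx #xj #xv))) (elt #xj #xlen))
        (SSet xlen #xj ;; SSet xv0 #xv) SNop)) ;;
  pWalk xv0 lim ;;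
  SSet xp #xlen ;; SSet xcur #xv0 ;;
  SFor xj lim (
    SIf #xp (
      SSet xp (esub #xp (HC 1)) ;; SSet xnxt (HC 0) ;;
      SFor xx xn (SIf (emul (HA aW (eidx #xp #xx)) (eE #xx #xcur)) (SSet xnxt #xx) SNop) ;;
      SPut aCYC #xp #xnxt ;; SSet xcur #xnxt) SNop).

Definition pRmCyc :=
  SFor xq xL (SIf (elt #xq #xlen) (SPut aA (HA aCYC #xq) (HC 0)) SNop).

Definition pRmNbr :=
  SFor xq xL (SIf (elt #xq #xlen)
    (SFor xu xn (SIf (HA aADJ (eidx (HA aCYC #xq) #xu)) (SPut aA #xu (HC 0)) SNop)) SNop).

(** All radii up to the limit are grown and the wanted one is picked out by a test, since [idx] is
    random and a loop limit has to be read-only. *)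
Definition pGrow lim idx :=
  SFor xi2 lim (
    SFor xu xn (
      pAny xacc xx xn (emul (HA aZ #xx) (eE #xx #xu)) ;;
      SPut aZN #xu (elt (HC 0) (eadd (HA aZ #xu) #xacc))) ;;
    SIf (eeq #xi2 idx)
      (SFor xu xn (SIf (emul (HA aZN #xu) (esub (HC 1) (HA aZ #xu))) (SPut aDEL #xu (HC 1)) SNop))
      SNop ;;
    SFor xu xn (SPut aZ #xu (HA aZN #xu))).

(** The marks are collected in [aDEL] and carried out at the end, so that both spheres are measured
    in the same graph. *)
Definition pRmLay :=
  SFor xu xn (SPut aDEL #xu (HC 0) ;; SPut aZ #xu (HC 0)) ;;
  SFor xq xN (SIf (elt #xq #xlen) (SPut aZ (HA aCYC #xq) (HC 1)) SNop) ;;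
  pGrow xD #xdd ;;
  SFor xu xn (SPut aZ #xu (eeq #xu #xv0)) ;;
  pGrow xD4 (eadd #xD3 #xbb) ;;
  SFor xu xn (SIf (HA aDEL #xu) (SPut aA #xu (HC 0)) SNop).

(** The draws form a stack that is read downward. Reduction modulo [m] keeps them uniform because
    every [m] in use divides their bound B. *)
Definition pPop x m := SSet xptr (esub #xptr (HC 1)) ;; SSet x (emod (HA aRND #xptr) #m).

(** The random number j of deletions cannot be a loop limit; [n] guarded iterations do instead, and
    they are enough because j <= 2h <= n. *)
Definition pRound :=
  pPop xjj xH ;; pPop xdd xD ;; pPop xbb xD ;;
  SFor xg xn (SIf (elt #xg #xjj) (pFind xL ;; SIf (elt #xlen #xL) pRmCyc SNop) SNop) ;;
  pFind xL ;;
  SIf (elt #xlen #xL) pRmNbr (pFind xN ;; SIf (elt #xlen #xN) pRmLay SNop).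

Definition pSample :=
  SFor xu xn (SPut aA #xu (HC 1)) ;;
  SFor xq xS (pPop xsm xn ;;
    SFor xu xn (SIf (HA aADJ (eidx #xsm #xu)) (SPut aA #xu (HC 0)) SNop)).

(** Colour 2 means not yet coloured; each new start colours its whole component by the parity of
    walk lengths. *)
Definition pColor :=
  SFor xu xn (SPut aCOL #xu (HC 2)) ;;
  SFor xv xn (SIf (eeq (HA aCOL #xv) (HC 2)) (
    pWalk xv xN ;;
    SFor xj xN (SFor xu xn (SIf (HA aW (eidx #xj #xu))
      (SPut aCOL #xu (emod #xj (HC 2))) SNop))) SNop).

Definition pScan :=
  SSet xbl (HC 0) ;;
  SFor xx xn (SFor xy xn (
    SIf (emul (emul (eE #xx #xy) (emul (eeq (HA aCOL #xx) (HC 0)) (eeq (HA aCOL #xy) (HC 1))))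
              (emul (eeq (HA aMATE #xx) #xn) (elt #xbl (HA aLEV #xy))))
      (SSet xbl (HA aLEV #xy) ;; SSet xbx #xx ;; SSet xby #xy) SNop)).

Definition pStep :=
  pScan ;;
  SIf #xbl (
    SFor xx xn (SIf (eeq (HA aMATE #xx) #xby) (SPut aMATE #xx #xn) SNop) ;;
    SPut aMATE #xbx #xby ;;
    SPut aLEV #xby (esub (HA aLEV #xby) (HC 1))) SNop.

(** Each bid lowers the sum of the levels by one, and this sum starts at D n; hence D n steps. *)
Definition pAuction :=
  SFor xu xn (SPut aMATE #xu #xn ;; SPut aLEV #xu #xD) ;;
  SFor xi xD (SFor xq xn pStep).

Definition pCand :=
  SFor xu xn (
    SIf (eeq (HA aCOL #xu) (HC 1))
      (SPut aCAND #xu (elt (HC 0) (emul (HA aA #xu) (elt #xth (HA aLEV #xu)))))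
      (pAny xacc xy xn (emul (eE #xu #xy) (elt #xth (HA aLEV #xy))) ;;
       SPut aCAND #xu (elt (HC 0) (emul (HA aA #xu) (eeq #xacc (HC 0)))))).

(** Sizes are kept as n minus the cardinality, so that counting subtracts and the assignments remain
    [small]; [xbc] = n stands for the empty set. *)
Definition pCheck :=
  SSet xflag (HC 0) ;; SSet xcnt #xn ;;
  SFor xx xn (SIf (HA aCAND #xx) (
    SSet xcnt (esub #xcnt (HC 1)) ;;
    SFor xy xn (SIf (emul (HA aCAND #xy) (HA aADJ (eidx #xx #xy))) (SSet xflag (HC 1)) SNop)) SNop) ;;
  SIf (emul (eeq #xflag (HC 0)) (elt #xcnt #xbc))
    (SSet xbc #xcnt ;; SFor xu xn (SPut aBEST #xu (HA aCAND #xu))) SNop.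

Definition pFinal :=
  pColor ;; pAuction ;; SFor xth xD (pCand ;; pCheck).

Definition pTrial := pSample ;; SFor xi xk pRound ;; pFinal.

Definition pMain := SSet xbc #xn ;; SSet xptr #xQ ;; SFor xtr xR pTrial.

Lemma nogrow_main : nogrow 40 pMain. Proof. by []. Qed.

(** * Specifications of the program fragments *)

Lemma run_any acc y lim cond s (P : pred nat) :
  ~~ eqn acc lim -> ~~ eqn acc y -> ~~ eqn y acc ->
  (forall s' i, i < vs s lim -> (forall z, ~~ eqn z acc -> ~~ eqn z y -> vs s' z = vs s z) ->
    ar s' = ar s -> vs s' y = i -> (hev s' cond != 0) = P i) ->
  vs (run (pAny acc y lim cond) s) acc = has P (iota 0 (vs s lim)).
Proof.
move=> Hl Hy Hy' HP; rewrite /pAny run_seq run_set.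
set s0 := setv _ _ _; have El : vs s0 lim = vs s lim.
  by rewrite /s0 /= ifF // eqnE eq_sym -eqnE; apply: negbTE.
rewrite -El.
apply: (proj2 (@for_frame (fun i s' => ar s' = ar s /\ vs s' acc = has P (iota 0 i)) _ _ _ _ _ _)).
  by rewrite /s0 /= eqnE eqxx.
move=> i s' Hi Hv _ [Ha Hacc].
have E : (hev (setv s' y i) cond != 0) = P i.
  apply: HP => //=; [by rewrite -El | | by rewrite eqnE eqxx].
  move=> z Hz Hzy; rewrite (negPf Hzy) Hv /s0 /= ?(negPf Hz) //.
  by rewrite /= Hzy ?Hz.
rewrite -[i.+1]addn1 iotaD has_cat /= orbF add0n run_if -E.
rewrite run_nop run_set; case: eqP => _ /=; first by rewrite (negPf Hy) orbF.
by rewrite eqnE eqxx orbT.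
Qed.

Section Spec.
Variables (n : nat) (G : sgraph n).
Let g := nat_adj G.

Definition env (s : hstate) := vs s xn = n /\
  forall x y, x < n -> y < n -> ar s aADJ (x * n + y) = g x y.

Definition alive (s : hstate) (a : pred nat) := forall u, u < n -> ar s aA u = a u.

Lemma env_eq s s' : vs s' xn = vs s xn -> ar s' aADJ = ar s aADJ -> env s -> env s'.
Proof. by move=> H1 H2 [H3 H4]; split; rewrite ?H1 ?H2. Qed.

Lemma alive_eq s s' a : ar s' aA = ar s aA -> alive s a -> alive s' a.
Proof. by move=> H1 H2 u; rewrite H1; apply: H2. Qed.

Lemma env_run p s : keepv xn p -> keepa aADJ p -> env s -> env (run p s).
Proof. by move=> H1 H2; apply: env_eq; rewrite ?run_keepv ?run_keepa. Qed.

Lemma alive_run p s a : keepa aA p -> alive s a -> alive (run p s) a.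
Proof. by move=> H; apply: alive_eq; rewrite run_keepa. Qed.

Lemma hev_E s x u a : env s -> alive s a -> hev s x < n -> hev s u < n ->
  hev s (eE x u) = induced g a (hev s x) (hev s u).
Proof.
move=> [H1 H2] Ha Hx Hu; rewrite /= H1 H2 // !Ha // /induced.
by case: (a _); case: (a _); case: (g _ _).
Qed.

Lemma idx_inj x y u v : u < n -> v < n -> (x * n + u == y * n + v) = (x == y) && (u == v).
Proof.
move=> Hu Hv; apply/eqP/andP => [E|[/eqP-> /eqP->]] //.
have n0 : 0 < n by lia.
have := congr1 (fun z => z %/ n) E; have := congr1 (fun z => z %% n) E.
rewrite /= !modnMDl !divnMDl // !modn_small // !divn_small // !addn0 => -> ->.
by rewrite !eqxx.
Qed.

Lemma b2n_ne0 (b : bool) : (nat_of_bool b != 0) = b. Proof. by case: b. Qed.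

Lemma run_walk src lim s a : (src == xv) || (src == xv0) -> (lim == xL) || (lim == xN) ->
  env s -> alive s a ->
  forall j u, j <= vs s lim -> u < n ->
    ar (run (pWalk src lim) s) aW (j * n + u) = walk n (induced g a) (vs s src) j u.
Proof.
move=> Hsrc Hlim Henv Ha.
have Ks z : z \in [:: xu; xx; xj; xacc] -> eqn src z = false /\ eqn lim z = false.
  by case/orP: Hsrc => /eqP->; case/orP: Hlim => /eqP->; rewrite !inE => /or4P[] /eqP->.
have [Ksu Klu] := Ks xu isT; have [Ksx Klx] := Ks xx isT.
have [Ksj Klj] := Ks xj isT; have [Ksa Kla] := Ks xacc isT.
rewrite /pWalk run_seq; set s1 := run (pWalk0 src) s.
have H1 u : u < n -> ar s1 aW u = walk n (induced g a) (vs s src) 0 u.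
  rewrite -(proj1 Henv) /s1 /pWalk0; move: u.
  apply: (@for_frame (fun i s' => forall u, u < i -> ar s' aW u = (u == vs s src))) => //.
  move=> i s' Hi Hv _ HI u'; rewrite run_put /= Ksu ltnS leq_eqVlt.
  rewrite (Hv src) /= ?Ksu //; case: eqP => [->|_] //=; exact: HI.
have E1 : env s1 by apply: env_run Henv.
have A1 : alive s1 a by apply: alive_run Ha.
have L1 : vs s1 lim = vs s lim by rewrite run_keepv //= Klu.
have S1 : vs s1 src = vs s src by rewrite run_keepv //= Ksu.
clearbody s1; rewrite -L1 -S1.
suff : forall j u, j < (vs s1 lim).+1 -> u < n ->
    ar (run (SFor xj lim pWalkRow) s1) aW (j * n + u) = walk n (induced g a) (vs s1 src) j u.
  by move=> H j u Hj; apply: H.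
apply: (@for_frame (fun i s' => forall j u, j < i.+1 -> u < n ->
    ar s' aW (j * n + u) = walk n (induced g a) (vs s1 src) j u)).
  by move=> [|//] u _ Hu; rewrite mul0n add0n H1 // S1.
move=> i s2 Hi Hv Hka HI.
have E2 : env (setv s2 xj i).
  by apply: env_eq E1 => /=; rewrite ?Hv ?Hka.
have A2 : alive (setv s2 xj i) a by apply: alive_eq A1; rewrite /= Hka.
rewrite /pWalkRow; set s3 := setv s2 xj i.
suff : forall u j, j < i.+2 -> u < n -> (j < i.+1) || (u < vs s3 xn) ->
    ar (run (SFor xu xn (pAny xacc xx xn (emul (HA aW (eidx # (xj) # (xx))) (eE # (xx) # (xu)));;
          SPut aW (eidx (eadd # (xj) (HC 1)) # (xu)) # (xacc))) s3) aW (j * n + u) =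
     walk n (induced g a) (vs s1 src) j u.
  by move=> H j u Hj Hu; apply: H => //; rewrite (proj1 E2) Hu orbT.
(* Inner invariant: the rows up to [i] are final, and row i + 1 is filled below column [i']. *)
apply: (@for_frame (fun i' s' => forall u j, j < i.+2 -> u < n -> (j < i.+1) || (u < i') ->
    ar s' aW (j * n + u) = walk n (induced g a) (vs s1 src) j u)).
  by move=> u j Hj Hu; rewrite orbF => Hj'; apply: HI.
move=> u' s4 Hu' Hv4 Ha4 HI4 u j Hj Hu Hc.
rewrite (proj1 E2) in Hu'.
set s5 := setv s4 xu u'.
have E5 : env s5 by apply: env_eq E2 => /=; rewrite ?Hv4 ?Ha4.
have A5 : alive s5 a by apply: alive_eq A2; rewrite /= Ha4.
rewrite run_seq run_put.
have Eacc : vs (run (pAny xacc xx xn (emul (HA aW (eidx # (xj) # (xx))) (eE # (xx) # (xu)))) s5) xacc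
    = walk n (induced g a) (vs s1 src) i.+1 u'.
  have -> : walk n (induced g a) (vs s1 src) i.+1 u' =
    has (fun x => walk n (induced g a) (vs s1 src) i x && induced g a x u') (iota 0 (vs s5 xn)).
    by rewrite (proj1 E5).
  apply: (@run_any _ _ _ _ _ (fun x => walk n (induced g a) (vs s1 src) i x && induced g a x u')) => //.
  move=> s' x Hx Hv' Ha' Ex.
  have E' : env s' by apply: env_eq E5; rewrite ?Hv' ?Ha'.
  have A' : alive s' a by apply: alive_eq A5; rewrite Ha'.
  rewrite (proj1 E5) in Hx.
  have Eu : vs s' xu = u' by rewrite Hv'.
  have Ej : vs s' xj = i by rewrite Hv' // /s5 /= Hv4.
  have EE : hev s' (eE #xx #xu) = induced g a x u'.
    by rewrite (hev_E E' A') /= ?Ex ?Eu.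
  have -> : hev s' (emul (HA aW (eidx #xj #xx)) (eE #xx #xu)) =
     hev s' (HA aW (eidx #xj #xx)) * hev s' (eE #xx #xu) by [].
  rewrite EE /= Ex Ej (proj1 E') Ha' /s5 /= HI4 ?ltnSn //.
  by case: (walk _ _ _ _ _); case: (induced _ _ _ _).
rewrite /= Eacc !run_keepv //.
have -> : vs s5 xj = i by rewrite /s5 /= Hv4.
have -> : vs s5 xu = u' by [].
rewrite (proj1 E5) addn1 idx_inj //.
case: eqP => [Ej|nj]; last first.
  by rewrite run_keepa // /s5 /= HI4 //; lia.
subst j; case: eqP => [->|nu]; first by [].
by rewrite run_keepa // /s5 [LHS]/= HI4 //; lia.
Qed.

End Spec.

(** * The search for a shortest odd closed walk *)

Lemma foldl_iotaS (T : Type) (f : T -> nat -> T) z i :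
  foldl f z (iota 0 i.+1) = f (foldl f z (iota 0 i)) i.
Proof. by rewrite -[i.+1]addn1 iotaD foldl_cat. Qed.

Definition finner n (e : rel nat) v r p := foldl (fun (p : nat * nat) j =>
  if [&& odd j, walk n e v j v & j < p.1] then (j, v) else p) p (iota 0 r).

(** Functional model of the search in [pFind]: length and starting vertex, where a length that stays
    at [r] signals failure. *)
Definition shortest_odd n (e : rel nat) r :=
  foldl (fun p v => finner n e v r p) (r, 0) (iota 0 n).

Lemma finnerP n e v r p : let p' := finner n e v r p in
  [/\ p'.1 <= p.1,
      p' = p \/ [/\ odd p'.1, walk n e v p'.1 v, p'.1 < p.1 & p'.2 = v] &
      forall j, j < r -> odd j -> walk n e v j v -> p'.1 <= j].
Proof.
rewrite /finner /=; elim: r => [|r [H1 H2 H3]]; first by split=> //; left.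
rewrite foldl_iotaS; set p1 := foldl _ p _ in H1 H2 H3 *.
case: ifP => [/and3P[Ho Hw Hl]|Hn] /=.
  split; first by lia.
    by right; split=> //; lia.
  by move=> j Hj Hoj Hwj; rewrite ltnS leq_eqVlt in Hj; case/orP: Hj => [/eqP->//|/H3]; lia.
split=> // j; rewrite ltnS leq_eqVlt => /orP[/eqP->|/H3] // Ho Hw.
by move: Hn; rewrite Ho Hw /=; lia.
Qed.

Lemma shortest_odd_le n e r : (shortest_odd n e r).1 <= r.
Proof.
rewrite /shortest_odd; elim: {2}n => [|i IH] //; rewrite foldl_iotaS.
by apply: leq_trans IH; case: (finnerP n e i r (foldl (fun p v => finner n e v r p) (r, 0) (iota 0 i))).
Qed.

Lemma shortest_odd_lt n e r : 0 < n -> (shortest_odd n e r).2 < n.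
Proof.
move=> Hn; rewrite /shortest_odd; have: n <= n by [].
elim: {1 4}n => [|i IH] // Hi; rewrite foldl_iotaS.
have {}IH := IH (ltnW Hi).
set p := foldl _ _ _ in IH *.
by have [_ [->|[_ _ _ ->]] _] := finnerP n e i r p.
Qed.

Lemma shortest_odd_found n e r : (shortest_odd n e r).1 < r ->
  odd (shortest_odd n e r).1 /\ walk n e (shortest_odd n e r).2 (shortest_odd n e r).1 (shortest_odd n e r).2.
Proof.
rewrite /shortest_odd; suff H m : let q := foldl (fun p v => finner n e v r p) (r, 0) (iota 0 m) in
  q.1 < r -> odd q.1 /\ walk n e q.2 q.1 q.2 by exact: H.
elim: m => [|i IH]; first by rewrite /= ltnn.
rewrite foldl_iotaS; set p := foldl _ _ _ in IH *.
have [_ [->|[H1 H2 H3 E]] _] := finnerP n e i r p; first exact: IH.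
by rewrite /= E.
Qed.

Lemma shortest_odd_min n e r v j : v < n -> j < r -> odd j -> walk n e v j v -> (shortest_odd n e r).1 <= j.
Proof.
rewrite /shortest_odd; elim: {1 4}n => [|i IH] //; rewrite foldl_iotaS ltnS leq_eqVlt.
set p := foldl _ _ _ in IH *; have [H1 _ H3] := finnerP n e i r p.
case/orP=> [/eqP->|Hv] Hj Ho Hw; first exact: H3.
exact: leq_trans H1 (IH Hv Hj Ho Hw).
Qed.

Lemma pick_last_lt n P : 0 < n -> pick_last n P < n.
Proof.
move=> Hn; have H m : pick_last m P < maxn m 1.
  elim: m => [|m IH] //; rewrite pick_lastS; case: ifP => _; lia.
by have := H n; rewrite (maxn_idPl Hn).
Qed.

Lemma curs_lt n e v len i : v < n -> cyc_rev n e v len i < n.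
Proof. by case: i => [|i] //= Hv; apply: pick_last_lt; lia. Qed.

Lemma run_pick acc y lim cond s (P : pred nat) :
  ~~ eqn acc lim -> ~~ eqn acc y -> ~~ eqn y acc ->
  (forall s' i, i < vs s lim -> (forall z, ~~ eqn z acc -> ~~ eqn z y -> vs s' z = vs s z) ->
    ar s' = ar s -> vs s' y = i -> (hev s' cond != 0) = P i) ->
  vs (run (SSet acc (HC 0) ;; SFor y lim (SIf cond (SSet acc #y) SNop)) s) acc =
  pick_last (vs s lim) P.
Proof.
move=> Hl Hy Hy' HP; rewrite run_seq run_set.
set s0 := setv _ _ _; have El : vs s0 lim = vs s lim.
  by rewrite /s0 /= ifF // eqnE eq_sym -eqnE; apply: negbTE.
rewrite -El.
apply: (proj2 (@for_frame (fun i s' => ar s' = ar s /\ vs s' acc = pick_last i P) _ _ _ _ _ _)).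
  by rewrite /s0 /= eqnE eqxx.
move=> i s' Hi Hv _ [Ha Hacc].
have E : (hev (setv s' y i) cond != 0) = P i.
  apply: HP => //=; [by rewrite -El | | by rewrite eqnE eqxx].
  move=> z Hz Hzy; rewrite (negPf Hzy) Hv /s0 /= ?(negPf Hz) //.
  by rewrite /= Hzy ?Hz.
rewrite pick_lastS -E run_if run_nop run_set; case: eqP => _ /=; first by rewrite (negPf Hy).
by rewrite !eqnE !eqxx.
Qed.

Section Spec.
Variables (n : nat) (G : sgraph n).
Let g := nat_adj G.

Lemma run_find_len lim s a : (lim == xL) || (lim == xN) -> env G s -> alive n s a ->
  let s' := run (SSet xlen #lim ;; SSet xv0 (HC 0) ;;
  SFor xv xn (
    pWalk xv lim ;;
    SFor xj lim (
      SIf (emul (emul (eeq (emod #xj (HC 2)) (HC 1)) (HA aW (eidx #xj #xv))) (elt #xj #xlen))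
        (SSet xlen #xj ;; SSet xv0 #xv) SNop))) s in
  vs s' xlen = (shortest_odd n (induced g a) (vs s lim)).1 /\ vs s' xv0 = (shortest_odd n (induced g a) (vs s lim)).2.
Proof.
move=> Hlim Henv Ha.
have Kl z : 13 < z -> eqn lim z = false /\ eqn z lim = false.
  by case/orP: Hlim => /eqP->; do 14!case: z => // z.
cbv zeta; rewrite !run_seq !run_set; set s0 := setv _ xv0 _.
have E0 : env G s0 by apply: env_eq Henv.
have A0 : alive n s0 a by apply: alive_eq Ha.
have L0 : vs s0 lim = vs s lim by rewrite /s0 /= !(proj1 (Kl _ _)).
have I0 : vs s0 xlen = vs s lim /\ vs s0 xv0 = 0 by rewrite /s0 /=.
clearbody s0; rewrite -L0 /shortest_odd -[X in iota 0 X](proj1 E0); rewrite -L0 in I0.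
set F := foldl _.
apply: (@for_frame (fun i s' => vs s' xlen = (F (vs s0 lim, 0) (iota 0 i)).1 /\
   vs s' xv0 = (F (vs s0 lim, 0) (iota 0 i)).2)) => //.
move=> v s1 Hv Hk Hka I1; rewrite run_seq /F foldl_iotaS -/F.
move: (F _ _) I1 => p [I1 I1'].
set s2 := setv s1 xv v.
have E2 : env G s2 by apply: env_eq E0 => /=; rewrite ?Hk ?Hka.
have A2 : alive n s2 a by apply: alive_eq A0; rewrite /= Hka.
have L2 : vs s2 lim = vs s0 lim.
  rewrite /s2 /= (proj1 (Kl _ _)) // Hk //.
  by case/orP: Hlim => /eqP->.
have W3 := run_walk (isT : (xv == xv) || (xv == xv0)) Hlim E2 A2.
set s3 := run (pWalk xv lim) s2 in W3 *.
have E3 : env G s3 by apply: env_run E2.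
have K3 z : z \in [:: xv; xlen; xv0; lim] -> vs s3 z = vs s2 z.
  by move=> Hz; rewrite run_keepv //; case/orP: Hlim Hz => /eqP->; rewrite !inE => /or4P[] /eqP->.
have L3 : vs s3 lim = vs s0 lim by rewrite K3 ?inE ?eqxx ?orbT.
have V3 : vs s3 xv = v by rewrite K3.
have P3 : vs s3 xlen = p.1 /\ vs s3 xv0 = p.2 by rewrite !K3.
have EV : vs s2 xv = v by [].
rewrite EV L2 in W3; clearbody s3; rewrite (proj1 E0) in Hv.
rewrite /finner -L3; set F2 := foldl _.
apply: (@for_frame (fun i s' => vs s' xlen = (F2 p (iota 0 i)).1 /\
   vs s' xv0 = (F2 p (iota 0 i)).2)) => //.
move=> j s4 Hj Hk4 Hka4; rewrite /F2 foldl_iotaS -/F2; move: (F2 _ _) => q [Q1 Q2].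
rewrite run_if run_seq !run_set run_nop.
have -> : (hev (setv s4 xj j) (emul (emul (eeq (emod # (23) (HC 2)) (HC 1)) (HA aW (eidx # (23) # (22)))) (elt # (23) # (25))) == 0) = ~~ [&& odd j, walk n (induced g a) v j v & j < q.1].
  rewrite /= Hka4 // Q1 !Hk4 // V3 (proj1 E3) W3 //; last by rewrite -L3 ltnW.
  rewrite modn2; case: (odd j) => //=; case: (walk _ _ _ _ _) => //=.
  by case: (_ < _).
by case: [&& _, _ & _] => /=; [rewrite Hk4|].

Qed.
Definition pTrace lim :=
  SFor xj lim (
    SIf #xp (
      SSet xp (esub #xp (HC 1)) ;; SSet xnxt (HC 0) ;;
      SFor xx xn (SIf (emul (HA aW (eidx #xp #xx)) (eE #xx #xcur)) (SSet xnxt #xx) SNop) ;;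
      SPut aCYC #xp #xnxt ;; SSet xcur #xnxt) SNop).

(** Only the first [len] of the [lim] iterations act; then [xp] is 0 and the trace no longer
    changes, whence the [minn] in the invariant. *)
Lemma run_trace lim s a v len : (lim == xL) || (lim == xN) -> env G s -> alive n s a ->
  (forall j u, j <= vs s lim -> u < n -> ar s aW (j * n + u) = walk n (induced g a) v j u) ->
  len <= vs s lim -> (0 < n -> v < n) -> vs s xp = len -> vs s xcur = v ->
  forall q, q < len -> ar (run (pTrace lim) s) aCYC q = cyc n (induced g a) v len q.
Proof.
move=> Hlim Henv Ha HW Hlen Hvn Hp Hcur.
have Kl z : 13 < z -> eqn lim z = false /\ eqn z lim = false.
  by case/orP: Hlim => /eqP->; do 14!case: z => // z.
set e := induced g a in HW *.
pose I i s' := [/\ vs s' xp = len - i, vs s' xcur = cyc_rev n e v len (minn i len) &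
    forall q, len - i <= q < len -> ar s' aCYC q = cyc n e v len q].
suff [_ _ H] : I (vs s lim) (run (pTrace lim) s) by move=> q Hq; apply: H; lia.
apply: (@for_frame I); rewrite /I; first by rewrite subn0 min0n; split=> // q; lia.
move=> i s1 Hi Hk Hka [I1 I2 I3].
rewrite run_if run_seq run_nop run_set [X in run X]lock.
have -> : hev (setv s1 xj i) #xp = len - i by rewrite /= I1.
case: eqP => Eli.
  split; rewrite /= ?I1 ?I2; try lia.
    by congr cyc_rev; lia.
  by move=> q Hq; rewrite /= I3 //; lia.
rewrite -lock -[SSet xnxt (HC 0) ;; _]/(SSet xnxt (HC 0) ;; SFor xx xn _ ;; _).
set s2 := setv (setv s1 xj i) xp _.
have P2 : vs s2 xp = len - i.+1 by rewrite /s2 /= I1; lia.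
have Ei : minn i len = i by lia.
rewrite Ei in I2.
have E2 : env G s2 by apply: env_eq Henv => /=; rewrite ?Hk ?Hka.
have A2 : alive n s2 a by apply: alive_eq Ha; rewrite /= Hka.
have W2 : ar s2 aW = ar s aW by rewrite /= Hka.
have C2 : vs s2 xcur = cyc_rev n e v len i by [].
have Y2 : ar s2 aCYC = ar s1 aCYC by [].
clearbody s2.
rewrite run_seq -run_seq.
have -> : forall p1 p2 p3, run (p1 ;; p2 ;; p3) s2 = run p3 (run (p1 ;; p2) s2) by [].
set s3 := run (_ ;; _) s2.
have N3 : vs s3 xnxt = cyc_rev n e v len i.+1.
  rewrite /s3 [cyc_rev _ _ _ _ _]/= -[X in pick_last X _](proj1 E2).
  apply: run_pick => // s' x Hx Hk' Ha' Ex.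
  rewrite (proj1 E2) in Hx.
  have E' : env G s' by apply: env_eq E2; rewrite ?Hk' ?Ha'.
  have A' : alive n s' a by apply: alive_eq A2; rewrite Ha'.
  have Ec : vs s' xcur = cyc_rev n e v len i by rewrite Hk'.
  have Hc : cyc_rev n e v len i < n by apply/curs_lt/Hvn; lia.
  have EE : hev s' (eE #xx #xcur) = e x (cyc_rev n e v len i).
    by rewrite (hev_E E' A') /= ?Ex ?Ec.
  have -> : hev s' (emul (HA aW (eidx #xp #xx)) (eE #xx #xcur)) =
     hev s' (HA aW (eidx #xp #xx)) * hev s' (eE #xx #xcur) by [].
  rewrite EE /= Ex (proj1 E') Hk' // P2 Ha' W2 HW //; last by lia.
  by case: (walk _ _ _ _ _); case: (e _ _).
have Y3 : ar s3 aCYC = ar s1 aCYC by rewrite run_keepa.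
have P3 : vs s3 xp = len - i.+1 by rewrite run_keepv.
clearbody s3; rewrite run_seq run_put run_set; split.
- by rewrite /= P3.
- by rewrite /= N3; congr cyc_rev; lia.
move=> q Hq; rewrite /= P3 N3 Y3; case: eqP => [->|nq]; last by apply: I3; lia.
by rewrite /cyc; congr cyc_rev; lia.
Qed.

Lemma run_find lim s a : (lim == xL) || (lim == xN) -> env G s -> alive n s a ->
  let s' := run (pFind lim) s in let p := shortest_odd n (induced g a) (vs s lim) in
  [/\ vs s' xlen = p.1, vs s' xv0 = p.2 &
      forall q, q < p.1 -> ar s' aCYC q = cyc n (induced g a) p.2 p.1 q].
Proof.
move=> Hlim Henv Ha /=.
have Kl z : 13 < z -> eqn lim z = false /\ eqn z lim = false.
  by case/orP: Hlim => /eqP->; do 14!case: z => // z.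
have := run_find_len Hlim Henv Ha; cbv zeta; rewrite /pFind.
set p1 := SFor xv xn _.
have -> : forall p, run (SSet xlen #lim ;; SSet xv0 (HC 0) ;; p1 ;; p) s =
  run p (run (SSet xlen #lim ;; SSet xv0 (HC 0) ;; p1) s) by [].
set s1 := run (_ ;; _) s; case=> H1 H2.
have E1 : env G s1 by apply: env_run Henv.
have A1 : alive n s1 a by apply: alive_run Ha.
have L1 : vs s1 lim = vs s lim.
  by rewrite run_keepv //; case/orP: Hlim => /eqP->.
clearbody s1; move: (shortest_odd_le n (induced g a) (vs s lim)) (@shortest_odd_lt n (induced g a) (vs s lim)) H1 H2.
case: (shortest_odd _ _ _) => len v /= Hlen Hv H1 H2.
rewrite run_seq; have W2 := run_walk (isT : (xv0 == xv) || (xv0 == xv0)) Hlim E1 A1.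
set s2 := run (pWalk xv0 lim) s1 in W2 *.
have E2 : env G s2 by apply: env_run E1.
have A2 : alive n s2 a by apply: alive_run A1.
have L2 : vs s2 lim = vs s lim.
  by rewrite run_keepv //; case/orP: Hlim => /eqP->.
have [len2 v2] : vs s2 xlen = len /\ vs s2 xv0 = v by rewrite !run_keepv.
rewrite H2 L1 in W2; clearbody s2.
rewrite !run_seq !run_set -/(pTrace lim); set s3 := setv _ xcur _.
have L3 : vs s3 lim = vs s lim by rewrite /= !(proj1 (Kl _ _)).
have T := @run_trace lim s3 a v len Hlim (env_eq _ _ E2) (alive_eq _ A2).
split; last 1 first.
- move=> q Hq; apply: T => //; rewrite ?L3 //=.
- by rewrite run_keepv // /s3 /=; case/orP: Hlim => /eqP->.
- by rewrite run_keepv // /s3 /=; case/orP: Hlim => /eqP->.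
Qed.
End Spec.

(** * Deletion of cycles, neighbourhoods and layers *)

Lemma run_rows p arr s (f : nat -> nat) :
  (forall s' u, u < vs s xn ->
     (forall z, keepv z (SFor xu xn p) -> vs s' z = vs s z) ->
     (forall b, keepa b p -> ar s' b = ar s b) ->
     ar s' arr u = ar s arr u -> vs s' xu = u ->
     forall u', ar (run p s') arr u' = if u' == u then f u else ar s' arr u') ->
  forall u, u < vs s xn -> ar (run (SFor xu xn p) s) arr u = f u.
Proof.
move=> H; pose I i s' := forall u, ar s' arr u = if u < i then f u else ar s arr u.
suff HI : I (vs s xn) (run (SFor xu xn p) s) by move=> u Hu; rewrite HI Hu.
apply: (@for_frame I); rewrite /I // => i s' Hi Hv Ha HI u.
rewrite (H _ i Hi) //=.
- by rewrite HI ltnS; case: ltngtP => // ->.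
- by move=> z /[dup] Hz /andP[/negPf-> _]; apply: Hv.
- by rewrite HI ltnn.
Qed.

Section Spec.
Variables (n : nat) (G : sgraph n).
Let g := nat_adj G.

Definition removed (a P : pred nat) : pred nat := fun u => a u && ~~ P u.
Definition oncyc (e : rel nat) (p : nat * nat) : pred nat :=
  fun u => has (fun q => cyc n e p.2 p.1 q == u) (iota 0 p.1).

Lemma run_rmcyc s a e p : alive n s a -> vs s xlen = p.1 -> p.1 <= vs s xL ->
  (forall q, q < p.1 -> ar s aCYC q = cyc n e p.2 p.1 q) ->
  alive n (run pRmCyc s) (removed a (oncyc e p)).
Proof.
move=> Ha Hl Hle Hc.
pose I i s' := alive n s'
  (removed a (fun u => has (fun q => cyc n e p.2 p.1 q == u) (iota 0 (minn i p.1)))).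
suff : I (vs s xL) (run pRmCyc s) by rewrite /I (minn_idPr Hle).
apply: (@for_frame I); rewrite /I.
  by move=> u Hu; rewrite min0n /removed andbT Ha.
move=> i s' Hi Hv Hk HI; rewrite run_if run_put run_nop.
have -> : hev (setv s' xq i) (elt #xq #xlen) = (i < p.1) by rewrite /= Hv // Hl.
case: (ltnP i p.1) => Hip /=; last first.
  by move=> u Hu; rewrite /= HI // !(minn_idPr _) //; lia.
move=> u Hu; rewrite /= Hk // Hc // HI // /removed.
rewrite !(minn_idPl _); try lia.
rewrite -[i.+1]addn1 iotaD has_cat /= orbF add0n eq_sym.
by case: eqP => _; rewrite ?orbT ?andbF ?orbF.
Qed.

Lemma run_rmnbr s a (c : nat -> nat) len : env G s -> alive n s a -> vs s xlen = len ->
  len <= vs s xL -> (forall q, q < len -> ar s aCYC q = c q /\ c q < n) ->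
  alive n (run pRmNbr s) (removed a (fun u => has (fun q => g (c q) u) (iota 0 len))).
Proof.
move=> Henv Ha Hl Hle Hc.
pose I i s' := alive n s'
  (removed a (fun u => has (fun q => g (c q) u) (iota 0 (minn i len)))).
suff : I (vs s xL) (run pRmNbr s) by rewrite /I (minn_idPr Hle).
apply: (@for_frame I); rewrite /I.
  by move=> u Hu; rewrite min0n /removed andbT Ha.
move=> i s' Hi Hv Hk HI; rewrite run_if run_nop.
have -> : hev (setv s' xq i) (elt #xq #xlen) = (i < len) by rewrite /= Hv // Hl.
case: (ltnP i len) => Hip /=; last first.
  by move=> u Hu; rewrite /= HI // !(minn_idPr _) //; lia.
set s1 := setv _ _ _; have E1 : env G s1 by apply: env_eq Henv; rewrite /= ?Hv ?Hk.
have A1 : ar s1 = ar s' by [].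
have Y1 : vs s1 xq = i by [].
move=> u Hu; rewrite -(proj1 E1) in Hu; move: u Hu.
apply: (@run_rows _ _ _ (fun u => removed a (fun u => has (fun q => g (c q) u) (iota 0 (minn i.+1 len))) u)).
rewrite (proj1 E1) => s2 u Hu Hv2 Ha2 Hr Ex u'; rewrite run_if run_put run_nop.
have Hcond : hev s2 (HA aADJ (eidx (HA aCYC #xq) #xu)) = g (c i) u.
  have [H1 H2] := Hc i Hip.
  have N2 : vs s2 xn = n by rewrite Hv2 ?(proj1 E1).
  have Q2 : vs s2 xq = i by rewrite Hv2.
  by rewrite /= Ex Q2 N2 !Ha2 // A1 !Hk // H1 (proj2 Henv).
rewrite Hcond.
have Eu : removed a (fun u => has (fun q => g (c q) u) (iota 0 (minn i.+1 len))) u =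
   (ar s' aA u != 0) && ~~ g (c i) u.
  rewrite HI // /removed !(minn_idPl _); try lia.
  by rewrite -[i.+1]addn1 iotaD has_cat /= orbF add0n negb_or andbA b2n_ne0.
rewrite {}Eu; case: (g (c i) u) => /=; first by rewrite Ex andbF.
case: eqP => [->|] //; rewrite Hr A1 andbT HI //.
by case: (removed _ _ _).
Qed.

Lemma run_grow lim idx s a (z d : pred nat) iv : (lim == xD) || (lim == xD4) ->
  (forall s', (forall y, y \in [:: xdd; xbb; xD3] -> vs s' y = vs s y) -> hev s' idx = iv) ->
  env G s -> alive n s a -> (forall u, u < n -> ar s aZ u = z u) ->
  (forall u, u < n -> ar s aDEL u = d u) ->
  forall u, u < n -> ar (run (pGrow lim idx) s) aDEL u =
    d u || (iv < vs s lim) && layer n (induced g a) z iv u.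
Proof.
move=> Hlim Hidx Henv Ha Hz Hd.
set e := induced g a.
pose I i s' := (forall u, u < n -> ar s' aZ u = ball n e z i u) /\
  (forall u, u < n -> ar s' aDEL u = d u || (iv < i) && layer n e z iv u).
suff [_ H] : I (vs s lim) (run (pGrow lim idx) s) by [].
apply: (@for_frame I); rewrite /I; first by split=> // u Hu; rewrite orbF Hd.
move=> i s1 Hi Hv Hk [HZ HD].
set s2 := setv s1 xi2 i.
have E2 : env G s2 by apply: env_eq Henv; rewrite /= ?Hv ?Hk.
have A2 : alive n s2 a by apply: alive_eq Ha; rewrite /= Hk.
have V2 y : y \in [:: xdd; xbb; xD3] -> vs s2 y = vs s y.
  by rewrite !inE => /or3P[] /eqP-> /=; rewrite Hv.
have Z2 : ar s2 aZ = ar s1 aZ by [].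
have D2 : ar s2 aDEL = ar s1 aDEL by [].
have I2 : vs s2 xi2 = i by [].
clearbody s2.
rewrite run_seq; set s3 := run _ s2.
have HZN u : u < n -> ar s3 aZN u = ball n e z i.+1 u.
  rewrite -[X in _ < X](proj1 E2) /s3; move: u.
  apply: (@run_rows _ _ _ (fun u => ball n e z i.+1 u)) => s4 u Hu Hv4 Ha4 Hr Ex u'.
  rewrite (proj1 E2) in Hu.
  rewrite run_seq run_put /= run_keepv // Ex.
  rewrite !run_keepa //.
  have E4 : env G s4 by apply: env_eq E2; rewrite ?Hv4 ?Ha4.
  have A4 : alive n s4 a by apply: alive_eq A2; rewrite Ha4.
  have Eacc : vs (run (pAny xacc xx xn (emul (HA aZ #xx) (eE #xx #xu))) s4) xacc =
      has (fun x => ball n e z i x && e x u) (iota 0 n).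
    rewrite -[X in iota _ X](proj1 E4); apply: run_any => // s' x Hx Hv' Ha' Exx.
    rewrite (proj1 E4) in Hx.
    have E' : env G s' by apply: env_eq E4; rewrite ?Hv' ?Ha'.
    have A' : alive n s' a by apply: alive_eq A4; rewrite Ha'.
    have Eu : vs s' xu = u by rewrite Hv'.
    have EE : hev s' (eE #xx #xu) = e x u by rewrite (hev_E E' A') /= ?Exx ?Eu.
    have -> : hev s' (emul (HA aZ #xx) (eE #xx #xu)) = ar s' aZ (vs s' xx) * hev s' (eE #xx #xu) by [].
    rewrite EE Exx Ha' Ha4 // Z2 HZ //.
    by case: (ball _ _ _ _ _); case: (e _ _).
  rewrite Eacc. case: eqP => // _; rewrite Ha4 // Z2 HZ //.
  by case: (ball _ _ _ _ _) => //=; case: (has _ _).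
have [E3 Z3 D3] : [/\ env G s3, ar s3 aZ = ar s1 aZ & ar s3 aDEL = ar s1 aDEL].
  by split; [apply: env_run E2|rewrite run_keepa|rewrite run_keepa].
have V3 y : y \in [:: xdd; xbb; xD3] -> vs s3 y = vs s y.
  by move=> Hy; rewrite run_keepv ?V2 //; move: Hy; rewrite !inE => /or3P[] /eqP->.
have I3 : vs s3 xi2 = i by rewrite run_keepv.
clearbody s3; rewrite run_seq; set s4 := run _ s3.
have HD4 u : u < n -> ar s4 aDEL u = d u || (iv < i.+1) && layer n e z iv u.
  move=> Hu; rewrite /s4 run_if run_nop.
  have -> : hev s3 (eeq #xi2 idx) = (i == iv) by rewrite /= I3 (Hidx _ V3).
  case: (i =P iv) => Eiv /=; last first.
    rewrite D3 HD //; congr (nat_of_bool (_ || (_ && _))); lia.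
  move: u Hu; rewrite -[X in forall u, u < X -> _](proj1 E3).
  apply: (@run_rows _ _ _ (fun u => d u || (iv < i.+1) && layer n e z iv u)) => s5 u Hu Hv5 Ha5 Hr Ex u'.
  rewrite (proj1 E3) in Hu.
  rewrite run_if run_put run_nop.
  have Hc : hev s5 (emul (HA aZN #xu) (esub (HC 1) (HA aZ #xu))) = layer n e z iv u.
    rewrite [LHS]/= Ex !Ha5 // HZN // Z3 HZ // -Eiv /layer.
    by case: (ball n e z i.+1 u); case: (ball n e z i u).
  rewrite Hc -Eiv ltnS leqnn /=; case El: (layer n e z i u) => /=.
    by rewrite Ex orbT.
  case: eqP => // ->; rewrite Hr D3 HD // -Eiv El orbF.
  by rewrite andbF orbF.
have [E4 ZN4] : env G s4 /\ ar s4 aZN = ar s3 aZN.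
  by split; [apply: env_run E3 | rewrite run_keepa].
clearbody s4; split=> u Hu; last first.
  by rewrite run_keepa ?HD4.
rewrite -HZN //; rewrite -(proj1 E4) in Hu; move: u Hu.
apply: (@run_rows _ _ _ (fun u => ar s3 aZN u)) => s5 u Hu Hv5 Ha5 Hr Ex u'.
by rewrite run_put /= Ex Ha5 // ZN4.
Qed.

Lemma run_rmlay s a p D d b : env G s -> alive n s a -> vs s xlen = p.1 -> vs s xv0 = p.2 ->
  p.1 <= n.+1 -> vs s xN = n.+1 -> vs s xD = D -> vs s xD3 = 3 * D -> vs s xD4 = 4 * D ->
  vs s xdd = d -> vs s xbb = b -> d < D -> b < D ->
  (forall q, q < p.1 -> ar s aCYC q = cyc n (induced g a) p.2 p.1 q) ->
  alive n (run pRmLay s) (fun u => [&& a u, ~~ layer n (induced g a) (oncyc (induced g a) p) d u &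
     ~~ layer n (induced g a) (pred1 p.2) (3 * D + b) u]).
Proof.
set e := induced g a; move=> Henv Ha Hlen Hv0 Hle HN HDD H3 H4 Hd Hb Hdl Hbl Hc.
rewrite /pRmLay run_seq; set s1 := run _ s.
have [D1 Z1] : (forall u, u < n -> ar s1 aDEL u = 0) /\ (forall u, u < n -> ar s1 aZ u = 0).
  split=> u; rewrite -[X in _ < X](proj1 Henv); move: u.
    by apply: (@run_rows _ _ _ (fun u => 0)) => s' u Hu _ _ _ Ex u'; rewrite run_seq !run_put /= Ex.
  by apply: (@run_rows _ _ _ (fun u => 0)) => s' u Hu _ _ _ Ex u'; rewrite run_seq !run_put /= Ex.
have E1 : env G s1 by apply: env_run Henv.
have A1 : alive n s1 a by apply: alive_run Ha.
have V1 z : z \in [:: xlen; xv0; xN; xD; xD3; xD4; xdd; xbb] -> vs s1 z = vs s z.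
  by rewrite !inE => Hz; rewrite run_keepv //; do ![case/orP: Hz => [/eqP-> //|Hz]]; move/eqP: Hz => ->.
have C1 : ar s1 aCYC = ar s aCYC by rewrite run_keepa.
clearbody s1; rewrite run_seq; set s2 := run _ s1.
have Z2 u : u < n -> ar s2 aZ u = oncyc e p u.
  pose I i s' := forall u, u < n -> ar s' aZ u =
    has (fun q => cyc n e p.2 p.1 q == u) (iota 0 (minn i p.1)).
  suff H : I (vs s1 xN) s2 by move=> Hu; rewrite H // V1 // HN (minn_idPr Hle).
  apply: (@for_frame I); rewrite /I; first by move=> w Hw; rewrite min0n Z1.
  move=> i s' Hi Hv Hk HI w Hw; rewrite run_if run_put run_nop.
  have -> : hev (setv s' xq i) (elt #xq #xlen) = (i < p.1) by rewrite /= Hv // V1 // Hlen.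
  case: (ltnP i p.1) => Hip /=; last by rewrite HI // !(minn_idPr _) //; lia.
  rewrite Hk // C1 Hc // HI // !(minn_idPl _); try lia.
  rewrite -[i.+1]addn1 iotaD has_cat /= orbF add0n eq_sym.
  by case: eqP => _; rewrite ?orbT ?orbF.
have E2 : env G s2 by apply: env_run E1.
have A2 : alive n s2 a by apply: alive_run A1.
have V2 z : z \in [:: xv0; xD; xD3; xD4; xdd; xbb] -> vs s2 z = vs s z.
  move=> Hz; rewrite run_keepv.
    by rewrite V1 //; move: Hz; rewrite !inE => Hz; do ![case/orP: Hz => [/eqP-> //|Hz]]; move/eqP: Hz => ->.
  by move: Hz; rewrite !inE => Hz; do ![case/orP: Hz => [/eqP-> //|Hz]]; move/eqP: Hz => ->.
have D2 u : u < n -> ar s2 aDEL u = pred0 u by move=> Hu; rewrite run_keepa // D1.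
clearbody s2; rewrite run_seq; set s3 := run _ s2.
have D3 u : u < n -> ar s3 aDEL u = layer n e (oncyc e p) d u.
  move=> Hu; rewrite (@run_grow xD #xdd s2 a (oncyc e p) pred0 d) //=.
    by rewrite V2 // HDD Hdl.
  by move=> s' ->; rewrite ?V2.
have E3 : env G s3 by apply: env_run E2.
have A3 : alive n s3 a by apply: alive_run A2.
have V3 z : z \in [:: xv0; xD; xD3; xD4; xdd; xbb] -> vs s3 z = vs s z.
  move=> Hz; rewrite run_keepv ?V2 //.
  by move: Hz; rewrite !inE => Hz; do ![case/orP: Hz => [/eqP-> //|Hz]]; move/eqP: Hz => ->.
clearbody s3; rewrite run_seq; set s4 := run _ s3.
have Z4 u : u < n -> ar s4 aZ u = pred1 p.2 u.
  rewrite -[X in _ < X](proj1 E3); move: u.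
  apply: (@run_rows _ _ _ (fun u => pred1 p.2 u)) => s' u Hu Hv' Ha' Hr Ex u'.
  by rewrite run_put /= Ex Hv' // V3 // Hv0.
have E4 : env G s4 by apply: env_run E3.
have A4 : alive n s4 a by apply: alive_run A3.
have V4 z : z \in [:: xD; xD3; xD4; xdd; xbb] -> vs s4 z = vs s z.
  move=> Hz; rewrite run_keepv.
    by rewrite V3 //; move: Hz; rewrite !inE => Hz; do ![case/orP: Hz => [/eqP-> //|Hz]]; move/eqP: Hz => ->.
  by move: Hz; rewrite !inE => Hz; do ![case/orP: Hz => [/eqP-> //|Hz]]; move/eqP: Hz => ->.
have D4 u : u < n -> ar s4 aDEL u = layer n e (oncyc e p) d u.
  by move=> Hu; rewrite run_keepa // D3.
clearbody s4; rewrite run_seq; set s5 := run _ s4.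
have D5 u : u < n -> ar s5 aDEL u = layer n e (oncyc e p) d u || layer n e (pred1 p.2) (3 * D + b) u.
  move=> Hu; rewrite (@run_grow xD4 (eadd #xD3 #xbb) s4 a (pred1 p.2) (layer n e (oncyc e p) d) (3 * D + b)) //=.
    by rewrite V4 // H4 (_ : 3 * D + b < 4 * D) //; lia.
  by move=> s' Hs'; rewrite !Hs' // !V4 // H3 Hb.
have E5 : env G s5 by apply: env_run E4.
have A5 : alive n s5 a by apply: alive_run A4.
clearbody s5 => u; rewrite -[X in _ < X](proj1 E5); move: u.
apply: (@run_rows _ _ _ (fun u => [&& a u, ~~ layer n e (oncyc e p) d u & ~~ layer n e (pred1 p.2) (3 * D + b) u])).
move=> s' u Hu Hv' Ha' Hr Ex u'; rewrite (proj1 E5) in Hu.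
rewrite run_if run_put run_nop.
have -> : hev s' (HA aDEL #xu) = layer n e (oncyc e p) d u || layer n e (pred1 p.2) (3 * D + b) u.
  by rewrite /= Ex Ha' // D5.
rewrite -negb_or; case: (_ || _) => /=; first by rewrite Ex andbF.
by case: eqP => // ->; rewrite Hr andbT A5.
Qed.
End Spec.

(** * Rounds and trials as functions of the draws *)

Section Spec.
Variables (n : nat) (G : sgraph n) (k D L S H : nat).
Let g := nat_adj G.

Definition rmcyc (a : pred nat) : pred nat :=
  let p := shortest_odd n (induced g a) L in
  if p.1 < L then removed a (oncyc n (induced g a) p) else a.

Definition rmnbr (a : pred nat) (p : nat * nat) : pred nat :=
  removed a (fun u => has (fun q => g (cyc n (induced g a) p.2 p.1 q) u) (iota 0 p.1)).

Definition rmlay (a : pred nat) (p : nat * nat) d b : pred nat := fun u =>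
  [&& a u, ~~ layer n (induced g a) (oncyc n (induced g a) p) d u &
      ~~ layer n (induced g a) (pred1 p.2) (3 * D + b) u].

Definition finish (a : pred nat) d b : pred nat :=
  let p := shortest_odd n (induced g a) L in
  if p.1 < L then rmnbr a p else
  let p' := shortest_odd n (induced g a) n.+1 in
  if p'.1 < n.+1 then rmlay a p' d b else a.

Definition round_set (a : pred nat) j d b := finish (iter (minn n j) rmcyc a) d b.

Definition sample_set (dr : nat -> nat) o : pred nat :=
  foldl (fun a q => removed a (g (dr (o + q) %% n))) xpredT (iota 0 S).

Definition rounds_set (dr : nat -> nat) o (a : pred nat) i : pred nat :=
  foldl (fun a i => round_set a (dr (o + 3 * i) %% H) (dr (o + 3 * i).+1 %% D)
                             (dr (o + 3 * i).+2 %% D)) a (iota 0 i).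

Variables (Q : nat) (rnd : nat -> nat).
(** The value consumed at time [i], as the stack pointer descends from Q. *)
Let dr i := rnd (Q - 1 - i).

Definition penv (s : hstate) := env G s /\
  [/\ vs s xk = k, vs s xD = D, vs s xL = L, vs s xS = S & vs s xH = H] /\
  [/\ vs s xN = n.+1, vs s xD3 = 3 * D, vs s xD4 = 4 * D & forall i, ar s aRND i = rnd i].

Lemma penv_eq s s' : (forall x, x < 20 -> vs s' x = vs s x) -> ar s' aADJ = ar s aADJ ->
  ar s' aRND = ar s aRND -> penv s -> penv s'.
Proof.
move=> Hv H0 H1 [H2 [[H3 H4 H5 H6 H7] [H8 H9 H10 H11]]].
by split; [apply: env_eq H2; rewrite ?Hv ?H0|rewrite !Hv // H1].
Qed.

Lemma penv_run p s : wf ro p -> keepa aADJ p -> keepa aRND p -> penv s -> penv (run p s).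
Proof.
by move=> Hp H0 H1; apply: penv_eq; rewrite ?run_keepa // => x Hx; rewrite (@run_ro ro).
Qed.

Lemma penv_setv x v s : 20 <= x -> penv s -> penv (setv s x v).
Proof.
move=> Hx; apply: penv_eq => // y Hy /=; rewrite eqnE ifF //; apply/eqP; lia.
Qed.

Lemma run_pop x m s : run (pPop x m) s =
  setv (setv s xptr (vs s xptr - 1)) x
    (ar s aRND (vs s xptr - 1) %% (if eqn m xptr then vs s xptr - 1 else vs s m)).
Proof. by []. Qed.

Lemma run_greedy s a j : penv s -> alive n s a -> vs s xjj = j ->
  alive n (run (SFor xg xn (SIf (elt #xg #xjj)
     (pFind xL ;; SIf (elt #xlen #xL) pRmCyc SNop) SNop)) s) (iter (minn n j) rmcyc a).
Proof.
move=> HP Ha Hj; have [Henv [[_ _ HL _ _] _]] := HP.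
pose I i s' := alive n s' (iter (minn i j) rmcyc a).
suff : I (vs s xn) (run (SFor xg xn (SIf (elt #xg #xjj)
     (pFind xL ;; SIf (elt #xlen #xL) pRmCyc SNop) SNop)) s) by rewrite /I (proj1 Henv).
apply: (@for_frame I); rewrite /I; first by rewrite min0n.
move=> i s1 Hi Hv Hk HI; rewrite run_if run_nop.
have -> : hev (setv s1 xg i) (elt #xg #xjj) = (i < j) by rewrite /= Hv // Hj.
case: (ltnP i j) => Hij /=; last first.
  by apply: alive_eq (_ : alive n s1 _) => //; move: HI; rewrite !(minn_idPr _) //; lia.
rewrite run_seq (minn_idPl Hij) /=; rewrite (minn_idPl (ltnW Hij)) in HI.
set s2 := setv s1 xg i; set b := iter _ _ _ in HI *.
have A2 : alive n s2 b by [].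
have E2 : env G s2 by apply: env_eq Henv; rewrite /= ?Hv ?Hk.
have L2 : vs s2 xL = L by rewrite /s2 /= Hv.
clearbody s2 b; rewrite /rmcyc.
have := run_find (isT : (xL == xL) || (xL == xN)) E2 A2; cbv zeta; rewrite L2.
case=> F1 F2 F3.
have A3 : alive n (run (pFind xL) s2) b by apply: alive_run A2.
have L3 : vs (run (pFind xL) s2) xL = L by rewrite run_keepv.
rewrite run_if run_nop /= F1 L3; case: ltnP => Hlen //=.
by apply: run_rmcyc => //; rewrite L3 ltnW.
Qed.

Lemma run_round s a : 0 < D -> penv s -> alive n s a ->
  let p := vs s xptr in
  let s' := run pRound s in
  alive n s' (round_set a (rnd (p - 1) %% H) (rnd (p - 2) %% D) (rnd (p - 3) %% D)) /\
  vs s' xptr = p - 3.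
Proof.
move=> HD HP Ha p; cbv zeta; rewrite /pRound run_seq run_pop run_seq run_pop run_seq run_pop run_seq run_seq.
set s1 := setv (setv (setv (setv (setv _ _ _) _ _) _ _) _ _) _ _.
have [Henv [[_ HDD HL _ HH] [_ _ _ Hr]]] := HP.
have [J1 [D1 [B1 P1]]] : vs s1 xjj = rnd (p - 1) %% H /\ vs s1 xdd = rnd (p - 2) %% D /\
   vs s1 xbb = rnd (p - 3) %% D /\ vs s1 xptr = p - 3.
  by rewrite /s1 /= HH HDD !Hr -/p -!subnDA.
have E1 : penv s1 by do 6!apply: penv_setv => //.
have A1 : alive n s1 a by [].
clearbody s1; have A2 := run_greedy E1 A1 J1.
set s2 := run _ s1 in A2 *.
have E2 : penv s2 by apply: penv_run E1.
have [J2 [D2 [B2 P2]]] : vs s2 xjj = rnd (p - 1) %% H /\ vs s2 xdd = rnd (p - 2) %% D /\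
   vs s2 xbb = rnd (p - 3) %% D /\ vs s2 xptr = p - 3 by rewrite !run_keepv.
clearbody s2; rewrite /round_set; move: (iter _ _ _) A2 => b A2.
have [Henv2 [[_ HDD2 HL2 _ _] _]] := E2.
split; last by rewrite run_keepv // run_keepv.
have := run_find (isT : (xL == xL) || (xL == xN)) Henv2 A2; cbv zeta; rewrite HL2.
have A3 : alive n (run (pFind xL) s2) b by apply: alive_run A2.
have E3 : penv (run (pFind xL) s2) by apply: penv_run E2.
have [D3 B3] : vs (run (pFind xL) s2) xdd = rnd (p - 2) %% D /\
  vs (run (pFind xL) s2) xbb = rnd (p - 3) %% D by rewrite !run_keepv.
move: (run (pFind xL) s2) A3 E3 D3 B3 => s3 A3 E3 D3 B3.
have [Henv3 [[_ _ HL3 _ _] [HN3 _ _ _]]] := E3.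
set pp := shortest_odd _ _ _; case=> F1 F2 F3.
rewrite run_if run_seq run_if run_nop /finish -/pp.
have -> : hev s3 (elt #xlen #xL) = (pp.1 < L) by rewrite /= F1 HL3.
case: (ltnP pp.1 L) => Hp /=.
  apply: run_rmnbr => //; first by rewrite HL3 ltnW.
  move=> q Hq; split; first exact: F3.
  have [Ho Hw] := shortest_odd_found Hp.
  exact: (cyc_lt (@induced_sym _ G b) (@induced_lt _ G b) Hw (leq_ltn_trans (leq0n q) Hq) (ltnW Hq)).
have := run_find (isT : (xN == xL) || (xN == xN)) Henv3 A3; cbv zeta; rewrite HN3.
have A4 : alive n (run (pFind xN) s3) b by apply: alive_run A3.
have E4 : penv (run (pFind xN) s3) by apply: penv_run E3.
have [D4 B4] : vs (run (pFind xN) s3) xdd = rnd (p - 2) %% D /\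
  vs (run (pFind xN) s3) xbb = rnd (p - 3) %% D by rewrite !run_keepv.
move: (run (pFind xN) s3) A4 E4 D4 B4 => s4 A4 E4 D4 B4.
have [Henv4 [[_ HDD4 HL4 _ _] [HN4 HD34 HD44 _]]] := E4.
set pp' := shortest_odd _ _ n.+1; case=> F4 F5 F6.
rewrite F4 HN4.
case: (ltnP pp'.1 n.+1) => Hp' //=.
by apply: run_rmlay => //; rewrite ?ltn_pmod // ltnW.
Qed.

Lemma run_sample s o : penv s -> vs s xptr = Q - o ->
  let s' := run pSample s in
  alive n s' (sample_set dr o) /\ vs s' xptr = Q - (o + S).
Proof.
move=> HP Hp; have [Henv [[_ _ _ HS _] [_ _ _ Hr]]] := HP.
cbv zeta; rewrite /pSample run_seq; set s1 := run _ s.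
have A1 : alive n s1 xpredT.
  move=> u; rewrite -[X in _ < X](proj1 Henv) /s1; move: u.
  apply: (@run_rows _ _ _ (fun u => xpredT u)) => s' u Hu _ _ _ Ex u'.
  by rewrite run_put /= Ex.
have E1 : penv s1 by apply: penv_run HP.
have P1 : vs s1 xptr = Q - o by rewrite run_keepv.
clearbody s1; have [Henv1 [[_ _ _ HS1 _] [_ _ _ Hr1]]] := E1.
pose I i s' := alive n s' (foldl (fun a q => removed a (g (dr (o + q) %% n))) xpredT (iota 0 i)) /\
   vs s' xptr = Q - (o + i).
suff : I (vs s1 xS) (run (SFor xq xS (pPop xsm xn ;;
    SFor xu xn (SIf (HA aADJ (eidx #xsm #xu)) (SPut aA #xu (HC 0)) SNop))) s1).
  by rewrite /I HS1.
apply: (@for_frame I); rewrite /I; first by rewrite addn0.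
move=> i s2 Hi Hv Hk [HI HPt]; rewrite foldl_iotaS; move: (foldl _ _ _) HI => a HI.
rewrite run_seq run_pop; set s3 := setv _ xsm _.
have [P3 S3] : vs s3 xptr = Q - (o + i.+1) /\ vs s3 xsm = dr (o + i) %% n.
  rewrite /s3 /= HPt Hk // Hr1 Hv // (proj1 Henv1).
  by rewrite (_ : Q - (o + i) - 1 = Q - 1 - (o + i)) //; lia.
have E3 : env G s3 by apply: env_eq Henv1; rewrite /= ?Hv ?Hk.
have A3 : alive n s3 a by [].
clearbody s3; split; last by rewrite run_keepv.
move=> u; rewrite -[X in _ < X](proj1 E3); move: u.
apply: (@run_rows _ _ _ (fun u => removed a (g (dr (o + i) %% n)) u)) => s4 u Hu Hv4 Ha4 Hr4 Ex u'.
rewrite (proj1 E3) in Hu; rewrite run_if run_put run_nop.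
have -> : hev s4 (HA aADJ (eidx #xsm #xu)) = g (dr (o + i) %% n) u.
  have N4 : vs s4 xn = n by rewrite Hv4 ?(proj1 E3).
  have Q4 : vs s4 xsm = dr (o + i) %% n by rewrite Hv4.
  by rewrite /= Ex Q4 N4 !Ha4 // (proj2 E3) // ltn_mod; lia.
rewrite /removed; case: (g _ u) => /=; first by rewrite Ex andbF.
by case: eqP => // ->; rewrite Hr4 A3 // andbT.
Qed.

Definition trial_set o := rounds_set dr (o + S) (sample_set dr o) k.

Lemma run_prefix s o : 0 < D -> penv s -> vs s xptr = Q - o ->
  let s' := run (SFor xi xk pRound) (run pSample s) in
  alive n s' (trial_set o) /\ vs s' xptr = Q - (o + S + 3 * k).
Proof.
move=> HD HP Hp; have := run_sample HP Hp; cbv zeta => -[A1 P1].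
have E1 : penv (run pSample s) by apply: penv_run HP.
move: (run pSample s) A1 P1 E1 => s1 A1 P1 E1; rewrite /trial_set.
move: (sample_set _ _) A1 => a A1; set o' := o + S in P1 *.
have [_ [[Hk1 _ _ _ _] _]] := E1.
pose I i s' := [/\ penv s', alive n s' (rounds_set dr o' a i) & vs s' xptr = Q - (o' + 3 * i)].
suff : I (vs s1 xk) (run (SFor xi xk pRound) s1) by rewrite Hk1; case.
apply: (@for_frame I); rewrite /I; first by rewrite muln0 addn0.
move=> i s2 Hi Hv Hk [E2 A2 P2].
have E3 : penv (setv s2 xi i) by apply: penv_setv.
have := @run_round (setv s2 xi i) _ HD E3 A2; cbv zeta => -[A3 P3].
split; first exact: penv_run.
  rewrite /rounds_set foldl_iotaS -/(rounds_set dr o' a i) /dr.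
  rewrite (_ : Q - 1 - (o' + 3 * i) = vs (setv s2 xi i) xptr - 1); last by rewrite /= P2; lia.
  rewrite (_ : Q - 1 - (o' + 3 * i).+1 = vs (setv s2 xi i) xptr - 2); last by rewrite /= P2; lia.
  by rewrite (_ : Q - 1 - (o' + 3 * i).+2 = vs (setv s2 xi i) xptr - 3) //= P2; lia.
by rewrite P3 /= P2; lia.
Qed.

End Spec.

(** * Colouring of the bipartite remainder *)

Section Spec.
Variables (n : nat) (G : sgraph n).
Let g := nat_adj G.

Section Color.
Variable (a : pred nat).
Let e := induced g a.
Let es : symmetric e := @induced_sym n G a.
Let el : forall x y, e x y -> x < n := @induced_lt n G a.
Hypothesis Hbip : forall v j, odd j -> ~~ walk n e v j v.

Definition colored (col : nat -> nat) := forall x y, e x y -> col x != 2 ->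
  (col y != 2) && (col x != col y).

(** Adjacent vertices reached by walks of lengths j and j' of equal parity would close an odd walk
    of length j + 1 + j'. A neighbour of a reached vertex is itself reached, by [walk_short] already
    within the tabulated lengths, so old and new colours never meet along an edge. *)
Lemma colored_step (col col' : nat -> nat) v : v < n -> colored col -> col v = 2 ->
  (forall u, u < n -> (exists2 j, walk n e v j u & col' u = j %% 2) \/
     ((forall j, j <= n -> ~~ walk n e v j u) /\ col' u = col u)) ->
  colored col'.
Proof.
move=> Hv Hc Hcv H x y He Hx.
have Hxn : x < n := el He.
have Hyn : y < n by apply: (@el y x); rewrite es.
have reach_e u u' j : e u u' -> walk n e v j u -> u' < n ->
    exists2 j, walk n e v j u' & col' u' = j %% 2.
  move=> Heu Hw Hu'.
  have [i Hi Hwi] := walk_short es el (walk_cat el Hw (walk1 el Heu)).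
  by case: (H u' Hu') => // -[/(_ i Hi)]; rewrite Hwi.
have He' : e y x by rewrite es.
case: (H x Hxn) => [[j Hj Ej]|[Hn Ex]].
  have [j' Hj' Ej'] := reach_e _ _ _ He Hj Hyn.
  have Hw := walk_cat el Hj (walk_cat el (walk1 el He) (walk_rev es el Hj')).
  have := Hbip v (j := j + (1 + j')); rewrite Hw Ej Ej' !modn2 => Hodd.
  apply/andP; split; first by case: (odd j').
  by apply/negP => /eqP E; have := Hodd; rewrite (_ : odd (j + (1 + j'))) //; lia.
case: (H y Hyn) => [[j Hj _]|[_ Ey]].
  have [i Hi Hwi] := walk_short es el (walk_cat el Hj (walk1 el He')).
  by have := Hn i Hi; rewrite Hwi.
by rewrite Ex in Hx *; rewrite Ey; apply: Hc.
Qed.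

Lemma run_color s : env G s -> alive n s a -> vs s xN = n.+1 ->
  forall x y, e x y ->
  ((ar (run pColor s) aCOL x == 0) && (ar (run pColor s) aCOL y == 1)) ||
  ((ar (run pColor s) aCOL x == 1) && (ar (run pColor s) aCOL y == 0)).
Proof.
move=> Henv Ha HN.
pose I i s' := [/\ forall u, u < n -> ar s' aCOL u <= 2,
   forall u, u < i -> u < n -> ar s' aCOL u != 2 & colored (ar s' aCOL)].
suff : I n (run pColor s).
  case=> H1 H2 H3 x y He.
  have Hx := el He; have Hy : y < n by apply: (@el y x); rewrite es.
  have /andP[Hny Hxy] := H3 x y He (H2 x Hx Hx).
  by have := H1 x Hx; have := H1 y Hy; have := H2 x Hx Hx; lia.
rewrite /pColor run_seq; set s1 := run _ s.
have C1 u : u < n -> ar s1 aCOL u = 2.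
  rewrite -[X in _ < X](proj1 Henv); move: u.
  apply: (@run_rows _ _ _ (fun u => 2)) => s' u Hu _ _ _ Ex u'.
  by rewrite run_put /= Ex.
have E1 : env G s1 by apply: env_run Henv.
have A1 : alive n s1 a by apply: alive_run Ha.
have N1 : vs s1 xN = n.+1 by rewrite run_keepv.
clearbody s1; rewrite -(proj1 E1).
apply: (@for_frame I); rewrite /I.
  split=> [u Hu|//|x y He]; first by rewrite C1.
  by rewrite C1 // (el He).
move=> v s2 Hv Hk Hka [I1 I2 I3]; rewrite (proj1 E1) in Hv.
rewrite run_if run_nop.
have -> : (hev (setv s2 xv v) (eeq (HA aCOL #xv) (HC 2)) == 0) = (ar s2 aCOL v != 2).
  by rewrite /=; case: (ar s2 aCOL v == 2).
set s3 := setv s2 xv v; case: eqP => /= Ev; last first.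
  split=> // u; rewrite ltnS leq_eqVlt => /orP[/eqP->|/I2] //.
  by move=> _; apply/eqP.
have E3 : env G s3 by apply: env_eq E1; rewrite /= ?Hk ?Hka.
have A3 : alive n s3 a by apply: alive_eq A1; rewrite /= Hka.
have N3 : vs s3 xN = n.+1 by rewrite /s3 /= Hk.
have V3 : vs s3 xv = v by [].
have C3 : ar s3 aCOL = ar s2 aCOL by [].
clearbody s3; rewrite run_seq.
have := run_walk (isT : (xv == xv) || (xv == xv0)) (isT : (xN == xL) || (xN == xN)) E3 A3.
rewrite N3 V3 => HW.
have E4 : env G (run (pWalk xv xN) s3) by apply: env_run E3.
have C4 : ar (run (pWalk xv xN) s3) aCOL = ar s2 aCOL by rewrite run_keepa.
have N4 : vs (run (pWalk xv xN) s3) xN = n.+1 by rewrite run_keepv.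
move: (run (pWalk xv xN) s3) HW E4 C4 N4 => s4 HW E4 C4 N4.
set s5 := run _ s4.
have H5 u : u < n ->
   (exists2 j, walk n e v j u & ar s5 aCOL u = j %% 2) \/
   ((forall j, j <= n -> ~~ walk n e v j u) /\ ar s5 aCOL u = ar s2 aCOL u).
  pose J i s' := forall u, u < n ->
    (exists2 j, walk n e v j u & ar s' aCOL u = j %% 2) \/
    ((forall j, j < i -> ~~ walk n e v j u) /\ ar s' aCOL u = ar s2 aCOL u).
  have HJ : J (vs s4 xN) s5.
    apply: (@for_frame J); rewrite /J; first by move=> w Hw; right; rewrite C4.
    move=> j s6 Hj Hk6 Hka6 HI6; set s7 := setv s6 xj j.
    have N7 : vs s7 xn = n by rewrite /s7 /= Hk6 ?(proj1 E4).
    have R w : w < n -> ar (run (SFor xu xn (SIf (HA aW (eidx #xj #xu))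
      (SPut aCOL #xu (emod #xj (HC 2))) SNop)) s7) aCOL w =
        if walk n e v j w then j %% 2 else ar s6 aCOL w.
      rewrite -[X in _ < X]N7; move: w.
      apply: (@run_rows _ _ _ (fun w => if walk n e v j w then j %% 2 else ar s6 aCOL w)).
      move=> s8 w Hw Hv8 Ha8 Hr Ex w'; rewrite N7 in Hw.
      rewrite run_if run_put run_nop.
      have -> : hev s8 (HA aW (eidx #xj #xu)) = walk n e v j w.
        rewrite /= Ex !Hv8 // N7 Ha8 // /s7 /= Hka6 // HW //.
        by rewrite N4 in Hj; lia.
      have J8 : vs s8 xj = j by rewrite Hv8.
      case: (walk _ _ _ _ _) => /=; first by rewrite Ex J8.
      by case: eqP => // ->; rewrite Hr.
    move=> w Hw; rewrite R //; case: ifP => Hwk; first by left; exists j.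
    case: (HI6 w Hw) => [[i Hi Ei]|[Hn Eq]]; first by left; exists i.
    right; split=> // i; rewrite ltnS leq_eqVlt => /orP[/eqP->|/Hn] //.
    by rewrite Hwk.
  rewrite N4 in HJ; move=> Hu; case: (HJ u Hu) => [|[Hn E]]; first by left.
  by right; split=> // j Hj; apply: Hn.
clearbody s5; split.
- move=> u Hu; case: (H5 u Hu) => [[j _ ->]|[_ ->]]; last exact: I1.
  by rewrite modn2; case: (odd j).
- move=> u Hui Hu; case: (H5 u Hu) => [[j _ ->]|[Hn ->]].
    by rewrite modn2; case: (odd j).
  move: Hui; rewrite ltnS leq_eqVlt => /orP[/eqP Euv|Hui]; last exact: I2.
  by have := Hn 0 isT; rewrite /= Euv eqxx.
exact: colored_step Hv I3 Ev H5.
Qed.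
End Color.

End Spec.

(** * Invariant and termination of the auction *)

Section Auction.
Variables (n D : nat) (g : rel nat) (a : pred nat) (col : nat -> nat).
Hypotheses (g_sym : symmetric g) (g_lt : forall x y, g x y -> x < n).
Let e := induced g a.
Let es x y : e x y = e y x. Proof. by rewrite /e /induced g_sym andbCA. Qed.
Let el x y : e x y -> x < n. Proof. by case/and3P => _ _ /g_lt. Qed.
Let er x y : e x y -> y < n. Proof. by rewrite es; apply: el. Qed.

Hypothesis Hcol : forall x y, e x y ->
  ((col x == 0) && (col y == 1)) || ((col x == 1) && (col y == 0)).

Definition auction_inv (mate lev : nat -> nat) :=
  [/\ mate_ok n g a col mate, mate_inj n mate, lev_ok n D mate lev,
      mate_lev n g a mate lev & forall x, x < n -> mate x <= n].

Definition bid (mate : nat -> nat) x y :=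
  [&& e x y, col x == 0, col y == 1 & mate x == n].

(** The previous owner of [by'] is displaced, so the lowered level concerns only the new owner [bx];
    as it was maximal among the levels on offer to [bx], it now lies at most one below any of
    them. *)
Lemma auction_step mate lev mate' lev' bx by' :
  auction_inv mate lev -> bid mate bx by' -> 0 < lev by' ->
  (forall x y, bid mate x y -> lev y <= lev by') ->
  (forall x, x < n -> mate' x = if x == bx then by' else if mate x == by' then n else mate x) ->
  (forall y, lev' y = if y == by' then lev y - 1 else lev y) ->
  auction_inv mate' lev' /\
  (\sum_(0 <= y < n) lev' y).+1 = \sum_(0 <= y < n) lev y.
Proof.
move=> [M1 M2 M3 M4 M5] /and4P[He /eqP Cx /eqP Cy /eqP Mx] Hpos Hmax Em El.
have Hbx := el He; have Hby := er He.
have lev_le y : lev' y <= lev y by rewrite El; case: ifP; lia.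
split; last first.
  rewrite (big_cat_nat (n := by')) //=; last exact: ltnW.
  rewrite [in RHS](big_cat_nat (n := by')) //=; last exact: ltnW.
  rewrite -addnS; congr addn.
    by rewrite big_nat [RHS]big_nat; apply: eq_bigr => y /andP[_ Hy]; rewrite El ifF //; apply/eqP; lia.
  rewrite big_ltn // [in RHS]big_ltn // El eqxx -addSn; congr addn; first by lia.
  by rewrite big_nat [RHS]big_nat; apply: eq_bigr => y /andP[Hy _]; rewrite El ifF //; apply/eqP; lia.
split.
- move=> x Hx; rewrite Em //; case: eqP => [->|_] //.
  case: eqP => [_|_]; [by rewrite ltnn | exact: M1].
- move=> x x' Hx Hx'; rewrite !Em //.
  case: (x =P bx) => [->|nx]; case: (x' =P bx) => [->|nx'] //.
  + by case: eqP => [_ _ E|nE _ E]; [rewrite E ltnn in Hby | case: nE].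
  + by case: eqP => [_|nE]; [rewrite ltnn | move=> _ E; case: nE].
  + case: eqP => [_|_]; first by rewrite ltnn.
    case: eqP => [_|_]; last exact: M2.
    by move=> Hm E; rewrite E ltnn in Hm.
- move=> y Hy; rewrite El; case: eqP => [->|ny] Hl.
    by exists bx; rewrite // Em // eqxx.
  have [x Hx Ex] := M3 y Hy Hl; exists x; rewrite // Em //.
  case: eqP => [Ebx|_]; first by rewrite -Ex Ebx Mx ltnn in Hy.
  by case: eqP => // Exb; case: ny; rewrite -Ex.
- move=> x y Hx; rewrite Em //; case: eqP => [->|nx].
    move=> _ Hxy; rewrite [lev' by']El eqxx.
    have : lev y <= lev by'.
      case: (posnP (lev y)) => [->//|Hy]; apply: (Hmax bx); apply/and4P; split; rewrite ?Cx ?Mx //.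
      by case/orP: (Hcol Hxy) => /andP[]; rewrite ?Cx.
    by have := lev_le y; lia.
  case: eqP => [_|nE]; first by rewrite ltnn.
  move=> Hm Hxy; have := M4 x y Hx Hm Hxy; have := lev_le y.
  by rewrite [lev' (mate x)]El; case: eqP => [E|_]; [case: nE|lia].
- move=> x Hx; rewrite Em //; case: eqP => _; first exact: ltnW.
  by case: eqP => _ //; apply: M5.
Qed.
End Auction.

Section Spec.
Variables (n : nat) (G : sgraph n).
Let g := nat_adj G.

Section AuctionProg.
Variables (D : nat) (a : pred nat) (col : nat -> nat).
Let e := induced g a.
Let gs := @nat_adj_sym n G.
Let gl := @nat_adj_lt n G.
Let es : symmetric e := @induced_sym n G a.
Let el : forall x y, e x y -> x < n := @induced_lt n G a.
Hypothesis Hcol : forall x y, e x y ->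
  ((col x == 0) && (col y == 1)) || ((col x == 1) && (col y == 0)).

Let bidn := bid n g a col.

Lemma run_scan s : env G s -> alive n s a -> (forall u, ar s aCOL u = col u) ->
  let s' := run pScan s in
  (forall x y, bidn (ar s aMATE) x y -> ar s aLEV y <= vs s' xbl) /\
  (0 < vs s' xbl -> bidn (ar s aMATE) (vs s' xbx) (vs s' xby) /\ ar s aLEV (vs s' xby) = vs s' xbl).
Proof.
move=> Henv Ha Hc; cbv zeta; rewrite /pScan run_seq run_set.
set s0 := setv s xbl _.
have E0 : env G s0 by apply: env_eq Henv.
have A0 : alive n s0 a by [].
have R0 : ar s0 = ar s by [].
have B0 : vs s0 xbl = 0 by [].
clearbody s0.
pose I i s' := (forall x y, x < i -> bidn (ar s aMATE) x y -> ar s aLEV y <= vs s' xbl) /\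
  (0 < vs s' xbl -> bidn (ar s aMATE) (vs s' xbx) (vs s' xby) /\ ar s aLEV (vs s' xby) = vs s' xbl).
set s9 := run _ s0.
suff [H1 H2] : I (vs s0 xn) s9.
  split=> // x y Hxy; apply: H1 (Hxy); rewrite (proj1 E0).
  by case/and4P: Hxy => /el.
apply: (@for_frame I); rewrite /I; first by rewrite B0.
move=> x s1 Hx Hk Hka [I1 I2]; rewrite (proj1 E0) in Hx.
set s2 := setv s1 xx x.
have E2 : env G s2 by apply: env_eq E0; rewrite /= ?Hk ?Hka.
have A2 : alive n s2 a by apply: alive_eq A0; rewrite /= Hka.
have R2 b : b \in [:: aCOL; aMATE; aLEV] -> ar s2 b = ar s b.
  by rewrite -R0 !inE => /or3P[] /eqP-> /=; rewrite Hka.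
have X2 : vs s2 xx = x by [].
pose J i s' := (forall x' y, (x' < x) || (x' == x) && (y < i) ->
     bidn (ar s aMATE) x' y -> ar s aLEV y <= vs s' xbl) /\
  (0 < vs s' xbl -> bidn (ar s aMATE) (vs s' xbx) (vs s' xby) /\ ar s aLEV (vs s' xby) = vs s' xbl).
suff [H1 H2] : J (vs s2 xn) (run (SFor xy xn (
    SIf (emul (emul (eE #xx #xy) (emul (eeq (HA aCOL #xx) (HC 0)) (eeq (HA aCOL #xy) (HC 1))))
              (emul (eeq (HA aMATE #xx) #xn) (elt #xbl (HA aLEV #xy))))
      (SSet xbl (HA aLEV #xy) ;; SSet xbx #xx ;; SSet xby #xy) SNop)) s2).
  split=> // x' y Hx' Hb; apply: H1 (Hb).
  have -> : y < vs s2 xn by rewrite (proj1 E2); case/and4P: Hb; rewrite -/e es => /el.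
  by rewrite andbT; lia.
apply: (@for_frame J); rewrite /J.
  by split=> // x' y; rewrite andbF orbF; apply: I1.
move=> y s3 Hy Hk3 Hka3 [J1 J2]; rewrite (proj1 E2) in Hy.
rewrite run_if run_nop !run_seq !run_set.
set s4 := setv s3 xy y.
have E4 : env G s4 by apply: env_eq E2; rewrite /= ?Hk3 ?Hka3.
have A4 : alive n s4 a by apply: alive_eq A2; rewrite /= Hka3.
have R4 b : b \in [:: aCOL; aMATE; aLEV] -> ar s4 b = ar s b.
  by move=> Hb; rewrite /= Hka3 // R2.
have X4 : vs s4 xx = x by rewrite /= Hk3.
have Y4 : vs s4 xy = y by [].
have [Bl4 Bx4 By4] : [/\ vs s4 xbl = vs s3 xbl, vs s4 xbx = vs s3 xbx & vs s4 xby = vs s3 xby] by [].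
have -> : (hev s4 (emul (emul (eE #xx #xy) (emul (eeq (HA aCOL #xx) (HC 0)) (eeq (HA aCOL #xy) (HC 1))))
              (emul (eeq (HA aMATE #xx) #xn) (elt #xbl (HA aLEV #xy)))) == 0) =
   ~~ (bidn (ar s aMATE) x y && (vs s3 xbl < ar s aLEV y)).
  have EE : hev s4 (eE #xx #xy) = e x y by rewrite (hev_E E4 A4) /= ?Hk3 ?X2.
  have -> : hev s4 (emul (emul (eE #xx #xy) (emul (eeq (HA aCOL #xx) (HC 0)) (eeq (HA aCOL #xy) (HC 1))))
              (emul (eeq (HA aMATE #xx) #xn) (elt #xbl (HA aLEV #xy)))) =
     (hev s4 (eE #xx #xy) * ((ar s4 aCOL (vs s4 xx) == 0) * (ar s4 aCOL (vs s4 xy) == 1))) *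
     ((ar s4 aMATE (vs s4 xx) == vs s4 xn) * (vs s4 xbl < ar s4 aLEV (vs s4 xy))) by [].
  rewrite EE X4 Y4 !R4 // Bl4 (proj1 E4) !Hc /bidn /bid -/e.
  by case: (e x y); case: (col x == 0); case: (col y == 1); case: (_ == n); case: (_ < _).
clearbody s4.
case Hb: (_ && _) => /=.
  case/andP: Hb => Hb Hl; rewrite X4 Y4 R4 //; split.
    move=> x' y'; rewrite ltnS => Hv Hb'.
    case Hv': ((x' < x) || (x' == x) && (y' < y)); last first.
      by have -> : y' = y by lia.
    by apply: ltnW; apply: leq_ltn_trans (J1 _ _ Hv' Hb') Hl.
  by move=> _; split.
rewrite Bl4 Bx4 By4; split=> // x' y'; rewrite ltnS => Hv Hb'.
case Hv': ((x' < x) || (x' == x) && (y' < y)); first exact: J1 Hv' Hb'.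
have [Ex Ey] : x' = x /\ y' = y by lia.
by move: Hb; rewrite -Ex -Ey Hb' /=; lia.
Qed.

Definition ended (mate lev : nat -> nat) := mate_end n g a col mate lev.

Definition ainv s := [/\ env G s, alive n s a, forall u, ar s aCOL u = col u &
   auction_inv n D g a col (ar s aMATE) (ar s aLEV)].

(** The second alternative records that the auction was not over before: this lets the disjunction
    be carried through all D n steps, idle ones at the end included. *)
Lemma run_step s : ainv s -> ainv (run pStep s) /\
  (ended (ar (run pStep s) aMATE) (ar (run pStep s) aLEV) \/
   ~ ended (ar s aMATE) (ar s aLEV) /\
   (\sum_(0 <= y < n) ar (run pStep s) aLEV y).+1 = \sum_(0 <= y < n) ar s aLEV y).
Proof.
move=> [Henv Ha Hc Hinv]; rewrite /pStep run_seq.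
have := run_scan Henv Ha Hc; cbv zeta.
have E1 : env G (run pScan s) by apply: env_run Henv.
have A1 : alive n (run pScan s) a by apply: alive_run Ha.
have C1 u : ar (run pScan s) aCOL u = col u by rewrite run_keepa.
have M1 : ar (run pScan s) aMATE = ar s aMATE by rewrite run_keepa.
have L1 : ar (run pScan s) aLEV = ar s aLEV by rewrite run_keepa.
move: (run pScan s) E1 A1 C1 M1 L1 => s1 E1 A1 C1 M1 L1 [S1 S2].
rewrite run_if run_nop; have [B0|Bp] := posnP (vs s1 xbl).
  split; first by split=> //; rewrite M1 L1.
  left; rewrite /ended /mate_end; cbv zeta => x y He Cx Hm; case: Hinv => _ _ _ _ H5.
  rewrite L1; suff: ar s aLEV y <= vs s1 xbl by lia.
  apply: (S1 x); apply/and4P; split=> //.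
  - by rewrite Cx.
  - by case/orP: (Hcol He) => /andP[]; rewrite ?Cx.
  - by rewrite eqn_leq H5 ?(el He) // -M1.
have [Hbid Hlev] := S2 Bp; rewrite !run_seq !run_put.
set s2 := run _ s1.
have M2 x : x < n -> ar s2 aMATE x = if ar s aMATE x == vs s1 xby then n else ar s aMATE x.
  have R : forall x, x < vs s1 xn -> forall s', s' = s2 ->
     ar s' aMATE x = if ar s aMATE x == vs s1 xby then n else ar s aMATE x.
    pose J i s' := forall x, ar s' aMATE x =
       if (x < i) && (ar s aMATE x == vs s1 xby) then n else ar s aMATE x.
    suff HJ : J (vs s1 xn) s2 by move=> w Hw s' ->; rewrite HJ Hw.
    apply: (@for_frame J); rewrite /J; first by move=> w; rewrite M1.
    move=> i s3 Hi Hk Hka HJ w; rewrite run_if run_put run_nop.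
    have -> : hev (setv s3 xx i) (eeq (HA aMATE #xx) #xby) = (ar s aMATE i == vs s1 xby).
      by rewrite /= HJ ltnn Hk.
    case Ei: (ar s aMATE i == vs s1 xby) => /=.
      rewrite HJ ltnS Hk // (proj1 E1).
      by case: ltngtP => // ->; rewrite Ei.
    by rewrite HJ ltnS; case: ltngtP => // ->; rewrite Ei.
  by move=> Hx; apply: R; rewrite ?(proj1 E1).
have E2 : env G s2 by apply: env_run E1.
have A2 : alive n s2 a by apply: alive_run A1.
have C2 u : ar s2 aCOL u = col u by rewrite run_keepa.
have L2 : ar s2 aLEV = ar s aLEV by rewrite run_keepa.
have [Bx2 By2] : vs s2 xbx = vs s1 xbx /\ vs s2 xby = vs s1 xby by rewrite !run_keepv.
clearbody s2; set s3 := seta _ aLEV _ _.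
have Hstep : auction_inv n D g a col (ar s3 aMATE) (ar s3 aLEV) /\
   (\sum_(0 <= y < n) ar s3 aLEV y).+1 = \sum_(0 <= y < n) ar s aLEV y.
  apply: (auction_step gs gl Hcol Hinv Hbid).
  - by rewrite Hlev.
  - by move=> x y Hxy; rewrite Hlev; apply: S1 Hxy.
  - by move=> x Hx; rewrite /s3 /= Bx2 By2 M2.
  - by move=> y; rewrite /s3 /= By2 L2; case: eqP => // ->.
case: Hstep => H1 H2; split; first by split.
right; split=> // Hend.
case/and4P: Hbid => He /eqP Cx _ /eqP Mx.
by have := Hend _ _ He Cx; rewrite Mx => /(_ (leqnn n)); rewrite Hlev; lia.
Qed.

Lemma run_auction s : env G s -> alive n s a -> (forall u, ar s aCOL u = col u) ->
  vs s xD = D -> let s' := run pAuction s in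
  ainv s' /\ ended (ar s' aMATE) (ar s' aLEV).
Proof.
move=> Henv Ha Hc HD; cbv zeta; rewrite /pAuction run_seq; set s1 := run _ s.
have [M1 L1] : (forall u, u < n -> ar s1 aMATE u = n) /\ (forall u, u < n -> ar s1 aLEV u = D).
  split=> u; rewrite -[X in _ < X](proj1 Henv); move: u.
    apply: (@run_rows _ _ _ (fun u => n)) => s' u Hu Hv _ _ Ex u'.
    by rewrite run_seq !run_put /= Ex Hv // (proj1 Henv).
  apply: (@run_rows _ _ _ (fun u => D)) => s' u Hu Hv _ _ Ex u'.
  by rewrite run_seq !run_put /= Ex Hv // HD.
have I1 : ainv s1.
  split.
  - exact: env_run Henv.
  - exact: alive_run Ha.
  - by move=> u; rewrite run_keepa.
  split.
  - by move=> x Hx; rewrite M1 // ltnn.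
  - by move=> x x' Hx Hx'; rewrite M1 // ltnn.
  - by move=> y Hy; rewrite L1 // ltnn.
  - by move=> x y Hx; rewrite M1 // ltnn.
  - by move=> x Hx; rewrite M1.
have D1 : vs s1 xD = D by rewrite run_keepv.
have S1 : \sum_(0 <= y < n) ar s1 aLEV y <= D * n.
  rewrite big_nat (eq_bigr (fun=> D)); last by move=> y /andP[_ Hy]; rewrite L1.
  by rewrite -big_nat sum_nat_const_nat subn0 mulnC.
clearbody s1.
pose J c s' := ainv s' /\ (ended (ar s' aMATE) (ar s' aLEV) \/
   \sum_(0 <= y < n) ar s' aLEV y + c <= D * n).
have J_setv c s' x v : J c s' -> eqn 0 x = false -> J c (setv s' x v).
  by move=> [[H1 H2 H3 H4] H5] Hx; split=> //; split=> //; apply: env_eq H1; rewrite /= ?Hx.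
have J_step c s' : J c s' -> J c.+1 (run pStep s').
  move=> [H1 H2]; have [H3 H4] := run_step H1; split=> //.
  case: H4 => [|[Hne Hs]]; first by left.
  by right; case: H2 => // H2; lia.
have : J (D * n) (run (SFor xi xD (SFor xq xn pStep)) s1).
  rewrite -{1}D1; apply: (@for_frame (fun i s' => J (i * n) s')).
    by rewrite mul0n; split=> //; right; rewrite addn0.
  move=> i s2 Hi Hk Hka HJ.
  have HJ' := J_setv _ _ xi i HJ erefl.
  have N2 : vs (setv s2 xi i) xn = n by case: HJ' => -[[]].
  rewrite mulSn addnC -[X in J (_ + X)]N2.
  apply: (@for_frame (fun q s' => J (i * n + q) s')); first by rewrite addn0.
  move=> q s3 Hq Hk3 Hka3 HJ3; rewrite addnS; apply: J_step; exact: J_setv.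
case=> H1 [H2|H2]; first by split.
(* After D n effective bids the sum of the levels is 0, so all levels are 0 and the auction is over
   in this case too. *)
split=> //; rewrite /ended /mate_end; cbv zeta => x y He Cx Hm.
have Hy : y < n by move: He; rewrite -/e es => /el.
move: H2; rewrite (big_cat_nat (n := y)) //=; last exact: ltnW.
rewrite [X in _ + X + _]big_ltn //; lia.
Qed.

End AuctionProg.

(** * Candidates and the best independent set so far *)

Definition bestp (s : hstate) : pred nat := fun u => ar s aBEST u != 0.

Definition bestinv s := [/\ forall x y, x < n -> y < n -> bestp s x -> bestp s y -> ~~ g x y,
   vs s xbc = n - count (bestp s) (iota 0 n) &
   forall u, u < n -> ar s aBEST u <= 1].

Lemma run_cand s a th : env G s -> alive n s a -> vs s xth = th ->
  forall u, u < n -> ar (run pCand s) aCAND u =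
    candidate n g a (ar s aCOL) (ar s aLEV) th u.
Proof.
move=> Henv Ha Ht u; rewrite -[X in _ < X](proj1 Henv); move: u.
apply: (@run_rows _ _ _ (fun u => candidate n g a (ar s aCOL) (ar s aLEV) th u)).
move=> s1 u Hu Hk Hka Hr Ex u'; rewrite (proj1 Henv) in Hu.
have E1 : env G s1 by apply: env_eq Henv; rewrite ?Hk ?Hka.
have A1 : alive n s1 a by apply: alive_eq Ha; rewrite Hka.
have T1 : vs s1 xth = th by rewrite Hk.
rewrite run_if run_put run_seq run_put /candidate.
have -> : hev s1 (eeq (HA aCOL #xu) (HC 1)) = (ar s aCOL u == 1) by rewrite /= Ex Hka.
case: (ar s aCOL u == 1) => /=.
  rewrite Ex T1 A1 // Hka //; case: eqP => // _.
  by case: (a u); case: (th < _).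
rewrite run_keepv // Ex !run_keepa // A1 //.
have -> : vs (run (pAny xacc xy xn (emul (eE #xu #xy) (elt #xth (HA aLEV #xy)))) s1) xacc =
   has (fun y => induced g a u y && (th < ar s aLEV y)) (iota 0 n).
  rewrite -[X in iota _ X](proj1 E1); apply: run_any => // s' y Hy Hv' Ha' Ey.
  rewrite (proj1 E1) in Hy.
  have E' : env G s' by apply: env_eq E1; rewrite ?Hv' ?Ha'.
  have A' : alive n s' a by apply: alive_eq A1; rewrite Ha'.
  have EE : hev s' (eE #xu #xy) = induced g a u y by rewrite (hev_E E' A') /= ?Ey ?Hv' ?Ex.
  have -> : hev s' (emul (eE #xu #xy) (elt #xth (HA aLEV #xy))) =
    hev s' (eE #xu #xy) * (vs s' xth < ar s' aLEV (vs s' xy)) by [].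
  rewrite EE Ey Hv' // T1 Ha' Hka //.
  by case: (induced _ _ _ _); case: (_ < _).
by case: eqP => // _; case: (a u); case: (has _ _).
Qed.

Lemma run_check s : env G s -> bestinv s -> (forall u, u < n -> ar s aCAND u <= 1) ->
  let s' := run pCheck s in
  [/\ bestinv s', count (bestp s) (iota 0 n) <= count (bestp s') (iota 0 n) &
   (forall x y, x < n -> y < n -> ar s aCAND x != 0 -> ar s aCAND y != 0 -> ~~ g x y) ->
   count (fun u => ar s aCAND u != 0) (iota 0 n) <= count (bestp s') (iota 0 n)].
Proof.
move=> Henv Hb Hle; cbv zeta; rewrite /pCheck !run_seq !run_set.
set C := fun u => ar s aCAND u != 0.
set s0 := setv _ xcnt _.
have E0 : env G s0 by apply: env_eq Henv.
have R0 : ar s0 = ar s by [].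
have F0 : vs s0 xflag = 0 /\ vs s0 xcnt = n by rewrite /s0 /= (proj1 Henv).
have B0 : vs s0 xbc = vs s xbc by [].
clearbody s0; set s1 := run _ s0.
pose I i s' := vs s' xcnt = n - count C (iota 0 i) /\
  (vs s' xflag == 0) = ~~ has (fun x => C x && has (fun y => C y && g x y) (iota 0 n)) (iota 0 i).
have : I n s1.
  rewrite -(proj1 E0); apply: (@for_frame I); rewrite /I; first by rewrite (proj1 F0) (proj2 F0) subn0.
  move=> x s2 Hx Hk Hka [I1 I2]; rewrite (proj1 E0) in Hx.
  rewrite -[x.+1]addn1 iotaD count_cat has_cat add0n [count C (iota x 1)]/= [has _ (iota x 1)]/= addn0 orbF.
  rewrite run_if run_nop run_seq run_set.
  have -> : (hev (setv s2 xx x) (HA aCAND #xx) == 0) = ~~ C x.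
    by rewrite /= Hka // R0 /C negbK.
  case Cx: (C x) => /=; last by rewrite addn0 orbF.
  set s3 := setv _ xcnt _.
  have E3 : env G s3 by apply: env_eq E0; rewrite /= ?Hk ?Hka.
  have C3 : ar s3 aCAND = ar s aCAND by rewrite /= Hka // R0.
  have X3 : vs s3 xx = x by [].
  have F3 : vs s3 xflag = vs s2 xflag by [].
  have N3 : vs s3 xcnt = n - (count C (iota 0 x) + 1) by rewrite /= I1; lia.
  clearbody s3; rewrite run_keepv //; split=> //.
  pose J i s' := (vs s' xflag == 0) = ~~ (has (fun x => C x && has (fun y => C y && g x y) (iota 0 n)) (iota 0 x) ||
     has (fun y => C y && g x y) (iota 0 i)).
  suff HJ : J n (run (SFor xy xn (SIf (emul (HA aCAND #xy) (HA aADJ (eidx #xx #xy))) (SSet xflag (HC 1)) SNop)) s3) by [].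
  rewrite -(proj1 E3); apply: (@for_frame J); rewrite /J; first by rewrite /= orbF F3.
  move=> y s4 Hy Hk4 Hka4 HJ; rewrite (proj1 E3) in Hy.
  rewrite -[y.+1]addn1 iotaD has_cat add0n [has _ (iota y 1)]/= orbF orbA.
  rewrite run_if run_nop run_set.
  have -> : (hev (setv s4 xy y) (emul (HA aCAND #xy) (HA aADJ (eidx #xx #xy))) == 0) = ~~ (C y && g x y).
    rewrite /= !Hka4 // !Hk4 // X3 (proj1 E3) (proj2 E3) // C3 /C.
    by rewrite muln_eq0 negb_and negbK /g; case: (nat_adj G x y).
  case: (C y && g x y) => /=; first by rewrite orbT.
  by rewrite HJ orbF.
case=> N1 F1.
have B1 : vs s1 xbc = vs s xbc by rewrite run_keepv.
have R1 b : ar s1 b = ar s b by rewrite run_keepa // R0.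
have E1 : env G s1 by apply: env_run E0.
clearbody s1; rewrite run_if run_nop run_seq run_set.
case: (Hb) => Hb1 Hb2 Hb3.
have Hcc : count (bestp s) (iota 0 n) <= n by rewrite -[X in _ <= X](size_iota 0 n) count_size.
have Hcn : count C (iota 0 n) <= n by rewrite -[X in _ <= X](size_iota 0 n) count_size.
have -> : (hev s1 (emul (eeq #xflag (HC 0)) (elt #xcnt #xbc)) == 0) =
   ~~ ((vs s1 xflag == 0) && (count (bestp s) (iota 0 n) < count C (iota 0 n))).
  rewrite /= N1 B1 Hb2.
  have -> : (n - count C (iota 0 n) < n - count (bestp s) (iota 0 n)) =
     (count (bestp s) (iota 0 n) < count C (iota 0 n)) by apply/idP/idP; lia.
  by case: (vs s1 xflag == 0); case: (count _ _ < _).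
have Hind : (vs s1 xflag == 0) -> forall x y, x < n -> y < n -> C x -> C y -> ~~ g x y.
  rewrite F1 => /hasPn Hn x y Hx Hy Cx Cy; apply/negP => Hg.
  have := Hn x; rewrite mem_iota Cx Hx => /(_ isT)/hasPn/(_ y).
  by rewrite mem_iota Hy Cy Hg => /(_ isT).
have Hind' : (forall x y, x < n -> y < n -> C x -> C y -> ~~ g x y) -> vs s1 xflag == 0.
  move=> H; rewrite F1; apply/hasPn => x; rewrite mem_iota => Hx.
  rewrite negb_and; case Cx: (C x) => //=; apply/hasPn => y; rewrite mem_iota => Hy.
  by rewrite negb_and; case Cy: (C y) => //=; apply: H.
case: (boolP (_ && _)) => [/andP[Hf Hlt]|Hnot] /=; last first.
  have Eb : bestp s1 = bestp s by rewrite /bestp R1.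
  split; rewrite ?Eb //; first by split; rewrite ?Eb ?B1 ?R1.
  by move=> /Hind' Hf; move: Hnot; rewrite Hf /= -leqNgt.
set s2 := setv s1 xbc _.
have E2 : env G s2 by apply: env_eq E1.
have HB u : u < n -> ar (run (SFor xu xn (SPut aBEST #xu (HA aCAND #xu))) s2) aBEST u = ar s aCAND u.
  rewrite -[X in _ < X](proj1 E2); move: u.
  apply: (@run_rows _ _ _ (fun u => ar s aCAND u)) => s' u Hu Hv' Ha' Hr Ex u'.
  by rewrite run_put /= Ex Ha' // /s2 /= R1.
have Ec : count (bestp (run (SFor xu xn (SPut aBEST #xu (HA aCAND #xu))) s2)) (iota 0 n) = count C (iota 0 n).
  apply: eq_in_count => u; rewrite mem_iota => Hu; rewrite /bestp HB //.
split; rewrite ?Ec //; last exact: ltnW.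
split.
- by move=> x y Hx Hy; rewrite /bestp !HB //; apply: Hind.
- by rewrite run_keepv // Ec /s2 /= N1.
- by move=> u Hu; rewrite HB // Hle.
Qed.
End Spec.

(** * The main program *)

Section Spec.
Variables (n : nat) (G : sgraph n).
Let g := nat_adj G.

Definition no_odd (a : pred nat) := forall v j, odd j -> ~~ walk n (induced g a) v j v.
Definition indep (I : pred nat) := forall x y, I x -> I y -> ~~ g x y.
Definition count_below (P : pred nat) := count P (iota 0 n).

(** An additive error of n/D, multiplied by D to remain in the natural numbers. *)
Definition approx D (a b : pred nat) := forall I, indep I ->
  D * count_below (fun u => I u && a u) <= D * count_below b + n.

(** Independence and monotonicity hold for every [a], bipartite or not: a failed trial thus
    preserves what a successful one achieved. *)
Lemma run_final s a D : 0 < D -> env G s -> alive n s a -> bestinv G s ->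
  vs s xN = n.+1 -> vs s xD = D ->
  let s' := run pFinal s in
  [/\ bestinv G s', count_below (bestp s) <= count_below (bestp s') & no_odd a -> approx D a (bestp s')].
Proof.
move=> HD Henv Ha Hb HN HDD; cbv zeta; rewrite /pFinal run_seq.
have Bst p s0 : keepa aBEST p -> keepv xbc p -> bestinv G s0 ->
    bestinv G (run p s0) /\ bestp (run p s0) = bestp s0.
  move=> Kp Kv [B1 B2 B3]; have E : bestp (run p s0) = bestp s0 by rewrite /bestp run_keepa.
  by split=> //; split; rewrite ?E ?run_keepv ?run_keepa.
have E1 : env G (run pColor s) by apply: env_run Henv.
have A1 : alive n (run pColor s) a by apply: alive_run Ha.
have [B1 EB1] := Bst pColor s isT isT Hb.
have D1 : vs (run pColor s) xD = D by rewrite run_keepv.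
have Hcol := run_color (a := a) _ Henv Ha HN.
move: (run pColor s) E1 A1 B1 EB1 D1 Hcol => s1 E1 A1 B1 EB1 D1 Hcol.
rewrite run_seq.
have [B2 EB2] := Bst pAuction s1 isT isT B1.
have E2 : env G (run pAuction s1) by apply: env_run E1.
have A2 : alive n (run pAuction s1) a by apply: alive_run A1.
have D2 : vs (run pAuction s1) xD = D by rewrite run_keepv.
have C2 : ar (run pAuction s1) aCOL = ar s1 aCOL by rewrite run_keepa.
have Hauc (H : no_odd a) := run_auction (Hcol H) E1 A1 (fun u => erefl) D1.
move: (run pAuction s1) B2 EB2 E2 A2 D2 C2 Hauc => s2 B2 EB2 E2 A2 D2 C2 Hauc.
pose col := ar s2 aCOL; pose lev := ar s2 aLEV.
pose J i s' := [/\ bestinv G s', count_below (bestp s2) <= count_below (bestp s') &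
  forall th, th < i ->
   (forall x y, x < n -> y < n -> candidate n g a col lev th x -> candidate n g a col lev th y -> ~~ g x y) ->
   count_below (candidate n g a col lev th) <= count_below (bestp s')].
have : J (vs s2 xD) (run (SFor xth xD (pCand ;; pCheck)) s2).
  apply: (@for_frame J); rewrite /J // => i s3 Hi Hk Hka [J1 J2 J3].
  rewrite run_seq; set s4 := setv s3 xth i.
  have E4 : env G s4 by apply: env_eq E2; rewrite /= ?Hk ?Hka.
  have A4 : alive n s4 a by apply: alive_eq A2; rewrite /= Hka.
  have B4 : bestinv G s4 by case: J1.
  have EB4 : bestp s4 = bestp s3 by [].
  have HC := run_cand E4 A4 (erefl : vs s4 xth = i).
  have [B5 EB5] := Bst pCand s4 isT isT B4.
  have E5 : env G (run pCand s4) by apply: env_run E4.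
  have EC u : u < n -> ar (run pCand s4) aCAND u = candidate n g a col lev i u.
    by move=> Hu; rewrite HC // /s4 /= !Hka.
  move: (run pCand s4) B5 EB5 E5 EC => s5 B5 EB5 E5 EC.
  have [|B6 L6 C6] := run_check E5 B5.
    by move=> u Hu; rewrite EC //; case: (candidate _ _ _ _ _ _ _).
  rewrite EB5 EB4 in L6.
  split=> //; first exact: leq_trans J2 L6.
  move=> th; rewrite ltnS leq_eqVlt => /orP[/eqP->|Hth] Hind; last first.
    exact: leq_trans (J3 th Hth Hind) L6.
  have -> : count_below (candidate n g a col lev i) = count (fun u => ar s5 aCAND u != 0) (iota 0 n).
    apply: eq_in_count => u; rewrite mem_iota add0n => Hu /=.
    by rewrite EC //; case: (candidate _ _ _ _ _ _ _).
  apply: C6 => x y Hx Hy; rewrite !EC // !b2n_ne0; exact: Hind.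
case=> J1 J2 J3; split=> //; first by rewrite -EB1 -EB2.
move=> Hno I HI; have [[_ _ Hcc [H1 H2 H3 H4 H5]] Hend] := Hauc Hno.
have Hcol2 : forall x y, induced g a x y ->
  ((col x == 0) && (col y == 1)) || ((col x == 1) && (col y == 0)).
  by rewrite /col C2; apply: Hcol.
have Ecol : ar s1 aCOL = col by rewrite /col C2.
rewrite Ecol in H1 Hend.
have [th Hth Hle] := konig (@nat_adj_sym _ G) (@nat_adj_lt _ G) Hcol2 HI H1 H2 H3 H4 Hend HD.
apply: leq_trans Hle _; rewrite leq_add2r leq_mul2l; apply/orP; right.
apply: J3; first by rewrite D2.
by move=> x y _ _; apply: (cand_ind (@nat_adj_sym _ G) (@nat_adj_lt _ G) Hcol2).
Qed.

Variables (k D L S H Q R : nat) (rnd : nat -> nat).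
Let dr i := rnd (Q - 1 - i).
Let ablk i := trial_set G k D L S H Q rnd (i * (S + 3 * k)).

Lemma run_main s : 0 < D -> penv G k D L S H rnd s -> vs s xQ = Q -> vs s xR = R ->
  (forall u, ar s aBEST u = 0) ->
  let s' := run pMain s in
  bestinv G s' /\ (forall i, i < R -> no_odd (ablk i) -> approx D (ablk i) (bestp s')).
Proof.
move=> HD HP HQ HR HB; cbv zeta; rewrite /pMain !run_seq !run_set.
set s0 := setv _ xptr _.
have E0 : penv G k D L S H rnd s0 by do 2!apply: penv_setv => //.
have P0 : vs s0 xptr = Q by rewrite /s0 /= HQ.
have B0 : bestinv G s0.
  split.
  - by move=> x y Hx Hy; rewrite /bestp /= HB.
  - have -> : count (bestp s0) (iota 0 n) = 0.
      by rewrite (eq_count (a2 := pred0)) ?count_pred0 // => u; rewrite /bestp /= HB.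
    by rewrite subn0 /s0 /= (proj1 (proj1 HP)).
  - by move=> u Hu; rewrite /= HB.
have R0 : vs s0 xR = R by [].
clearbody s0; rewrite -R0.
pose J i s' := [/\ penv G k D L S H rnd s', vs s' xptr = Q - i * (S + 3 * k), bestinv G s' &
   forall i', i' < i -> no_odd (ablk i') -> approx D (ablk i') (bestp s')].
suff : J (vs s0 xR) (run (SFor xtr xR pTrial) s0) by case.
apply: (@for_frame J); rewrite /J; first by rewrite mul0n subn0.
move=> i s1 Hi _ _ [J1 J2 J3 J4].
set s2 := setv s1 xtr i.
have E2 : penv G k D L S H rnd s2 by apply: penv_setv.
have P2 : vs s2 xptr = Q - i * (S + 3 * k) by [].
have B2 : bestinv G s2 by case: J3.
have EB2 : bestp s2 = bestp s1 by [].
clearbody s2; rewrite /pTrial run_seq [run (SFor _ _ _ ;; _) _]run_seq.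
have := run_prefix HD E2 P2; cbv zeta.
have : penv G k D L S H rnd (run (SFor xi xk pRound) (run pSample s2)).
  by do 2!apply: penv_run => //.
have : bestinv G (run (SFor xi xk pRound) (run pSample s2)) /\
    bestp (run (SFor xi xk pRound) (run pSample s2)) = bestp s1.
  have E : bestp (run (SFor xi xk pRound) (run pSample s2)) = bestp s1.
    by rewrite -EB2 /bestp !run_keepa.
  split=> //; case: B2 => H1 H2 H3; split; rewrite ?E -?EB2 // ?run_keepv //.
  by rewrite !run_keepa.
move: (run _ (run _ s2)) => s3 [B3 EB3] E3 [A3 P3].
have [Henv [[_ HDD _ _ _] [HN _ _ _]]] := E3.
have [F1 F2 F3] := run_final HD Henv A3 B3 HN HDD.
have E4 : penv G k D L S H rnd (run pFinal s3) by apply: penv_run.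
split=> //.
  by rewrite run_keepv // P3; congr subn; rewrite mulSn; lia.
move=> i'; rewrite ltnS leq_eqVlt => /orP[/eqP->|Hi'] Hno; first exact: F3.
move=> I HI; apply: leq_trans (J4 i' Hi' Hno I HI) _.
by rewrite leq_add2r leq_mul2l -EB3 F2 orbT.
Qed.
End Spec.

(** * Averages over independent draws *)

Section Draws.
Local Open Scope ring_scope.

Section Avg.
Variable B : nat.
Hypothesis B0 : (0 < B)%N.

(** Expectation over [m] independent uniform draws below [B], by a recursion that unrolls in step
    with [prob] at a [Rand]. *)
Fixpoint avg (m : nat) (f : seq nat -> rat) : rat :=
  if m is m'.+1 then (\sum_(x <- iota 0 B) avg m' (fun s => f (x :: s))) / B%:R
  else f [::].

Let Bp : 0 < B%:R :> rat. Proof. by rewrite ltr0n. Qed.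
Let Bn : B%:R != 0 :> rat. Proof. by rewrite gt_eqF. Qed.

Lemma avg_le m f1 f2 : (forall s, size s = m -> all (gtn B) s -> f1 s <= f2 s) ->
  avg m f1 <= avg m f2.
Proof.
elim: m f1 f2 => [|m IH] f1 f2 H /=; first exact: H.
apply: ler_wpM2r; first by rewrite invr_ge0 ltW.
rewrite big_seq [X in _ <= X]big_seq; apply: ler_sum => x.
rewrite mem_iota /= add0n => Hx; apply: IH => s Hs Ha.
by apply: H; rewrite /= ?Hs // Hx.
Qed.

Lemma avg_ext m f1 f2 : (forall s, size s = m -> all (gtn B) s -> f1 s = f2 s) ->
  avg m f1 = avg m f2.
Proof.
by move=> H; apply/eqP; rewrite eq_le !avg_le // => s Hs Ha; rewrite H.
Qed.

Lemma avg_cst m c : avg m (fun=> c) = c.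
Proof.
elim: m => [|m IH] //=; under eq_bigr do rewrite IH.
by rewrite big_const_seq count_predT size_iota iter_addr_0 -[c *+ _]mulr_natr mulfK.
Qed.

Lemma avgZ m c f : avg m (fun s => c * f s) = c * avg m f.
Proof.
elim: m f => [|m IH] f //=; under eq_bigr do rewrite IH.
by rewrite -mulr_sumr mulrA.
Qed.

Lemma avgB m f1 f2 : avg m (fun s => f1 s - f2 s) = avg m f1 - avg m f2.
Proof.
elim: m f1 f2 => [|m IH] f1 f2 //=; under eq_bigr do rewrite IH.
by rewrite sumrB mulrBl.
Qed.

Lemma avgD m f1 f2 : avg m (fun s => f1 s + f2 s) = avg m f1 + avg m f2.
Proof.
elim: m f1 f2 => [|m IH] f1 f2 //=; under eq_bigr do rewrite IH.
by rewrite big_split mulrDl.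
Qed.

Lemma avg_sum m (T : Type) (r : seq T) (f : T -> seq nat -> rat) :
  avg m (fun s => \sum_(v <- r) f v s) = \sum_(v <- r) avg m (f v).
Proof.
elim: m f => [|m IH] f //=; under eq_bigr do rewrite IH.
by rewrite exchange_big /= mulr_suml.
Qed.

Lemma avg_cat m1 m2 f :
  avg (m1 + m2) f = avg m1 (fun s1 => avg m2 (fun s2 => f (s1 ++ s2))).
Proof.
by elim: m1 f => [|m IH] f //=; under eq_bigr do rewrite IH.
Qed.

Definition pr m (P : pred (seq nat)) := avg m (fun s => (P s)%:R).

Lemma pr_le m (P Q : pred (seq nat)) :
  (forall s, size s = m -> all (gtn B) s -> P s -> Q s) -> pr m P <= pr m Q.
Proof.
move=> H; apply: avg_le => s Hs Ha; rewrite ler_nat.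
by case HP: (P s) => //; rewrite (H s Hs Ha HP).
Qed.

(** Lower bounds multiply because [p2] is valid for each first part that satisfies [P]; what counts
    as success later may depend on that part. *)
Lemma pr_chain m1 m2 (P : pred (seq nat)) (Q : pred (seq nat)) p1 p2 :
  p1 <= pr m1 P -> 0 <= p2 ->
  (forall s1, size s1 = m1 -> P s1 -> p2 <= pr m2 (fun s2 => Q (s1 ++ s2))) ->
  p1 * p2 <= pr (m1 + m2) Q.
Proof.
move=> H1 p20 H2; rewrite /pr avg_cat.
apply: (@le_trans _ _ (avg m1 (fun s1 => p2 * (P s1)%:R))).
  by rewrite avgZ mulrC ler_wpM2l.
apply: avg_le => s1 Hs _; case HP: (P s1); rewrite ?mulr1 ?mulr0; first exact: H2.
rewrite -(avg_cst m2 0); apply: avg_le => s _ _; exact: ler0n.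
Qed.

Lemma pr_all m (P : pred nat) :
  pr m (all P) = ((count P (iota 0 B))%:R / B%:R) ^+ m.
Proof.
elim: m => [|m IH]; first by rewrite expr0.
rewrite /pr [avg _ _]/= exprS -IH mulrAC; congr (_ / _).
rewrite -sum1_count natr_sum mulr_suml [RHS]big_mkcond /=.
apply: eq_bigr => x _; case: (P x) => /=; rewrite ?mul1r //.
exact: avg_cst.
Qed.

Lemma count_mod (m q : nat) (P : pred nat) : (0 < m)%N ->
  count (fun x => P (x %% m)%N) (iota 0 (q * m)) = (q * count P (iota 0 m))%N.
Proof.
move=> m0; elim: q => [|q IH] //; rewrite mulSn addnC iotaD count_cat IH mulSn addnC; congr addn.
rewrite add0n -{1}(addn0 (q * m)%N) iotaDl count_map; apply: eq_in_count => x.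
by rewrite mem_iota add0n /= => Hx; rewrite modnMDl modn_small.
Qed.

(** Each residue class is hit exactly B/m times. *)
Lemma avg1_mod (m : nat) (P : pred nat) : (0 < m)%N -> (m %| B)%N ->
  (count (fun x => P (x %% m)%N) (iota 0 B))%:R / B%:R = (count P (iota 0 m))%:R / m%:R :> rat.
Proof.
move=> m0 /dvdnP[q EB]; rewrite EB count_mod // !natrM.
have q0 : q%:R != 0 :> rat by rewrite pnatr_eq0 -lt0n; move: B0; rewrite EB; case: q {EB}.
have mn0 : m%:R != 0 :> rat by rewrite pnatr_eq0 -lt0n.
by rewrite -mulf_div divff // mul1r.
Qed.

Lemma pr1_mod (m c : nat) (P : pred nat) (Q : pred (seq nat)) : (0 < m)%N -> (m %| B)%N ->
  (c <= count P (iota 0 m))%N -> (forall x, P (x %% m)%N -> Q [:: x]) ->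
  c%:R / m%:R <= pr 1 Q.
Proof.
move=> m0 mB Hc HQ.
apply: (@le_trans _ _ (pr 1 (all (fun x => P (x %% m)%N)))).
  rewrite pr_all expr1 avg1_mod //; apply: ler_wpM2r; first by rewrite invr_ge0 ler0n.
  by rewrite ler_nat.
apply: pr_le => [[|x [|y s]]] //= _ _; rewrite andbT; exact: HQ.
Qed.

Section Amplify.
Variables (q : nat) (good : pred (seq nat)) (p : rat).
Hypotheses (p_le1 : p <= 1) (Hp : p <= pr q good).

Fixpoint hasgood (R : nat) (l : seq nat) : bool :=
  if R is R'.+1 then good (take q l) || hasgood R' (drop q l) else false.

(** Disjoint blocks of draws fail independently. *)
Lemma pr_hasgood R : 1 - (1 - p) ^+ R <= pr (R * q) (hasgood R).
Proof.
elim: R => [|R IH]; first by rewrite expr0 subrr.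
rewrite mulSn /pr avg_cat.
apply: (@le_trans _ _ (avg q (fun s1 => (good s1)%:R * (1 - p) ^+ R + (1 - (1 - p) ^+ R)))).
  have -> : avg q (fun s1 => (good s1)%:R * (1 - p) ^+ R + (1 - (1 - p) ^+ R)) =
     (1 - p) ^+ R * pr q good + (1 - (1 - p) ^+ R).
    rewrite avgD avg_cst /pr -avgZ; congr (_ + _).
    by apply: avg_ext => s _ _; rewrite mulrC.
  have Hpow : 0 <= (1 - p) ^+ R by rewrite exprn_ge0 // subr_ge0.
  have := ler_wpM2l Hpow Hp; rewrite exprS; lra.
apply: avg_le => s1 Hs _; case Hg: (good s1).
  rewrite mul1r addrC subrK -{1}(avg_cst (R * q) 1); apply: avg_le => s2 _ _ /=.
  by rewrite take_size_cat // Hg.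
rewrite mul0r add0r; apply: le_trans IH _; apply: avg_le => s2 _ _ /=.
by rewrite take_size_cat // drop_size_cat // Hg.
Qed.
End Amplify.

(** With x = 1/R, the product (1 - x)^R (1 + x)^R is at most 1, while (1 + x)^R >= 1 + R x = 2 by
    Bernoulli's inequality. *)
Lemma pow_half (R : nat) : (0 < R)%N -> (1 - R%:R^-1) ^+ R <= 1 / 2%:R :> rat.
Proof.
move=> R0; have Rp : 0 < R%:R :> rat by rewrite ltr0n.
set x : rat := R%:R^-1.
have x0 : 0 < x by rewrite invr_gt0.
have x1 : x <= 1 by rewrite invf_le1 // ler1n.
have Hb m : 1 + m%:R * x <= (1 + x) ^+ m.
  elim: m => [|m IH]; first by rewrite mul0r addr0 expr0.
  rewrite exprS -natr1; have m0 : 0 <= m%:R :> rat by rewrite ler0n.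
  have H1 : (1 + x) * (1 + m%:R * x) <= (1 + x) * (1 + x) ^+ m by apply: ler_wpM2l => //; lra.
  have H2 : 0 <= m%:R * x * x by rewrite !mulr_ge0 // ltW.
  by apply: le_trans H1; lra.
have H2 : 2%:R <= (1 + x) ^+ R.
  by apply: le_trans (Hb R); rewrite /x divff ?gt_eqF //; lra.
have H3 : (1 - x) ^+ R * (1 + x) ^+ R <= 1.
  rewrite -exprMn; apply: exprn_ile1; nra.
have H4 : 0 <= (1 - x) ^+ R by apply: exprn_ge0; lra.
nra.
Qed.
End Avg.

(** A rational substitute for the exponential bound; with x = 1/E the induction step is (1 - x)(1 +
    (S + 1) x) <= 1 + S x. *)
Lemma bernoulli_inv (E S : nat) : (0 < E)%N ->
  (1 - E%:R^-1) ^+ S * (1 + S%:R / E%:R) <= 1 :> rat.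
Proof.
move=> E0; have Ep : 0 < E%:R :> rat by rewrite ltr0n.
set x : rat := E%:R^-1.
have x0 : 0 < x by rewrite invr_gt0.
have x1 : x <= 1 by rewrite invf_le1 // ler1n.
elim: S => [|S IH]; first by rewrite expr0 mul0r addr0 mul1r.
rewrite exprS -natr1; apply: le_trans IH.
rewrite [X in X <= _](_ : _ = (1 - x) ^+ S * ((1 - x) * (1 + (S%:R + 1) * x))); last by ring.
apply: ler_wpM2l; first by apply: exprn_ge0; lra.
have S0 : 0 <= S%:R :> rat by rewrite ler0n.
have : 0 <= S%:R * (x * x) by rewrite !mulr_ge0 // ltW.
have : 0 <= x * x by rewrite mulr_ge0 // ltW.
lra.
Qed.

End Draws.

(** * Success probability of a trial *)

Section Round.
Variables (n : nat) (G : sgraph n) (D L E : nat) (I : pred nat).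
Let g := nat_adj G.
Local Notation cnt := (count_below n).
Local Notation h := (n %/ E).
Local Notation H := (2 * h).+1.
Hypotheses (D0 : 0 < D) (HL : L = 10 * D) (HE : E = L * D).

Definition heavy : pred nat := fun v => n < E * cnt (fun u => g v u && I u).

(** [loss] bounds D times the number of vertices of [I] given up so far, which keeps the budget
    integral. *)
Definition round_inv (c loss : nat) (a : pred nat) : Prop :=
  [/\ iocp_le G a c, cnt (fun u => heavy u && a u) <= h &
      D * cnt I <= D * cnt (fun u => I u && a u) + loss].

Lemma cnt_mono (P Q : pred nat) : (forall x, P x -> Q x) -> cnt P <= cnt Q.
Proof. by move=> HPQ; apply: sub_count. Qed.

Lemma cnt_lt (P Q : pred nat) x : (forall y, P y -> Q y) -> x < n -> Q x -> ~~ P x ->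
  cnt P < cnt Q.
Proof.
move=> HPQ Hx Qx Px; have : x \in iota 0 n by rewrite mem_iota.
rewrite /count_below; elim: (iota 0 n) => //= y s IH.
have Hle : count P s <= count Q s by apply: sub_count.
rewrite inE => /orP[/eqP <-|/IH]; first by rewrite Qx (negPf Px); lia.
by case Py: (P y); rewrite ?(HPQ _ Py); lia.
Qed.

Lemma cnt_removed (P a R : pred nat) :
  cnt (fun u => P u && a u) <= cnt (fun u => P u && removed a R u) + cnt (fun u => P u && R u).
Proof.
rewrite /count_below -count_predUI; apply: leq_trans (leq_addr _ _).
by apply: sub_count => u /= /andP[-> au]; rewrite /removed au /=; case: (R u).
Qed.

Lemma cnt_cover3 (P Q R1 R2 : pred nat) : (forall u, P u -> [|| Q u, R1 u | R2 u]) ->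
  cnt P <= cnt Q + cnt R1 + cnt R2.
Proof.
move=> HP; rewrite /count_below; elim: (iota 0 n) => //= u s IH.
by have := HP u; case: (P u) => [/(_ isT)/or3P[]->|_]; lia.
Qed.

Lemma cnt_oncyc e p : cnt (fun u => I u && oncyc n e p u) <= p.1.
Proof.
rewrite -[X in _ <= X](size_iota 0) -(size_map (cyc n e p.2 p.1)) /count_below -size_filter.
apply: uniq_leq_size; first by rewrite filter_uniq ?iota_uniq.
move=> u; rewrite mem_filter => /andP[/andP[_ /hasP[q Hq /eqP <-]] _].
exact: map_f.
Qed.

Let hE : h * E <= n := leq_divM n E.
Let E0 : 0 < E. Proof. by rewrite HE HL; lia. Qed.
Let L0 : 0 < L. Proof. by rewrite HL; lia. Qed.

Lemma min_walk r a : (shortest_odd n (induced g a) r).1 < r -> forall u j, odd j ->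
  walk n (induced g a) u j u -> (shortest_odd n (induced g a) r).1 <= j.
Proof.
move=> Hr u j Ho Hw; case: (ltnP j r) => Hj; last by apply: ltnW; apply: leq_trans Hj.
apply: (shortest_odd_min (v := u)) => //.
by apply: (walk_lt (@induced_sym _ G a) (@induced_lt _ G a) _ Hw); case: j Ho {Hw Hj}.
Qed.

Lemma rmcyc_sub a x : rmcyc G L a x -> a x.
Proof. by rewrite /rmcyc; case: ifP => // _ /andP[]. Qed.

Lemma iter_rmcyc_sub j a x : iter j (rmcyc G L) a x -> a x.
Proof. by elim: j => //= j IH /rmcyc_sub. Qed.

Lemma rmcyc_loss a :
  cnt (fun u => I u && a u) <= cnt (fun u => I u && rmcyc G L a u) + L.
Proof.
rewrite /rmcyc; set p := shortest_odd _ _ _; case: ltnP => Hp; last exact: leq_addr.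
apply: leq_trans (cnt_removed I a (oncyc n (induced g a) p)) _; rewrite leq_add2l.
by apply: leq_trans (cnt_oncyc _ _) _; apply: ltnW.
Qed.

Lemma iter_loss j a :
  cnt (fun u => I u && a u) <= cnt (fun u => I u && iter j (rmcyc G L) a u) + j * L.
Proof.
elim: j => [|j IH]; first exact: leq_addr.
apply: leq_trans IH _; have := rmcyc_loss (iter j (rmcyc G L) a).
by rewrite mulSn iterS; lia.
Qed.

Definition bad (a : pred nat) : bool :=
  let p := shortest_odd n (induced g a) L in
  (p.1 < L) && has (fun q => heavy (cyc n (induced g a) p.2 p.1 q)) (iota 0 p.1).

Lemma bad_heavy a : bad a ->
  cnt (fun u => heavy u && rmcyc G L a u) < cnt (fun u => heavy u && a u).
Proof.
rewrite /bad /rmcyc; set p := shortest_odd _ _ _ => /andP[Hp /hasP[q]]; rewrite mem_iota add0n Hp => Hq Hh.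
have [Ho Hw] := shortest_odd_found Hp.
set x := cyc _ _ _ _ q in Hh.
have ax : a x := c_a Hw Ho (ltnW Hq).
have xn : x < n := c_lt Hw Ho (ltnW Hq).
apply: (@cnt_lt _ _ x _ xn); first by move=> y /andP[-> /andP[-> _]].
  by rewrite Hh.
rewrite Hh /removed ax /= negbK; apply/hasP; exists q; by rewrite ?mem_iota /=.
Qed.

(** Deleting a bad cycle removes a heavy vertex for good. As at most h of them are alive, at most h
    values of j lead to a bad cycle, out of 2h + 1. *)
Lemma bad_count m a :
  count (fun j => bad (iter j (rmcyc G L) a)) (iota 0 m) +
    cnt (fun u => heavy u && iter m (rmcyc G L) a u) <= cnt (fun u => heavy u && a u).
Proof.
elim: m => [|m IH] //; apply: leq_trans IH.
rewrite -[m.+1]addn1 iotaD count_cat -addnA leq_add2l add0n /= addn0 addn1 iterS.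
case Hb: (bad _) => /=; first exact: bad_heavy.
by rewrite add0n; apply: cnt_mono => x /andP[-> /rmcyc_sub].
Qed.

Lemma light_nbr x : E * cnt (fun u => I u && g x u) <= n \/ heavy x.
Proof.
rewrite /heavy; case: ltnP; [by right|left].
rewrite (_ : cnt (fun u => I u && g x u) = cnt (fun u => g x u && I u)) //.
by apply: eq_count => u; apply: andbC.
Qed.

Lemma cnt_has_le (T : pred nat) (F : nat -> pred nat) s :
  cnt (fun u => T u && has (fun q => F q u) s) <= \sum_(q <- s) cnt (fun u => T u && F q u).
Proof.
elim: s => [|q s IH] /=.
  by rewrite big_nil leqn0 /count_below (@eq_count _ _ pred0) ?count_pred0 // => u; rewrite andbF.
rewrite big_cons; apply: leq_trans (leq_add (leqnn _) IH).
rewrite /count_below -count_predUI; apply: leq_trans (leq_addr _ _).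
by apply: sub_count => u /= /andP[-> /=].
Qed.

(** A shortest odd closed walk visits distinct vertices, so its length is at most n and a search
    below n + 1 misses nothing. *)
Lemma no_odd_of_shortest_odd a : (shortest_odd n (induced g a) n.+1).1 = n.+1 -> no_odd G a.
Proof.
move=> HN v j Ho; apply/negP => Hw.
pose P l := odd l && has (fun u => walk n (induced g a) u l u) (iota 0 n).
have odd_walk_lt u l : odd l -> walk n (induced g a) u l u -> u < n.
  by move=> Hl Hu; apply: (walk_lt (@induced_sym _ G a) (@induced_lt _ G a) _ Hu); case: l Hl {Hu}.
have Hex : exists l, P l.
  by exists j; rewrite /P Ho; apply/hasP; exists v; rewrite // mem_iota add0n (odd_walk_lt v j).
case: (ex_minnP Hex) => m /andP[Hm /hasP[u _ Hu]] Hmin.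
have Hmin' x l : odd l -> walk n (induced g a) x l x -> m <= l.
  move=> Hl Hx; apply: Hmin; rewrite /P Hl; apply/hasP; exists x => //.
  by rewrite mem_iota add0n (odd_walk_lt x l).
have : m <= n.
  rewrite -[X in X <= _](size_iota 0 m) -[X in _ <= X](size_iota 0 n).
  rewrite -(size_map (cyc n (induced g a) u m)).
  apply: uniq_leq_size.
    rewrite map_inj_in_uniq ?iota_uniq // => p q; rewrite !mem_iota !add0n /= => Hp Hq Epq.
    have inj := cyc_inj (@induced_sym _ G a) (@induced_lt _ G a) Hu Hm Hmin'.
    case: (ltngtP p q) => // Hpq.
      by have := inj p q; rewrite Hpq Hq Epq eqxx => /(_ isT).
    by have := inj q p; rewrite Hpq Hp Epq eqxx => /(_ isT).
  move=> x /mapP[q]; rewrite !mem_iota !add0n /= => Hq ->.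
  exact: (c_lt Hu Hm (ltnW Hq)).
move=> Hmn; have := shortest_odd_min (odd_walk_lt u m Hm Hu) (r := n.+1) Hmn Hm Hu.
by rewrite HN; lia.
Qed.

Lemma iocp_no_odd a : no_odd G a -> iocp_le G a 0.
Proof.
move=> Hno P HP Ha; rewrite leqn0 cards_eq0; apply/eqP/setP => A; rewrite inE.
apply/negP => HA; have /and3P[/forallP Hf _ _] := HP.
have := Hf A; rewrite HA /= => Hioc.
have [x Hx] : exists x, x \in A.
  by apply/card_gt0P; case/and3P: Hioc; case: #|A|.
have [j Ho Hw] := ioc_wk Hioc (Ha A HA) Hx.
by have := Hno (val x) j Ho; rewrite Hw.
Qed.

Lemma iocp_le_leq a c c' : c <= c' -> iocp_le G a c -> iocp_le G a c'.
Proof. by move=> Hc H P HP HA; apply: leq_trans (H P HP HA) Hc. Qed.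

Lemma finish_sub a d b x : finish G D L a d b x -> a x.
Proof.
rewrite /finish; case: ifP => _; first by case/andP.
by case: ifP => // _ /and3P[].
Qed.

(** One suitable pair is enough, since the program guesses it with probability 1/D^2. *)
Lemma finish_ok c a : iocp_le G a c -> ~~ bad a -> exists2 d, d < D & exists2 b, b < D &
  iocp_le G (finish G D L a d b) c.-1 /\
  D * cnt (fun u => I u && a u) <= D * cnt (fun u => I u && finish G D L a d b u) + 2 * n.
Proof.
move=> Hc; rewrite /bad /finish; set p := shortest_odd _ _ _.
case: ltnP => /= Hp; last first.
  set p' := shortest_odd _ _ n.+1; move=> _.
  case: ltnP => Hp' /=; last first.
    exists 0 => //; exists 0 => //; split; last exact: leq_addr.
    apply: (iocp_le_leq (leq0n _)); apply/iocp_no_odd/no_odd_of_shortest_odd.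
    by apply/eqP; rewrite eqn_leq Hp' shortest_odd_le.
  have [Ho Hw] := shortest_odd_found Hp'.
  have Hmin := min_walk Hp'; rewrite -/p' in Hmin Ho Hw.
  have HLp : L <= p'.1.
    rewrite leqNgt; apply/negP => Hlt.
    have Hv : p'.2 < n by apply: (walk_lt (@induced_sym _ G a) (@induced_lt _ G a) _ Hw); case: (p'.1) Ho.
    have := shortest_odd_min Hv Hlt Ho Hw; rewrite -/p; lia.
  pose Ia u := I u && a u.
  have [d Hd Ld] := exists_light_layer n (induced g a) (oncyc n (induced g a) p') Ia 0 D0.
  have [b Hb Lb] := exists_light_layer n (induced g a) (pred1 p'.2) Ia (3 * D) D0.
  exists d => //; exists b => //; split.
    have HL10 : 10 * D <= L by rewrite HL.
    exact: (proj2 (iocp_long Hw Ho Hmin HL10 HLp Hd Hb (fun u => id) Hc)).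
  rewrite add0n in Ld.
  have : cnt Ia <= cnt (fun u => I u && rmlay G D a p' d b u) +
     cnt (fun u => Ia u && layer n (induced g a) (oncyc n (induced g a) p') d u) +
     cnt (fun u => Ia u && layer n (induced g a) (pred1 p'.2) (3 * D + b) u).
    apply: cnt_cover3 => u; rewrite /Ia /rmlay => /andP[-> ->] /=.
    by case: (layer _ _ _ _ u); case: (layer _ _ _ _ u).
  move: Ld Lb; rewrite -/Ia /count_below.
  move: (count _ _) (count _ _) (count _ _) (count _ _) => x y z w Hy Hz Hx.
  by have := leq_mul (leqnn D) Hx; rewrite !mulnDr; lia.
move=> /hasPn Hn; exists 0 => //; exists 0 => //.
have [Ho Hw] := shortest_odd_found Hp.
have Hmin := min_walk Hp; rewrite -/p in Hmin Ho Hw.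
split.
  apply: (proj2 (iocp_short Hw Ho Hmin _ _ Hc)); first by move=> x /andP[].
  move=> q u Hq /andP[_ /hasPn/(_ q)]; rewrite mem_iota; exact.
apply: (@leq_trans (D * cnt (fun u => I u && rmnbr G a p u) + n)); last by rewrite leq_add2l; lia.
have Hs : D * cnt (fun u => I u && has (fun q => g (cyc n (induced g a) p.2 p.1 q) u) (iota 0 p.1)) <= n.
  set X := cnt _; have HX : X <= \sum_(q <- iota 0 p.1) cnt (fun u => I u && g (cyc n (induced g a) p.2 p.1 q) u).
    exact: cnt_has_le.
  have HS : E * \sum_(q <- iota 0 p.1) cnt (fun u => I u && g (cyc n (induced g a) p.2 p.1 q) u) <= p.1 * n.
    rewrite big_distrr /= -[X in _ <= X * n](size_iota 0) -sum1_size big_distrl /=.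
    rewrite big_seq [X in _ <= X]big_seq; apply: leq_sum => q Hq; rewrite mul1n.
    by case: (light_nbr (cyc n (induced g a) p.2 p.1 q)) => // Hh; have := Hn q Hq; rewrite Hh.
  (* Fewer than L cycle vertices, each with at most n/E neighbours in [I], where E = L D. *)
  have : L * (D * X) <= L * n.
    rewrite mulnA -HE; apply: leq_trans (leq_mul (leqnn E) HX) _.
    by apply: leq_trans HS _; rewrite leq_mul2r ltnW ?orbT.
  by rewrite leq_pmul2l.
have Hc2 := cnt_removed I a (fun u => has (fun q => g (cyc n (induced g a) p.2 p.1 q) u) (iota 0 p.1)).
apply: leq_trans (leq_mul (leqnn D) Hc2) _; rewrite mulnDr; exact: leq_add.
Qed.

Lemma h2_le_n : 2 * h <= n.
Proof. have : 2 * h <= E * h by rewrite leq_mul2r HE HL; apply/orP; right; nia. by rewrite (mulnC E); lia. Qed.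

(** The 4n consists of D j L <= 2 h E <= 2n for the deleted cycles and 2n for the finish. *)
Lemma round_ok c loss a : round_inv c loss a ->
  exists2 J : pred nat, h.+1 <= count J (iota 0 H) &
  forall j, j < H -> J j -> exists2 d, d < D & exists2 b, b < D &
    round_inv c.-1 (loss + 4 * n) (round_set G D L a j d b).
Proof.
move=> [R1 R2 R3]; exists (fun j => ~~ bad (iter j (rmcyc G L) a)).
  have Hb := bad_count H a.
  have := count_predC (fun j => bad (iter j (rmcyc G L) a)) (iota 0 H).
  rewrite size_iota; set x := count _ _; set y := count _ _ => Hxy.
  have Hx : x <= h := leq_trans (leq_trans (leq_addr _ _) Hb) R2.
  change (h.+1 <= y); lia.
move=> j Hj Hb.
have Hc : iocp_le G (iter j (rmcyc G L) a) c.
  by apply: iocp_le_sub R1 => x; apply: iter_rmcyc_sub.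
have [d Hd [b Hb' [F1 F2]]] := finish_ok Hc Hb.
exists d => //; exists b => //; rewrite /round_set.
have -> : minn n j = j by have := h2_le_n; lia.
split=> //.
  apply: leq_trans R2; apply: cnt_mono => x /andP[-> /finish_sub].
  exact: iter_rmcyc_sub.
apply: leq_trans R3 _; have := leq_mul (leqnn D) (iter_loss j a); rewrite mulnDr => H1.
have H2 : D * (j * L) <= 2 * n.
  have : D * (j * L) <= D * (2 * h * L) by rewrite !leq_mul2l leq_mul2r; lia.
  have -> : D * (2 * h * L) = 2 * (h * E) by rewrite HE; lia.
  move: hE; lia.
lia.
Qed.
End Round.

Section Trial.
Variables (n : nat) (G : sgraph n) (D L E S t k B : nat) (I : pred nat).
Let g := nat_adj G.
Local Notation cnt := (count_below n).
Local Notation h := (n %/ E).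
Local Notation H := (2 * h).+1.
Hypotheses (n0 : 0 < n) (t0 : 0 < t) (D0 : 0 < D) (HL : L = 10 * D) (HE : E = L * D).
Hypotheses (HS : S = 2 * E ^ 2) (HB : B = n * H * D).
Hypotheses (I_ind : indep G I) (I_big : n <= t * cnt I).

(** Boolean form of [iocp_le], as events under [pr] are boolean. *)
Definition iocp_leb (a : pred nat) c := [forall P : {set {set 'I_n}},
  induced_odd_cycle_packing G P ==> [forall A in P, forall x in A, a (val x)] ==> (#|P| <= c)].

Lemma iocp_leP a c : reflect (iocp_le G a c) (iocp_leb a c).
Proof.
apply: (iffP forallP) => H P.
  move=> HP Ha; have := H P; rewrite HP /= => /implyP; apply.
  by apply/forallP => A; apply/implyP => HA; apply/forallP => x; apply/implyP => Hx; apply: Ha HA x Hx.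
apply/implyP => HP; apply/implyP => Ha; apply: H => // A HA x Hx.
by have /forallP/(_ A)/implyP/(_ HA)/forallP/(_ x)/implyP/(_ Hx) := Ha.
Qed.

Definition round_invb c loss (a : pred nat) := [&& iocp_leb a c,
  cnt (fun u => heavy G E I u && a u) <= h & D * cnt I <= D * cnt (fun u => I u && a u) + loss].

Lemma round_invP c loss a : reflect (round_inv G D E I c loss a) (round_invb c loss a).
Proof. by apply: (iffP and3P) => -[/iocp_leP]. Qed.

Let B0 : 0 < B. Proof. by rewrite HB !muln_gt0 n0 D0. Qed.
Let nB : n %| B. Proof. by rewrite HB -mulnA dvdn_mulr. Qed.
Let HdB : H %| B. Proof. by rewrite HB mulnAC dvdn_mull. Qed.
Let DB : D %| B. Proof. by rewrite HB dvdn_mull. Qed.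
Let E0 : 0 < E. Proof. by rewrite HE HL; lia. Qed.

Fixpoint roundsl kk (a : pred nat) (l : seq nat) : pred nat :=
  match kk, l with
  | kk'.+1, [:: x, y, z & l'] => roundsl kk' (round_set G D L a (x %% H) (y %% D) (z %% D)) l'
  | _, _ => a
  end.

Local Notation Pr := (pr B).
Local Open Scope ring_scope.

Let p30 : 0 <= 1 / 2%:R * (1 / D%:R * (1 / D%:R)) :> rat.
Proof. by rewrite !(mulr_ge0, invr_ge0, ler0n, ler01). Qed.

(** The factors are (h + 1)/(2h + 1) >= 1/2 for [j] and 1/D each for [d] and [b], whose good values
    are fixed by [a] and [j]. *)
Lemma round_prob c loss a : round_inv G D E I c loss a ->
  1 / 2%:R * (1 / D%:R * (1 / D%:R)) <= Pr 3 (fun l =>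
    round_invb c.-1 (loss + 4 * n) (round_set G D L a (nth 0 l 0 %% H) (nth 0 l 1 %% D) (nth 0 l 2 %% D))%N).
Proof.
move=> Ha; have [J HJ HdJ] := round_ok D0 HL HE Ha.
have D10 : 0 <= 1 / D%:R :> rat by rewrite divr_ge0.
apply: (@pr_chain B B0 1 2 (fun l => J (nth 0%N l 0 %% H)%N)).
- apply: (@le_trans _ _ (h.+1%:R / H%:R)); last first.
    by apply: (@pr1_mod B B0 H h.+1 J) => // x.
  rewrite ler_pdivlMr ?ltr0n // mulrAC ler_pdivrMr ?ltr0n // mul1r -natrM ler_nat; lia.
- by rewrite mulr_ge0.
move=> [|x [|]] //= _ Jx.
have [d Hd [b Hb HR]] := HdJ _ (ltn_pmod x (ltn0Sn _)) Jx.
apply: (@pr_chain B B0 1 1 (fun l => (nth 0%N l 0 %% D == d)%N)) => //.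
  apply: (@pr1_mod B B0 D 1 (pred1 d)) => //.
  by rewrite (count_uniq_mem d (iota_uniq 0 D)) mem_iota add0n Hd.
move=> [|y [|]] //= _ /eqP Ey.
apply: (@pr1_mod B B0 D 1 (pred1 b)) => //.
  by rewrite (count_uniq_mem b (iota_uniq 0 D)) mem_iota add0n Hb.
by move=> z /eqP /= ->; rewrite Ey; apply/round_invP.
Qed.

Lemma rounds_prob kk c loss a : round_inv G D E I c loss a ->
  (1 / 2%:R * (1 / D%:R * (1 / D%:R))) ^+ kk <= Pr (3 * kk) (fun l =>
    round_invb (c - kk) (loss + kk * (4 * n)) (roundsl kk a l))%N.
Proof.
elim: kk c loss a => [|kk IH] c loss a Ha.
  by rewrite expr0 muln0 /pr /= subn0 addn0; have /round_invP-> := Ha.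
rewrite exprS mulnS; apply: pr_chain (round_prob Ha) _ _ => //.
  by apply/exprn_ge0/p30.
move=> [|x [|y [|z [|]]]] //= _ /round_invP Hr.
have := IH _ _ _ Hr; rewrite (_ : (c.-1 - kk = c - kk.+1)%N); last by lia.
by rewrite (_ : (loss + 4 * n + kk * (4 * n) = loss + kk.+1 * (4 * n))%N) //; lia.
Qed.

Definition sampleseq (l : seq nat) : pred nat :=
  foldl (fun a x => removed a (g (x %% n)%N)) xpredT l.

Lemma sampleseqE l v : sampleseq l v = all (fun x => ~~ g (x %% n)%N v) l.
Proof.
rewrite /sampleseq -[RHS]andTb -[true in RHS]/(xpredT v).
elim: l (xpredT : pred nat) => [|x l IH] a /=; first by rewrite andbT.
by rewrite IH /removed andbA.
Qed.

(** With q = |I|/n >= 1/t, the whole sample lies in [I] with probability q^S, and then [I] survives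
    because it is independent. The surplus of surviving heavy vertices is shown to take away at most
    half of this probability. *)
Lemma sample_prob : (1 / 2%:R) * (1 / t%:R) ^+ S <= Pr S (fun l =>
  round_invb k 0 (sampleseq l) || ~~ iocp_leb xpredT k).
Proof.
case Hk: (iocp_leb xpredT k); last first.
  apply: (@le_trans _ _ 1).
    have H1 : (1 / t%:R) ^+ S <= 1 :> rat.
      apply: exprn_ile1; first by rewrite divr_ge0 ?ler0n.
      by rewrite ler_pdivrMr ?ltr0n // mul1r ler1n.
    lra.
  rewrite -{1}(avg_cst B0 S 1); apply: avg_le => // s _ _.
  by rewrite orbT.
set q : rat := (cnt I)%:R / n%:R.
pose A := fun l => all (fun x => I (x %% n)%N) l.
pose hv := fun l => cnt (fun u => heavy G E I u && sampleseq l u).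
have np : 0 < n%:R :> rat by rewrite ltr0n.
have Ep : 0 < E%:R :> rat by rewrite ltr0n.
have q0 : 0 <= q by rewrite divr_ge0 ?ler0n.
have qt : 1 / t%:R <= q.
  rewrite /q ler_pdivlMr // mulrAC mul1r ler_pdivrMr ?ltr0n // -natrM ler_nat mulnC.
  exact: I_big.
have prA : Pr S A = q ^+ S by rewrite pr_all // (avg1_mod B0 I n0 nB).
have good l : A l -> (hv l <= h)%N -> round_invb k 0 (sampleseq l).
  move=> HA Hh; apply/and3P; split=> //.
    by apply/iocp_leP; apply: iocp_le_sub (elimT (iocp_leP _ _) Hk).
  rewrite addn0 leq_mul2l; apply/orP; right; apply: sub_count => u Iu.
  rewrite Iu sampleseqE; apply/allP => x /(allP HA) Ix; exact: I_ind.
have lower : q ^+ S - Pr S (fun l => A l && (h < hv l)%N) <= Pr S (fun l => round_invb k 0 (sampleseq l) || ~~ true).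
  rewrite -prA -avgB; apply: avg_le => // l _ _; rewrite orbF.
  case HA: (A l); case Hh: (h < hv l)%N; rewrite ?subrr ?subr0 ?ler0n //=.
  by rewrite (good l HA) // leqNgt Hh.
(* Markov's inequality on the part where the sample lies in [I], which avoids conditional
   probabilities. *)
have markov : h.+1%:R * Pr S (fun l => A l && (h < hv l)%N) <=
    \sum_(v <- iota 0 n) Pr S (fun l => [&& A l, heavy G E I v & sampleseq l v]).
  rewrite /pr -avgZ -avg_sum; apply: avg_le => // l _ _.
  case HA: (A l) => /=; last by rewrite mulr0; apply: sumr_ge0 => v _; rewrite ler0n.
  rewrite -natr_sum -natrM ler_nat.
  have -> : (\sum_(v <- iota 0 n) (heavy G E I v && sampleseq l v) = hv l)%N.
    by rewrite /hv /count_below -sum1_count [RHS]big_mkcond; apply: eq_bigr => v _; case: (_ && _).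
  by case: ltnP => Hh; rewrite ?muln1 ?muln0.
(* A heavy vertex has more than n/E >= |I|/E neighbours in [I], so a single draw lands in [I] and
   misses them with probability at most q (1 - 1/E). *)
have each v : (v < n)%N -> Pr S (fun l => [&& A l, heavy G E I v & sampleseq l v]) <=
    q ^+ S * (1 - E%:R^-1) ^+ S.
  move=> Hv; case Hh: (heavy G E I v); last first.
    have -> : Pr S (fun l => [&& A l, false & sampleseq l v]) = 0.
      by rewrite -(avg_cst B0 S 0); apply: avg_ext => // l _ _; rewrite andbF.
    apply: mulr_ge0; apply: exprn_ge0 => //.
    by rewrite subr_ge0 invf_le1 // ler1n.
  have -> : Pr S (fun l => [&& A l, true & sampleseq l v]) =
     Pr S (all (fun x => (fun y => I y && ~~ g y v) (x %% n)%N)).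
    apply: avg_ext => // l _ _; congr (nat_of_bool _)%:R.
    by rewrite /= sampleseqE -all_predI; apply: eq_all => x.
  rewrite pr_all // (avg1_mod B0 (fun y => I y && ~~ g y v) n0 nB) -exprMn; apply: lerXn2r.
  - by rewrite nnegrE divr_ge0 ?ler0n.
  - rewrite nnegrE mulr_ge0 // subr_ge0 invf_le1 // ler1n //.
  have Hc : (count (fun y => I y && ~~ g y v) (iota 0 n) + cnt (fun u => g v u && I u) = cnt I)%N.
    rewrite /count_below [RHS](count_split (g v) I) addnC; congr addn; apply: eq_count => y.
    by rewrite andbC /g nat_adj_sym.
  have Hc' : (cnt I < E * cnt (fun u => g v u && I u))%N.
    by apply: leq_ltn_trans Hh; rewrite -[X in (_ <= X)%N](size_iota 0 n) count_size.
  rewrite /q mulrAC; apply: ler_wpM2r; first by rewrite invr_ge0 ltW.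
  have Hc2 : (count (fun y => I y && ~~ g y v) (iota 0 n))%:R =
      (cnt I)%:R - (cnt (fun u => g v u && I u))%:R :> rat.
    by rewrite -Hc natrD addrK.
  rewrite Hc2 mulrBr mulr1 lerD2l lerN2 ler_pdivrMr // -natrM ler_nat mulnC.
  exact: ltnW.
have sum_le : \sum_(v <- iota 0 n) Pr S (fun l => [&& A l, heavy G E I v & sampleseq l v]) <=
   n%:R * (q ^+ S * (1 - E%:R^-1) ^+ S).
  apply: (@le_trans _ _ (\sum_(v <- iota 0 n) q ^+ S * (1 - E%:R^-1) ^+ S)).
    rewrite big_seq [X in _ <= X]big_seq; apply: ler_sum => v.
    by rewrite mem_iota add0n => /andP[_ Hv]; apply: each.
  by rewrite big_const_seq count_predT size_iota iter_addr_0 -[X in X <= _]mulr_natl.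
have qS0 : 0 <= q ^+ S by apply: exprn_ge0.
have hn : n%:R <= h.+1%:R * E%:R :> rat.
  by rewrite -natrM ler_nat ltnW // ltn_ceil.
set b := Pr S (fun l => A l && _) in lower markov *.
set x : rat := (1 - E%:R^-1) ^+ S in sum_le.
have x0 : 0 <= x by apply: exprn_ge0; rewrite subr_ge0 invf_le1 // ler1n.
(* The choice S = 2E^2 makes S/E = 2E, so that E x <= 1/2 below. *)
have Hx : x * (1 + 2%:R * E%:R) <= 1.
  have := bernoulli_inv S E0; rewrite -/x HS natrM natrX expr2 mulrA mulfK; first exact.
  by rewrite gt_eqF.
have hp : 0 < h.+1%:R :> rat by rewrite ltr0n.
have Hb : b <= E%:R * (q ^+ S * x).
  rewrite -(ler_pM2l hp); apply: le_trans markov (le_trans sum_le _).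
  by rewrite [X in _ <= X]mulrA; apply: ler_wpM2r => //; apply: mulr_ge0.
have HEx : E%:R * x <= 1 / 2%:R by lra.
have Hb2 : b <= q ^+ S * (1 / 2%:R).
  by apply: le_trans Hb _; rewrite mulrCA ler_wpM2l.
have Hpow : (1 / t%:R) ^+ S <= q ^+ S.
  by apply: lerXn2r => //; rewrite nnegrE divr_ge0 ?ler0n.
move: lower; lra.
Qed.

Definition goodb (l : seq nat) : bool :=
  round_invb 0 (k * (4 * n))%N (roundsl k (sampleseq (take S l)) (drop S l)).

Lemma trial_prob : iocp_le G xpredT k ->
  (1 / 2%:R) * (1 / t%:R) ^+ S * (1 / 2%:R * (1 / D%:R * (1 / D%:R))) ^+ k
    <= Pr (S + 3 * k) goodb.
Proof.
move=> Hk; apply: pr_chain sample_prob _ _ => //.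
  by apply/exprn_ge0/p30.
move=> s1 Hs; have /iocp_leP-> := Hk; rewrite orbF => /round_invP Hr.
have := rounds_prob k Hr; rewrite subnn add0n => H1; apply: le_trans H1 _.
by apply: pr_le => // s2 _ _; rewrite /goodb take_size_cat // drop_size_cat.
Qed.

End Trial.

(** * Running on the machine *)

Section Params.
Variables (k t : nat).
Definition pD := 4 * (t * (k + 1)).
Definition pL := 10 * pD.
Definition pE := pL * pD.
Definition pS := 2 * (pE * pE).
Definition pR := 2 * t ^ pS * (2 * (pD * pD)) ^ k.
Definition pQ := pR * (pS + 3 * k).
(** One constant above all parameters and the products met while computing them; being a sum, it
    makes each comparison linear. *)
Definition pV := k + t + pD + pL + pE + pS + pR + pQ + pE * pE + t * (k + 1) + 2 * (pD * pD) + 4 * pD + 20.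
End Params.

(** The bound B of the draws is polynomial in n, so words of O(log n) bits can hold it. *)
Lemma nHD_le n k t :
  n * (2 * (n %/ pE k t)).+1 * pD k t <= pV k t * (n + 1) ^ 2.
Proof.
have HE : 2 * (n %/ pE k t) <= 2 * n by rewrite leq_mul2l leq_div.
have DV : 2 * pD k t <= pV k t by rewrite /pV; lia.
apply: (@leq_trans ((2 * pD k t) * (n + 1) ^ 2)); last by rewrite leq_mul2r DV orbT.
rewrite expnS expn1; apply: (@leq_trans (n * (2 * n).+1 * pD k t)).
  by rewrite leq_mul2r leq_mul2l ltnS HE !orbT.
by rewrite [X in _ <= X]mulnAC leq_mul2r; apply/orP; right; nia.
Qed.

Lemma pD_gt0 k t : 0 < t -> 0 < pD k t. Proof. by rewrite /pD; nia. Qed.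

(** The parameters need sums and products, which [nogrow] forbids, so overflow is checked by hand.
    The computation is split because the second half uses variable 6, assigned here, as a loop
    limit. *)
Definition pPreA :=
  SSet 4 (emul (HC 4) (emul #2 (eadd #1 (HC 1)))) ;;
  SSet 5 (emul (HC 10) #4) ;;
  SSet 14 (emul #5 #4) ;;
  SSet 6 (emul (HC 2) (emul #14 #14)) ;;
  SSet 11 (emul (HC 4) #4) ;;
  SSet 12 (emul (HC 3) #4) ;;
  SSet 10 (eadd #0 (HC 1)) ;;
  SSet 8 (eadd (emul (HC 2) (HB Defs.Div #0 #14)) (HC 1)) ;;
  SSet 9 (emul (emul #0 #8) #4) ;;
  SSet 15 (HC 2).

(** Variable 15 starts at 2 and is multiplied up to R = 2 t^S (2 D^2)^k. *)
Definition pPreB1 := SFor 20 6 (SSet 15 (emul #15 #2)).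
Definition pPreB2 := SFor 20 1 (SSet 15 (emul #15 (emul (HC 2) (emul #4 #4)))).
Definition pPreC := SSet 7 #15 ;; SSet 13 (emul #7 (eadd #6 (emul (HC 3) #1))).
Definition pPreB := pPreB1 ;; pPreB2 ;; pPreC.

Section Prelude.
Variables (W n k t : nat) (s : hstate).
Hypotheses (t0 : 0 < t) (Hn : vs s 0 = n) (Hk : vs s 1 = k) (Ht : vs s 2 = t).
Hypothesis HW : pV k t * (n + 1) ^ 2 < W.
Local Notation D := (pD k t).
Local Notation L := (pL k t).
Local Notation E := (pE k t).
Local Notation S := (pS k t).
Local Notation R := (pR k t).
Local Notation H := ((2 * (n %/ E)).+1).

Lemma V_lt : pV k t < W.
Proof. by apply: leq_ltn_trans HW; rewrite leq_pmulr // expn_gt0 addn1. Qed.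

Lemma safe_set x e s1 p v : esafe W s1 e -> hev s1 e = v -> safe W (setv s1 x v) p ->
  safe W s1 (SSet x e ;; p).
Proof. by move=> H1 <- H2; split. Qed.

Lemma run_set_eq x e s1 p v : hev s1 e = v -> run (SSet x e ;; p) s1 = run p (setv s1 x v).
Proof. by move=> <-. Qed.

Definition preA := setv (setv (setv (setv (setv (setv (setv (setv (setv (setv s
  4 D) 5 L) 14 E) 6 S) 11 (4 * D)) 12 (3 * D)) 10 (n + 1)) 8 H) 9 (n * H * D)) 15 2.

Lemma preA_ok : safe W s pPreA /\ run pPreA s = preA.
Proof.
have V := V_lt; have NHD := nHD_le n k t.
have n1 : n + 1 <= (n + 1) ^ 2 by rewrite expnS expn1; nia.
have V1 : (n + 1) ^ 2 <= pV k t * (n + 1) ^ 2 by rewrite leq_pmull // /pV; lia.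
have n20 : 20 * (n + 1) <= pV k t * (n + 1) ^ 2.
  by apply: leq_mul => //; rewrite /pV; lia.
have dn := leq_div n E.
have nH : n * H <= n * H * D by rewrite leq_pmulr // pD_gt0.
have VE : pV k t = k + t + D + L + E + S + R + pQ k t + E * E + t * (k + 1) + 2 * (D * D) + 4 * D + 20 by [].
have [DE LE EE SE] : [/\ D = 4 * (t * (k + 1)), L = 10 * D, E = L * D & S = 2 * (E * E)] by [].
rewrite /pPreA; split.
  apply: (@safe_set _ _ _ _ D); [by rewrite /= ?Hn ?Hk ?Ht; lia|by rewrite /= ?Hn ?Hk ?Ht|].
  apply: (@safe_set _ _ _ _ L); [by rewrite /= ?Hn ?Hk ?Ht; lia|by rewrite /= ?Hn ?Hk ?Ht|].
  apply: (@safe_set _ _ _ _ E); [by rewrite /= ?Hn ?Hk ?Ht; lia|by rewrite /= ?Hn ?Hk ?Ht|].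
  apply: (@safe_set _ _ _ _ S); [by rewrite /= ?Hn ?Hk ?Ht; lia|by rewrite /= ?Hn ?Hk ?Ht|].
  apply: (@safe_set _ _ _ _ (4 * D)); [by rewrite /= ?Hn ?Hk ?Ht; lia|by rewrite /= ?Hn ?Hk ?Ht|].
  apply: (@safe_set _ _ _ _ (3 * D)); [by rewrite /= ?Hn ?Hk ?Ht; lia|by rewrite /= ?Hn ?Hk ?Ht|].
  apply: (@safe_set _ _ _ _ (n + 1)); [by rewrite /= ?Hn ?Hk ?Ht; lia|by rewrite /= ?Hn ?Hk ?Ht|].
  apply: (@safe_set _ _ _ _ H); [by rewrite /= ?Hn ?Hk ?Ht; lia|by rewrite /= ?Hn ?Hk ?Ht ?addn1|].
  apply: (@safe_set _ _ _ _ (n * H * D)); [by rewrite /= ?Hn ?Hk ?Ht; lia|by rewrite /= ?Hn ?Hk ?Ht|].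
  by rewrite /=; lia.
rewrite (@run_set_eq _ _ _ _ D); last by rewrite /= Hk Ht.
rewrite (@run_set_eq _ _ _ _ L) //.
rewrite (@run_set_eq _ _ _ _ E) //.
rewrite (@run_set_eq _ _ _ _ S) //.
rewrite (@run_set_eq _ _ _ _ (4 * D)) //.
rewrite (@run_set_eq _ _ _ _ (3 * D)) //.
rewrite (@run_set_eq _ _ _ _ (n + 1)); last by rewrite /= Hn.
rewrite (@run_set_eq _ _ _ _ H); last by rewrite /= Hn addn1.
by rewrite (@run_set_eq _ _ _ _ (n * H * D)) //= Hn.
Qed.

Lemma fiter_pow M e b s1 i : (forall s', (forall z, ~~ eqn z 15 -> ~~ eqn z 20 -> vs s' z = vs s1 z) -> hev s' e = b) ->
  (forall j, j <= i -> j <= M /\ vs s1 15 * b ^ j <= M) -> bounded M s1 ->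
  let s2 := fiter 20 (SSet 15 (emul #15 e)) s1 i in
  [/\ vs s2 15 = vs s1 15 * b ^ i, forall z, ~~ eqn z 15 -> ~~ eqn z 20 -> vs s2 z = vs s1 z,
      ar s2 = ar s1 & bounded M s2].
Proof.
move=> He HM Hb; cbv zeta; elim: i HM => [|i IH] HM; first by rewrite muln1.
have [|I1 I2 I3 I4] := IH; first by move=> j Hj; apply: HM; apply: leqW.
rewrite fiterS run_set.
have Ee : hev (setv (fiter 20 (SSet 15 (emul #15 e)) s1 i) 20 i) e = b.
  by apply: He => z Hz Hz' /=; rewrite (negPf Hz') I2.
have Em : hev (setv (fiter 20 (SSet 15 (emul #15 e)) s1 i) 20 i) (emul #15 e) = vs s1 15 * b ^ i.+1.
  by rewrite [LHS]/= Ee I1 expnSr mulnA.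
split.
- by rewrite [LHS]/= -[RHS]Em.
- by move=> z Hz Hz' /=; rewrite (negPf Hz) (negPf Hz') I2.
- by rewrite /= I3.
- by apply: bounded_setv; [apply: bounded_setv => //; case: (HM i (leqnSn i)) | rewrite Em; case: (HM i.+1 (leqnn _))].
Qed.

Lemma safe_pow M y e b s1 : M < W -> (forall s', (forall z, ~~ eqn z 15 -> ~~ eqn z 20 -> vs s' z = vs s1 z) ->
    hev s' e = b /\ esafe W s' e) -> 0 < b ->
  vs s1 15 * b ^ vs s1 y <= M -> bounded M s1 ->
  safe W s1 (SFor 20 y (SSet 15 (emul #15 e))) /\
  let s2 := run (SFor 20 y (SSet 15 (emul #15 e))) s1 in
  [/\ vs s2 15 = vs s1 15 * b ^ vs s1 y, forall z, ~~ eqn z 15 -> ~~ eqn z 20 -> vs s2 z = vs s1 z,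
      ar s2 = ar s1 & bounded M s2].
Proof.
move=> HMW He b0 HM Hb.
have HM' j : j <= vs s1 y -> j <= M /\ vs s1 15 * b ^ j <= M.
  move=> Hj; split; first exact: leq_trans Hj (proj1 Hb y).
  by apply: leq_trans HM; rewrite leq_mul2l leq_pexp2l ?orbT.
have He' s' H := proj1 (He s' H).
split; last exact: fiter_pow.
split; first exact: leq_ltn_trans (proj1 Hb y) HMW.
move=> i Hi; have [|I1 I2 I3 I4] := @fiter_pow M e b s1 i He' _ Hb.
  by move=> j Hj; apply: HM'; lia.
set s2 := setv _ 20 i.
have [E1 E2] : hev s2 e = b /\ esafe W s2 e.
  by apply: He => z Hz Hz' /=; rewrite (negPf Hz') I2.
rewrite /= E2 E1 I1 -mulnA -expnSr.
by apply: leq_ltn_trans HMW; case: (HM' i.+1 Hi).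
Qed.

Definition pre_post M (s' : hstate) := [/\
  [/\ vs s' 0 = n, vs s' 1 = k, vs s' 3 = vs s 3, vs s' 4 = D & vs s' 5 = L],
  [/\ vs s' 6 = S, vs s' 7 = R, vs s' 8 = H, vs s' 9 = n * H * D & vs s' 10 = n.+1],
  [/\ vs s' 11 = 4 * D, vs s' 12 = 3 * D & vs s' 13 = pQ k t], ar s' = ar s & bounded M s'].

Lemma preB_ok M : pV k t * (n + 1) ^ 2 <= M -> M < W -> bounded M s ->
  bounded M preA /\ safe W preA pPreB /\ pre_post M (run pPreB preA).
Proof.
move=> HM HMW Hb.
have VM : pV k t <= M by apply: leq_trans HM; rewrite leq_pmulr // expn_gt0 addn1.
have NHD := leq_trans (nHD_le n k t) HM.
have n1 : n + 1 <= M.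
  apply: leq_trans HM; apply: (@leq_trans ((n + 1) ^ 2)).
    by rewrite expnS expn1 leq_pmulr // addn1.
  by rewrite leq_pmull // /pV addn_gt0 orbT.
have VE : pV k t = k + t + D + L + E + S + R + pQ k t + E * E + t * (k + 1) + 2 * (D * D) + 4 * D + 20 by [].
have [DE LE EE SE] : [/\ D = 4 * (t * (k + 1)), L = 10 * D, E = L * D & S = 2 * (E * E)] by [].
have Hd0 := pD_gt0 k t0.
have LD : L <= E by rewrite EE leq_pmulr.
have HH : H <= M.
  apply: leq_trans n1; rewrite addn1 ltnS.
  have : n %/ E * 2 <= n %/ E * E by rewrite leq_mul2l; apply/orP; right; move: LD; rewrite LE; clear -Hd0; lia.
  by have := leq_divM n E; clear; lia.
have bA : bounded M preA.
  rewrite /preA; do 10!(apply: bounded_setv; last by clear -VE VM NHD n1 HH; lia).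
  exact: Hb.
split=> //.
have pA15 : vs preA 15 = 2 by [].
have t20 : 0 < 2 * (D * D) by clear -Hd0; nia.
have RV : R <= M by clear -VE VM; lia.
have tS : 2 * t ^ S <= R by rewrite leq_pmulr // expn_gt0 t20.
have [|||||sB1 [B1 B2 B3 B4]] := @safe_pow M 6 #2 t preA.
- exact: HMW.
- by move=> s' Hs'; rewrite /= Hs' //= Ht.
- exact: t0.
- by rewrite pA15; exact: leq_trans tS RV.
- exact: bA.
rewrite -/pPreB1 in sB1 B1 B2 B3 B4.
rewrite pA15 in B1.
rewrite /pPreB run_seq.
suff [sC HC] : safe W (run pPreB1 preA) (pPreB2 ;; pPreC) /\ pre_post M (run (pPreB2 ;; pPreC) (run pPreB1 preA)).
  by split.
move: (run pPreB1 preA) B1 B2 B3 B4 => s1 B1 B2 B3 B4.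
have s1k : vs s1 1 = k by rewrite B2 //= Hk.
have s1D : vs s1 4 = D by rewrite B2.
have [|||||sB2 [C1 C2 C3 C4]] := @safe_pow M 1 (emul (HC 2) (emul #4 #4)) (2 * (D * D)) s1.
- exact: HMW.
- move=> s' Hs'; rewrite /= Hs' // s1D; split=> //.
  by clear -VE VM HMW; lia.
- exact: t20.
- by rewrite B1 s1k; exact: RV.
- exact: B4.
rewrite -/pPreB2 in sB2 C1 C2 C3 C4.
rewrite B1 s1k -/R in C1.
rewrite run_seq.
suff [sC HC] : safe W (run pPreB2 s1) pPreC /\ pre_post M (run pPreC (run pPreB2 s1)) by split.
have K z v : ~~ eqn z 15 -> ~~ eqn z 20 -> vs preA z = v -> vs (run pPreB2 s1) z = v.
  by move=> H1 H2 <-; rewrite C2 // B2.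
move: (run pPreB2 s1) C1 C3 C4 K => s2 C1 C3 C4 K.
have k6 : vs s2 6 = S by rewrite (K 6 S).
have k1 : vs s2 1 = k by rewrite (K 1 k) //= Hk.
have QE : R * (S + 3 * k) = pQ k t by [].
have QR : S + 3 * k <= pQ k t.
  by rewrite -QE leq_pmull //; apply: leq_trans tS; rewrite muln_gt0 expn_gt0 t0.
rewrite /pPreC; split.
  apply: (@safe_set _ _ _ _ R); [by []|by rewrite /= C1|].
  rewrite /= k6 k1 QE; clear -VE VM HMW QR; lia.
rewrite (@run_set_eq _ _ _ _ R); last by rewrite /= C1.
rewrite run_set.
have -> : hev (setv s2 7 R) (emul #7 (eadd #6 (emul (HC 3) #1))) = pQ k t by rewrite /= k6 k1.
split.
- by split; rewrite /=; [rewrite (K 0 n) //= Hn|exact: k1|rewrite (K 3 (vs s 3))|rewrite (K 4 D)|rewrite (K 5 L)].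
- split; rewrite /=; [exact: k6|by []|by rewrite (K 8 H)|by rewrite (K 9 (n * H * D))|].
  by rewrite (K 10 (n + 1)) // addn1.
- by split; rewrite /=; [rewrite (K 11 (4 * D))|rewrite (K 12 (3 * D))|].
- by rewrite /= C3 B3.
- by do 2!(apply: bounded_setv; last by clear -VE VM; lia).
Qed.
End Prelude.

(* Registers 6, 18 and 26 are the variables n^2, B and Q. *)
Definition acell a := Bin Add (Reg 6) (Bin Add (Bin Mul (Const 16) (Reg 1)) (Const a)).
Definition incr1 := Assign 1 (Bin Add (Reg 1) (Const 1)).

(** * Copying the input, drawing, and writing the output *)

Definition copyBody := Seq (Store (acell 0) (Read (Reg 1))) incr1.
(** The matrix is moved into array 0 because compiled programs address only cells from n^2 on. *)
Definition copyProg := Seq (Assign 1 (Const 0)) (While (Bin Defs.Lt (Reg 1) (Reg 6)) copyBody).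
Definition drawBody := Seq (Assign 1 (Bin Defs.Sub (Reg 1) (Const 1)))
  (Seq (Rand 3 (Reg 18)) (Store (acell 1) (Reg 3))).
Definition drawProg := Seq (Assign 1 (Reg 26)) (While (Reg 1) drawBody).
Definition outBody := Seq (Store (Reg 1) (Read (acell 9))) incr1.
Definition outProg := Seq (Assign 1 (Const 0)) (While (Bin Defs.Lt (Reg 1) (Reg 0)) outBody).

Section Machine.
Variable w : nat.
Hypothesis Hw : 16 < 2 ^ w.

Lemma sim_ext s s' m : vs s =1 vs s' -> (forall a, ar s a =1 ar s' a) -> sim s m -> sim s' m.
Proof. by move=> Hv Ha [H1 H2]; split=> [x|a i Hi]; rewrite -?Hv -?Ha; auto. Qed.

Lemma acell_ok a m i b : a < 16 -> regs m 6 = b -> regs m 1 = i -> b + (16 * i + a) < 2 ^ w ->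
  eval w m (acell a) = b + (16 * i + a).
Proof.
move=> Ha H6 H1 Hb; rewrite /= H6 H1.
rewrite (modn_small (m := 16)) // (modn_small (m := a)); last by apply: ltn_trans Hw.
by rewrite (modn_small (m := 16 * i)) ?(modn_small (m := 16 * i + a)) ?modn_small //; lia.
Qed.

Lemma incr1_ok m i : regs m 1 = i -> i.+1 < 2 ^ w -> reach w incr1 m 1 (set_reg m 1 i.+1).
Proof.
move=> H1 Hi; have := reach_assign w 1 (Bin Add (Reg 1) (Const 1)) m.
rewrite [eval _ _ _]/= H1 (modn_small (m := 1)); last by apply: ltn_trans Hw.
by rewrite addn1 modn_small.
Qed.

Lemma prob_rand T x e K m E (B := maxn 1 (eval w m e)) :
  (prob w T.+1 (Rand x e :: K, m) E =
   (\sum_(j <- iota 0 B) prob w T (K, set_reg m x j) E) / B%:R)%R.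
Proof.
have -> : (prob w T.+1 (Rand x e :: K, m) E =
  (\sum_(c <- step w (Rand x e :: K, m)) prob w T c E) /
     (size (step w (Rand x e :: K, m)))%:R)%R by [].
by rewrite big_map size_map size_iota.
Qed.

Lemma sim_reg1 s m r v : odd r -> sim s m -> sim s (set_reg m r v).
Proof.
move=> Hr [H1 H2]; split=> // x; rewrite /= /upd ifF //.
by apply/negP => /eqP E; move: Hr; rewrite -E odd_double.
Qed.

Section Copy.
Variables (s : hstate) (inp : nat -> nat).
Let b := vs s 3.
Hypothesis Hb : 17 * b + 32 < 2 ^ w.

Definition copyst i := HState (vs s)
  (fun a x => if (a == 0) && (x < i) then inp x else ar s a x).

Lemma copy_loop j i m : i + j = b -> sim (copyst i) m -> regs m 1 = i ->
  (forall x, x < b -> Defs.mem m x = inp x) ->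
  exists m', sim (copyst b) m' /\
    reach w (While (Bin Defs.Lt (Reg 1) (Reg 6)) copyBody) m (4 * j + 1) m'.
Proof.
elim: j i m => [|j IH] i m Eij Hm H1 Hin.
  have Ei : i = b by lia.
  exists m; rewrite -[b in copyst b]Ei; split=> //; apply: reach_while0.
  by rewrite /= H1 (proj1 Hm 3) Ei ltnn mod0n.
have Hi : i < b by lia.
set m1 := set_mem m (b + (16 * i + 0)) (inp i).
set m2 := set_reg m1 1 i.+1.
have Hm1 : sim (copyst i.+1) m1.
  case: Hm => Hr Ha; split=> // a x Hax; rewrite /m1 /= /upd -/b.
  case: (a =P 0) => [->|na] /=; last first.
    have := Ha a x Hax; rewrite /= -/b (_ : (a == 0) = false) /=; last exact/eqP.
    by move=> <-; rewrite ifF //; apply/eqP; lia.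
  have := Ha 0 x isT; rewrite /= -/b ltnS.
  case: (ltngtP x i) => [Hx|Hx|->] Ex; last by rewrite eqxx.
    by rewrite ifF //; apply/eqP; lia.
  by rewrite ifF //; apply/eqP; lia.
have Hm2 : sim (copyst i.+1) m2 by apply: sim_reg1.
have H2 : regs m2 1 = i.+1 by [].
have Hin2 x : x < b -> Defs.mem m2 x = inp x.
  by move=> Hx; rewrite /m2 /= /upd ifF ?Hin //; apply/eqP; lia.
have Eij' : i.+1 + j = b by lia.
have [m' [Hm' R]] := IH _ _ Eij' Hm2 H2 Hin2.
exists m'; split=> //.
rewrite (_ : 4 * j.+1 + 1 = ((1 + 1).+1 + (4 * j + 1)).+1); last by lia.
apply: (reach_while1 (s2 := m2)) => //.
  rewrite /= H1 (proj1 Hm 3) /= -/b Hi modn_small //; lia.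
apply: (reach_seq (s2 := m1)).
  have := reach_store w (acell 0) (Read (Reg 1)) m.
  rewrite (@acell_ok 0 m i b) //; [|exact: (proj1 Hm 3)|by lia].
  by rewrite [eval w m (Read _)]/= H1 Hin.
by apply: incr1_ok => //; lia.
Qed.

Lemma copy_ok m : sim s m -> (forall x, x < b -> Defs.mem m x = inp x) ->
  exists m', sim (copyst b) m' /\ reach w copyProg m (4 * b + 3) m'.
Proof.
move=> Hm Hin.
have [||||m' [H1 H2]] := @copy_loop b 0 (set_reg m 1 0) => //.
  by apply: sim_reg1 => //; apply: sim_ext Hm => // a x /=; rewrite ltn0 andbF.
exists m'; split=> //; rewrite (_ : 4 * b + 3 = (1 + (4 * b + 1)).+1); last by lia.
apply: reach_seq H2.
by have := reach_assign w 1 (Const 0) m; rewrite [eval _ _ _]/= mod0n.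
Qed.
End Copy.

(* Array 1 is filled from the top, and consumed in the same order. *)
Definition fillst (s : hstate) q (l : seq nat) := HState (vs s)
  (fun a x => if (a == 1) && (x < q) then nth 0 l (q - 1 - x) else ar s a x).

Lemma draw_loop q s m T K E F (B := maxn 1 (vs s 9)) :
  sim s m -> regs m 1 = q -> vs s 3 + 16 * q + 32 < 2 ^ w ->
  (forall l m', size l = q -> all (gtn B) l -> sim (fillst s q l) m' ->
     F l <= prob w T (K, m') E)%R ->
  (avg B q F <= prob w (T + (6 * q + 1)) (While (Reg 1) drawBody :: K, m) E)%R.
Proof.
rewrite {}/B; elim: q s m F => [|q IH] s m F Hm H1 Hb HF.
  have R : reach w (While (Reg 1) drawBody) m 1 m by apply: reach_while0.
  rewrite R /=; apply: HF => //.
  by apply: sim_ext Hm => // a x /=; rewrite andbF.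
(* Six moves per draw: loop test, two sequence nodes, decrement, draw and store. *)
rewrite (_ : T + (6 * q.+1 + 1) = (T + (6 * q + 1)).+1.+4.+1); last by lia.
set T1 := T + (6 * q + 1) in IH *.
rewrite (@prob_det w _ _ _ _ (drawBody :: While (Reg 1) drawBody :: K, m)); last first.
  by rewrite /= H1.
rewrite (@prob_det w _ _ _ _ (Assign 1 (Bin Defs.Sub (Reg 1) (Const 1)) ::
   Seq (Rand 3 (Reg 18)) (Store (acell 1) (Reg 3)) :: While (Reg 1) drawBody :: K, m)) //.
set m1 := set_reg m 1 q.
rewrite (@prob_det w _ _ _ _ (Seq (Rand 3 (Reg 18)) (Store (acell 1) (Reg 3)) ::
    While (Reg 1) drawBody :: K, m1)); last first.
  rewrite /= H1 (modn_small (m := 1)); last by apply: ltn_trans Hw.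
  by rewrite subn1 /= modn_small //; lia.
rewrite (@prob_det w _ _ _ _ (Rand 3 (Reg 18) :: Store (acell 1) (Reg 3) ::
    While (Reg 1) drawBody :: K, m1)) //.
have Hm1 : sim s m1 by apply: sim_reg1.
rewrite prob_rand (_ : eval w m1 (Reg 18) = vs s 9); last exact: (proj1 Hm1 9).
apply: ler_wpM2r; first by rewrite invr_ge0 ler0n.
rewrite big_seq [X in (_ <= X)%R]big_seq; apply: ler_sum => x; rewrite mem_iota add0n => /andP[_ Hx].
set m2 := set_reg m1 3 x.
set m3 := set_mem m2 (vs s 3 + (16 * q + 1)) x.
have Hm2 : sim s m2 by apply: sim_reg1.
have Hm3 : sim (seta s 1 q x) m3.
  case: Hm2 => Hr Ha; split=> // a i Hai; rewrite /m3 [LHS]/= /upd [RHS]/= eqnE.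
  case: (a =P 1) => [->|na] /=.
    case: (i =P q) => [->|ni]; first by rewrite eqxx.
    by rewrite ifF; [exact: Ha 1 i isT|apply/eqP; lia].
  by rewrite ifF; [exact: Ha|apply/eqP; lia].
rewrite (@prob_det w _ _ _ _ (While (Reg 1) drawBody :: K, m3)); last first.
  rewrite -[step _ _]/([:: (While (Reg 1) drawBody :: K, set_mem m2 (eval w m2 (acell 1)) x)]).
  by rewrite (@acell_ok 1 m2 q (vs s 3)) //; [exact: (proj1 Hm2 3)|lia].
apply: (IH (seta s 1 q x) m3) => //=; first by lia.
move=> l m' Hl Hall Hsim; apply: HF => /=; rewrite ?Hl ?Hx //.
apply: sim_ext Hsim => // a i /=; rewrite eqnE.
case: (a =P 1) => //= _; rewrite ltnS.
case: (ltngtP i q) => [Hi|Hi|->] //=.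
- by rewrite (_ : q.+1 - 1 - i = (q - 1 - i).+1) //; lia.
- by rewrite (_ : q.+1 - 1 - q = 0) //; lia.
Qed.

Section Out.
Variables (s : hstate) (n : nat).
Let b := vs s 3.
Hypotheses (Hn : vs s 0 = n) (Hnb : n <= b) (Hb : 17 * b + 64 < 2 ^ w).

Lemma out_loop j i m : i + j = n -> regs m 0 = n -> regs m 6 = b -> regs m 1 = i ->
  (forall x, Defs.mem m (b + (16 * x + 9)) = ar s 9 x) ->
  (forall x, x < i -> Defs.mem m x = ar s 9 x) ->
  exists m', (forall x, x < n -> Defs.mem m' x = ar s 9 x) /\
    reach w (While (Bin Defs.Lt (Reg 1) (Reg 0)) outBody) m (4 * j + 1) m'.
Proof.
elim: j i m => [|j IH] i m Eij H0 H6 H1 Ha Hx.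
  exists m; split; first by move=> x Hxn; apply: Hx; lia.
  by apply: reach_while0; rewrite /= H1 H0 (_ : i < n = false) ?mod0n //; lia.
have Hi : i < n by lia.
set m1 := set_mem m i (ar s 9 i).
set m2 := set_reg m1 1 i.+1.
have F1 : i.+1 + j = n by lia.
have F2 x : Defs.mem m2 (b + (16 * x + 9)) = ar s 9 x.
  by rewrite /m2 /= /upd ifF ?Ha //; apply/eqP; lia.
have F3 x : x < i.+1 -> Defs.mem m2 x = ar s 9 x.
  move=> Hxi; rewrite /m2 /= /upd; case: (x =P i) => [->|nx] //.
  by apply: Hx; lia.
have [m' [Hm' R]] := IH i.+1 m2 F1 H0 H6 erefl F2 F3.
exists m'; split=> //.
rewrite (_ : 4 * j.+1 + 1 = ((1 + 1).+1 + (4 * j + 1)).+1); last by lia.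
apply: (reach_while1 (s2 := m2)) => //.
  by rewrite /= H1 H0 Hi modn_small //; lia.
apply: (reach_seq (s2 := m1)).
  have := reach_store w (Reg 1) (Read (acell 9)) m.
  rewrite [eval w m (Reg 1)]/= H1.
  rewrite -[eval w m (Read _)]/(Defs.mem m (eval w m (acell 9))) (@acell_ok 9 m i b) ?Ha //.
  lia.
by apply: incr1_ok => //; lia.
Qed.

Lemma out_ok m : sim s m ->
  exists m', (forall x, x < n -> Defs.mem m' x = ar s 9 x) /\ reach w outProg m (4 * n + 3) m'.
Proof.
move=> [Hr Ha].
have F0 : regs (set_reg m 1 0) 0 = n by rewrite -Hn -(Hr 0).
have [m' [H1 H2]] := out_loop (add0n n) F0 (Hr 3) erefl (fun x => Ha 9 x isT) (fun x (H : x < 0) => match notF H with end).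
exists m'; split=> //; rewrite (_ : 4 * n + 3 = (1 + (4 * n + 1)).+1); last by lia.
apply: reach_seq H2.
by have := reach_assign w 1 (Const 0) m; rewrite [eval _ _ _]/= mod0n.
Qed.
End Out.
End Machine.

(** * Assembly of the algorithm *)

(** Variables live in even registers, so [k] and [t] move from registers 1 and 2 to 2 and 4; [t]
    goes first because [k] takes its place. *)
Definition moves := Seq (Assign 4 (Reg 2)) (Seq (Assign 2 (Reg 1))
  (Assign 6 (Bin Defs.Mul (Reg 0) (Reg 0)))).
Definition setup := Seq moves (Seq copyProg (Seq (comp 0 pPreA) (comp 0 pPreB))).
Definition algorithm := Seq setup (Seq drawProg (Seq (comp 0 pMain) outProg)).

Definition main_cst k t := ncst (pV k t) pMain.
Definition time_cst k t := main_cst k t + 7 * pS k t + 7 * k + 6 * pQ k t + 100.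

(** X = M + 17 satisfies the conditions M < X and 16 <= X of the overflow analysis; 40 is the degree
    checked in [nogrow_main]. *)
Definition word_bound M w := (M + 17) ^ 40 <= 2 ^ w.

Section Run.
Variables (n : nat) (G : sgraph n) (k t w : nat).
Hypothesis t0 : 0 < t.
Let M := pV k t * (n + 1) ^ 2.
Hypothesis HW : word_bound M w.
Local Notation D := (pD k t).
Local Notation L := (pL k t).
Local Notation E := (pE k t).
Local Notation S := (pS k t).
Local Notation R := (pR k t).
Local Notation Q := (pQ k t).
Local Notation H := ((2 * (n %/ E)).+1).
Local Notation N := (maxn n 1).
Local Notation Bm := (maxn 1 (n * H * D)).

Let W17 : 17 * M + 64 < 2 ^ w.
Proof.
move: HW; rewrite /word_bound => HW'.
apply: leq_trans HW'; apply: (@leq_trans ((M + 17) ^ 2)); last by rewrite leq_pexp2l // addnC.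
move: M => x; rewrite expnS expn1; nia.
Qed.
Let HMW : M < 2 ^ w. Proof. by move: W17; lia. Qed.
Let W16 : 16 < 2 ^ w. Proof. by move: W17; lia. Qed.
Let V_M : pV k t <= M. Proof. by rewrite leq_pmulr // expn_gt0 addn1. Qed.
Let n_M : n <= M.
Proof.
apply: (@leq_trans ((n + 1) ^ 2)); first by rewrite expnS expn1; nia.
by rewrite leq_pmull // /pV addn_gt0 orbT.
Qed.
Let nn_M : n * n <= M.
Proof.
apply: (@leq_trans ((n + 1) ^ 2)); first by rewrite expnS expn1; nia.
by rewrite leq_pmull // /pV addn_gt0 orbT.
Qed.
Let kt_M : [/\ k <= M, t <= M & 20 <= M].
Proof. by split; apply: leq_trans V_M; rewrite /pV; lia. Qed.

Definition inp := Defs.mem (init_store w k t G).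

Lemma inp_adj x y : x < n -> y < n -> inp (x * n + y) = nat_adj G x y.
Proof.
move=> Hx Hy; rewrite /inp /=.
have -> : [exists i : 'I_n, exists j : 'I_n, (x * n + y == i * n + j) && G i j] = nat_adj G x y.
  apply: eq_existsb => i; apply: eq_existsb => j.
  by rewrite idx_inj // (eq_sym x) (eq_sym y) -andbA.
by rewrite modn_small //; case: (nat_adj _ _ _); lia.
Qed.

Lemma inp_high a : n * n <= a -> inp a = 0.
Proof.
move=> Ha; rewrite /inp /= (_ : [exists i, _] = false) ?mod0n //.
apply/negbTE/negP => /existsP[i /existsP[j /andP[/eqP Ea _]]].
by have := ltn_ord i; have := ltn_ord j; nia.
Qed.

Lemma inp_le1 a : inp a <= 1.
Proof. by rewrite /inp /=; apply: leq_trans (leq_mod _ _) _; case: [exists _, _]. Qed.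

Definition hst0 := HState (fun x => if x is 3 then n * n else nth 0 [:: n; k; t] x) (fun _ _ => 0).

Lemma moves_ok : exists m, [/\ sim hst0 m, forall x, Defs.mem m x = inp x &
  reach w moves (init_store w k t G) 5 m].
Proof.
have [Hk Ht _] := kt_M.
set m0 := init_store w k t G.
set m1 := set_reg m0 4 t; set m2 := set_reg m1 2 k; set m3 := set_reg m2 6 (n * n).
have sm x : x <= M -> x %% 2 ^ w = x by move=> Hx; apply: modn_small; apply: leq_ltn_trans HMW.
exists m3; split=> //.
  split.
    by do 4?[case=> [|]] => //=; rewrite /upd /= ?sm // => x; rewrite nth_default ?mod0n.
  by move=> a i Ha /=; rewrite -[RHS](@inp_high (n * n + (16 * i + a))) // leq_addr.
have A r e m v : eval w m e = v -> reach w (Assign r e) m 1 (set_reg m r v).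
  by move=> <-; apply: reach_assign.
apply: (@reach_seq _ _ _ _ m1 _ 1 3); first by apply: A; rewrite /= sm.
apply: (@reach_seq _ _ _ _ m2 _ 1 1); first by apply: A; rewrite /= /upd /= sm.
by apply: A; rewrite /= /upd /= !sm // sm.
Qed.

Definition hstC := copyst hst0 inp (n * n).
Definition hst1 := run pPreB (preA n k t hstC).
Definition hstM l := fillst hst1 Q l.

Lemma hst1_post : pre_post n k t hstC M hst1 /\ bounded M (preA n k t hstC) /\
  safe (2 ^ w) (preA n k t hstC) pPreB.
Proof.
have b0 : bounded M hstC.
  have [Hk Ht H20] := kt_M.
  split; first by do 4?[case=> [|]] => //= x; rewrite nth_default.
  by move=> a x /=; case: ifP => // _; apply: leq_trans (inp_le1 x) _; lia.
have [bA [sB pB]] := preB_ok t0 (erefl : vs hstC 0 = n) (erefl : vs hstC 1 = k) (erefl : vs hstC 2 = t)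
   HMW (leqnn _) HMW b0.
by [].
Qed.

Lemma tcost_preB nu : nu 6 = S -> nu 1 = k -> tcost nu pPreB <= 7 * S + 7 * k + 20.
Proof. by move=> /= -> ->; lia. Qed.

Lemma setup_ok : exists T1 m, [/\ T1 <= 7 * S + 7 * k + 4 * (n * n) + 60, sim hst1 m &
  reach w setup (init_store w k t G) T1 m].
Proof.
have [m0 [S0 I0 R0]] := moves_ok.
have Hb : 17 * vs hst0 3 + 32 < 2 ^ w by rewrite /=; move: W17 nn_M; lia.
have [mC [SC RC]] := copy_ok W16 Hb S0 (fun x _ => I0 x).
have [sA eA] := preA_ok t0 (erefl : vs hstC 0 = n) (erefl : vs hstC 1 = k) (erefl : vs hstC 2 = t) HMW.
have [post1 [bA sB]] := hst1_post.
have [TA [mA [LA SA _ RA]]] := @comp_ok w (fun x => x < 4) (vs hstC) W16 isT 0 pPreA hstC mC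
  isT (fun _ _ => erefl) sA SC.
rewrite eA in SA.
have [TB [mB [LB SB _ RB]]] := @comp_ok w (fun x => (x < 5) || (x == 6)) (vs (preA n k t hstC))
  W16 isT 0 pPreB _ mA isT (fun _ _ => erefl) sB SA.
have LA' : TA <= 19 by exact: LA.
have LB' := leq_trans LB (tcost_preB (erefl : vs (preA n k t hstC) 6 = S) (erefl : vs (preA n k t hstC) 1 = k)).
have RAll := reach_seq R0 (reach_seq RC (reach_seq RA RB)).
have E3 : vs hst0 3 = n * n by [].
rewrite E3 in RAll; clear -RAll LA' LB' SB.
eexists; exists mB; split; [|exact: SB|exact: RAll].
lia.
Qed.
(** The loop limits of [pMain], together with 3, because the base of the arrays must not move. *)
Definition lim_ro : pred nat := fun x => x \in [:: 0; 1; 3; 4; 5; 6; 7; 10; 11].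
Definition lim_deg (x : nat) : nat := if x == 3 then 2 else (x == 0) || (x == 10).

Lemma hstM_bounded l : all (gtn Bm) l -> bounded M (hstM l).
Proof.
move=> Hl; have [[_ _ _ _ [bv ba]] _] := hst1_post; split; first exact: bv.
have [_ _ H20] := kt_M.
move=> a x /=; case: ifP => _; last exact: ba.
case: (ltnP (Q - 1 - x) (size l)) => Hx; last by rewrite nth_default.
have Hlt : nth 0 l (Q - 1 - x) < Bm by apply: (allP Hl); apply: mem_nth.
apply: leq_trans (ltnW Hlt) _; rewrite geq_max; have := nHD_le n k t; rewrite -/M => ->.
by move: H20; clear; lia.
Qed.

Lemma main_run m l : all (gtn Bm) l -> sim (hstM l) m ->
  exists T2 m', [/\ T2 <= main_cst k t * N ^ 4 + 4 * n + 4,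
    forall v, v < n -> Defs.mem m' v = ar (run pMain (hstM l)) 9 v &
    reach w (Seq (comp 0 pMain) outProg) m T2 m'].
Proof.
move=> Hl Hm.
have [[[v0 v1 v3 v4 v5] [v6 v7 v8 v9 v10] [v11 v12 v13] _ _] _] := hst1_post.
have [Hk Ht H20] := kt_M.
have [|||||Hs _] := @safe_ok M (M + 17) (2 ^ w) 40 _ _ _ _ _ pMain (hstM l) nogrow_main (hstM_bounded Hl).
- by move: H20; clear; lia.
- by clear; lia.
- by clear; lia.
- exact: HW.
- by [].
pose nu y := if lim_ro y then vs hst1 y else 0.
have Hnu y : lim_ro y -> vs (hstM l) y = nu y by rewrite /nu => ->.
have [T2 [m2 [L2 S2 _ R2]]] := @comp_ok w lim_ro nu W16 isT 0 pMain (hstM l) m isT Hnu Hs Hm.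
have Hc y : nu y <= pV k t * N ^ lim_deg y.
  rewrite /nu /lim_deg; case: ifP => // Hy.
  have N1 : 0 < N by rewrite leq_max orbT.
  have nN : n <= N by rewrite leq_maxl.
  have V2 : 2 <= pV k t by rewrite /pV; clear; lia.
  move: Hy; rewrite /lim_ro !inE => Hy.
  case/orP: Hy => [/eqP->|Hy]; first by rewrite v0 expn1; clear -nN V2 N1; nia.
  case/orP: Hy => [/eqP->|Hy]; first by rewrite v1 muln1 /pV; clear; lia.
  case/orP: Hy => [/eqP->|Hy]; first by rewrite v3 /= expnS expn1; clear -nN V2 N1; nia.
  case/orP: Hy => [/eqP->|Hy]; first by rewrite v4 muln1 /pV; clear; lia.
  case/orP: Hy => [/eqP->|Hy]; first by rewrite v5 muln1 /pV; clear; lia.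
  case/orP: Hy => [/eqP->|Hy]; first by rewrite v6 muln1 /pV; clear; lia.
  case/orP: Hy => [/eqP->|Hy]; first by rewrite v7 muln1 /pV; clear; lia.
  case/orP: Hy => [/eqP->|/eqP->]; first by rewrite v10 expn1; clear -nN V2 N1; nia.
  by rewrite v11 muln1 /pV; clear; lia.
have Hcost := @tcost_le lim_deg (pV k t) N nu pMain _ Hc.
(* Degree 4: n guarded deletions, each searching from n starts through L table rows of cost n^2,
   where L has degree 0. The searches with n + 1 rows and the colouring lie outside that loop. *)
rewrite (_ : ndeg lim_deg pMain = 4) // in Hcost.
have N0 : 0 < N by rewrite leq_max orbT.
have {}Hcost := leq_trans L2 (Hcost N0).
have E0 : vs (run pMain (hstM l)) 0 = n by rewrite run_keepv.
have E3 : vs (run pMain (hstM l)) 3 = n * n by rewrite run_keepv //= v3.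
have [||m3 [O3 R3]] := @out_ok w W16 (run pMain (hstM l)) n E0 _ _ m2 S2.
- by rewrite E3; clear; nia.
- by rewrite E3; move: W17 nn_M; clear; lia.
have RR := reach_seq R2 R3.
exists (T2 + (4 * n + 3)).+1, m3; split=> //.
by move: Hcost; rewrite /main_cst; clear; lia.
Qed.

Lemma machine_run (E : pred store) T (F : seq nat -> rat) : time_cst k t * N ^ 4 <= T ->
  (forall l m, size l = Q -> all (gtn Bm) l ->
    (forall v, v < n -> Defs.mem m v = ar (run pMain (hstM l)) 9 v) -> (F l <= (E m)%:R)%R) ->
  (avg Bm Q F <= prob w T ([:: algorithm], init_store w k t G) E)%R.
Proof.
move=> HT HF.
have [[[v0 v1 v3 v4 v5] [v6 v7 v8 v9 v10] [v11 v12 v13] _ _] _] := hst1_post.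
have [T1 [m1 [L1 S1 R1]]] := setup_ok.
set T2 := main_cst k t * N ^ 4 + 4 * n + 4.
pose T0 := ((T2 + (6 * Q + 1) + 1).+2 + T1).+1.
have N0 : 0 < N by rewrite leq_max orbT.
have HT0 : T0 <= T.
  apply: leq_trans HT; rewrite /T0 /T2 /time_cst; move: L1.
  have N4 : n * n <= N ^ 4 /\ n <= N ^ 4 /\ 0 < N ^ 4.
    have nN : n <= N by rewrite leq_maxl.
    have N2 : 0 < N ^ 4 by rewrite expn_gt0 N0.
    split; last split=> //.
      apply: (@leq_trans (N ^ 2)); first by rewrite expnS expn1 leq_mul.
      by rewrite leq_pexp2l.
    by apply: leq_trans nN _; rewrite -{1}(expn1 N) leq_pexp2l.
  case: N4 => H1 [H2 H3].
  have A x : x <= x * N ^ 4 by rewrite leq_pmulr.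
  have := A (7 * S); have := A (7 * k); have := A (6 * Q); have := A 100.
  move: H1 H2 H3; move: (N ^ 4) (main_cst k t) (pS k t) (pQ k t) => e f h i.
  clear; lia.
apply: le_trans (prob_mono _ _ _ HT0).
rewrite /T0 /algorithm (@prob_det w _ _ _ _ ([:: setup; Seq drawProg (Seq (comp 0 pMain) outProg)], init_store w k t G)) //.
rewrite R1 (@prob_det w _ _ _ _ ([:: drawProg; Seq (comp 0 pMain) outProg], m1)) //.
rewrite (@prob_det w _ _ _ _ ([:: Assign 1 (Reg 26); While (Reg 1) drawBody; Seq (comp 0 pMain) outProg], m1)) //.
rewrite (@reach_assign w 1 (Reg 26) m1).
have S2 : sim hst1 (set_reg m1 1 (eval w m1 (Reg 26))) by apply: sim_reg1.
have E9 : Bm = maxn 1 (vs hst1 9) by rewrite v9.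
rewrite E9; apply: (draw_loop W16 S2).
- by rewrite /= (proj1 S1 13).
- rewrite v3 /=; have QM : Q <= M by apply: leq_trans V_M; rewrite /pV; clear; lia.
  by move: W17 nn_M QM; clear; lia.
rewrite -E9 => l m Hl Hall Hm.
have [T3 [m3 [L3 O3 R3]]] := main_run Hall Hm.
apply: le_trans (HF l m3 Hl Hall O3) _.
have := R3 [::] E (T2 - T3); rewrite prob_nil => <-.
by rewrite subnK.
Qed.
End Run.

(** * From good draws to a good output *)

Lemma foldl_map (T U V : Type) (f : U -> T -> U) (h : V -> T) z s :
  foldl f z (map h s) = foldl (fun x y => f x (h y)) z s.
Proof. by elim: s z => //=. Qed.

Lemma sample_setE n (G : sgraph n) S dr o :
  sample_set G S dr o = sampleseq G [seq dr (o + q) | q <- iota 0 S].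
Proof. by rewrite /sampleseq foldl_map. Qed.

Lemma rounds_setE n (G : sgraph n) D L E dr kk o a :
  rounds_set G D L ((2 * (n %/ E)).+1) dr o a kk =
  roundsl G D L E kk a [seq dr (o + q) | q <- iota 0 (3 * kk)].
Proof.
elim: kk o a => [|kk IH] o a //.
rewrite mulnS !addSn add0n [iota _ _]/= !map_cons [RHS]/= !addn0 addn1 addn2.
rewrite -[3]addn0 iotaDl -map_comp.
have -> : [seq (dr \o addn o \o addn 3) q | q <- iota 0 (3 * kk)] =
   [seq dr (o + 3 + q) | q <- iota 0 (3 * kk)].
  by apply: eq_map => q /=; rewrite addnA.
have <- := IH (o + 3).
rewrite /rounds_set -[kk.+1]addn1 addnC iotaD [iota 0 1]/= foldl_cat [foldl _ a [:: 0]]/= !addn0.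
rewrite add0n -[1]addn0 iotaDl foldl_map; move: (round_set _ _ _ _ _ _ _) => b.
elim: (iota 0 kk) b => //= i s IHs b; rewrite IHs; congr (foldl _ (round_set _ _ _ _ _ _ _) _);
  by rewrite (_ : o + 3 * (1 + i) = o + 3 + 3 * i) //; lia.
Qed.

(** Identifies what the program computes from its stack with the function of a block of draws whose
    success probability was bounded. *)
Lemma trial_setE n (G : sgraph n) k D L S E Q rnd o l :
  (forall i, i < S + 3 * k -> rnd (Q - 1 - (o + i)) = nth 0 l i) -> size l = S + 3 * k ->
  trial_set G k D L S (2 * (n %/ E)).+1 Q rnd o =
  roundsl G D L E k (sampleseq G (take S l)) (drop S l).
Proof.
move=> Hr Hl; rewrite /trial_set sample_setE rounds_setE; congr (roundsl _ _ _ _ _ (sampleseq _ _) _).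
  apply: (@eq_from_nth _ 0); first by rewrite size_map size_iota size_take Hl; case: ifP; lia.
  move=> i; rewrite size_map size_iota => Hi.
  by rewrite (nth_map 0) ?size_iota // nth_iota // nth_take // Hr //; lia.
apply: (@eq_from_nth _ 0); first by rewrite size_map size_iota size_drop Hl; lia.
move=> i; rewrite size_map size_iota => Hi.
by rewrite (nth_map 0) ?size_iota // nth_iota // nth_drop add0n -addnA Hr //; lia.
Qed.

Lemma count_card n (P : pred nat) : count P (iota 0 n) = #|[set v : 'I_n | P v]|.
Proof.
rewrite -val_enum_ord count_map cardsE cardE -size_filter; congr size.
by rewrite enumT; apply: eq_filter => v.
Qed.

Lemma hasgoodP q good R l : hasgood q good R l ->
  exists2 i, i < R & good (take q (drop (i * q) l)).
Proof.
elim: R l => //= R IH l /orP[H|/IH[i Hi H]]; first by exists 0; rewrite // mul0n drop0.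
by exists i.+1; rewrite // mulSn addnC -drop_drop.
Qed.

(** Origin of [pR]: it is the exact reciprocal of the bound in [trial_prob]. *)
Lemma pR_inv k t : (0 < t)%N -> ((pR k t)%:R^-1 =
  (1 / 2%:R) * (1 / t%:R) ^+ (pS k t) *
  (1 / 2%:R * (1 / (pD k t)%:R * (1 / (pD k t)%:R))) ^+ k :> rat)%R.
Proof.
move=> t0; rewrite /pR; move: (pS k t) (pD k t) => S D.
by rewrite !natrM !natrX !natrM !invfM -!exprVn !invfM !div1r.
Qed.

Section Final.
Variables (n : nat) (G : sgraph n) (k t w : nat).
Hypotheses (t0 : 0 < t) (HW : word_bound (pV k t * (n + 1) ^ 2) w).
Local Notation D := (pD k t).
Local Notation L := (pL k t).
Local Notation E := (pE k t).
Local Notation S := (pS k t).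
Local Notation R := (pR k t).
Local Notation Q := (pQ k t).
Local Notation H := ((2 * (n %/ E)).+1).
Local Notation hM := (hstM G k t w).

Lemma hstM_penv l : penv G k D L S H (ar (hM l) 1) (hM l).
Proof.
have [[[v0 v1 v3 v4 v5] [v6 v7 v8 v9 v10] [v11 v12 v13] Ear _] _] := hst1_post G t0 HW.
split; last by split.
split=> // x y Hx Hy.
rewrite [LHS]/= Ear /= ifT; first exact: (inp_adj G t0 HW Hx Hy).
by nia.
Qed.

Lemma bestinv_hM l : bestinv G (run pMain (hM l)) /\
  forall i, i < R -> size l = Q -> no_odd G (trial_set G k D L S H Q (ar (hM l) 1) (i * (S + 3 * k))) ->
   approx G D (trial_set G k D L S H Q (ar (hM l) 1) (i * (S + 3 * k))) (bestp (run pMain (hM l))).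
Proof.
have [[[v0 v1 v3 v4 v5] [v6 v7 v8 v9 v10] [v11 v12 v13] Ear _] _] := hst1_post G t0 HW.
have [] := @run_main n G k D L S H Q R (ar (hM l) 1) (hM l) (pD_gt0 k t0) (hstM_penv l) v13 v7.
  by move=> u; rewrite [LHS]/= Ear.
by move=> H1 H2; split=> // i Hi _; apply: H2.
Qed.

Lemma output_indep l m : (forall v, v < n -> Defs.mem m v = ar (run pMain (hM l)) 9 v) ->
  independent G (output n m) /\ #|output n m| = count_below n (bestp (run pMain (hM l))).
Proof.
move=> Hm; have [[B1 _ _] _] := bestinv_hM l.
have Ho : output n m = [set v : 'I_n | bestp (run pMain (hM l)) v].
  by apply/setP => v; rewrite !inE Hm.
split; last by rewrite Ho /count_below count_card.
rewrite Ho; apply/forallP => x; apply/implyP; rewrite inE => Hx.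
apply/forallP => y; apply/implyP; rewrite inE => Hy.
by rewrite -nat_adj_ord; exact: (B1 _ _ (ltn_ord x) (ltn_ord y) Hx Hy).
Qed.

Lemma good_output (I : pred nat) l m : (forall v, v < n -> Defs.mem m v = ar (run pMain (hM l)) 9 v) ->
  indep G I -> size l = Q -> hasgood (S + 3 * k) (goodb G D L E S k I) R l ->
  t * count_below n I <= t * #|output n m| + n.
Proof.
move=> Hm HI Hl /hasgoodP[i Hi Hg].
have [_ ->] := output_indep Hm; have [_ Happ] := bestinv_hM l.
set a := trial_set G k D L S H Q (ar (hM l) 1) (i * (S + 3 * k)) in Happ.
have Hiq : i * (S + 3 * k) + (S + 3 * k) <= Q.
  by rewrite /pQ addnC -mulSn leq_mul2r Hi orbT.
have Ha : a = roundsl G D L E k (sampleseq G (take S (take (S + 3 * k) (drop (i * (S + 3 * k)) l))))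
    (drop S (take (S + 3 * k) (drop (i * (S + 3 * k)) l))).
  apply: trial_setE.
    move=> j Hj; rewrite nth_take // nth_drop /= ifT; last by lia.
    by congr nth; lia.
  by rewrite size_take size_drop Hl; case: ifP; lia.
move: Hg; rewrite /goodb -Ha => /round_invP[Hio _ Hle].
have Hno : no_odd G a.
  by move=> v j Ho; apply/negP => Hw; have := iocp0_no_odd Hio Hw; rewrite Ho.
have := Happ i Hi Hl Hno I HI; rewrite -/a => H1.
(* The rounds lose 4kn and the auction n, together at most 4(k + 1) n; dividing by D = 4(k + 1) t
   leaves n/t. *)
have : D * count_below n I <= D * count_below n (bestp (run pMain (hM l))) + 4 * (k + 1) * n by lia.
have DE : D = 4 * (k + 1) * t by rewrite /pD; lia.
have k0 : 0 < 4 * (k + 1) by lia.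
by rewrite DE -!mulnA -!mulnDr !(leq_pmul2l) // ?addn1.
Qed.
End Final.

Lemma alpha_pred n (G : sgraph n) : exists2 I : pred nat, indep G I & count_below n I = alpha G.
Proof.
have [S0 HS0 HE] : {S0 : {set 'I_n} | S0 \in [pred S | independent G S] &
    \max_(S in [pred S | independent G S]) #|S| = #|S0|}.
  apply: (@eq_bigmax_cond _ _ (fun S : {set 'I_n} => #|S|)).
  apply/card_gt0P; exists set0; rewrite inE; apply/forallP => x.
  by rewrite inE.
exists (fun x => [exists i : 'I_n, (i \in S0) && (val i == x)]).
  move=> x y /existsP[i /andP[Hi /eqP <-]] /existsP[j /andP[Hj /eqP <-]].
  rewrite nat_adj_ord; move: HS0; rewrite inE => /forallP/(_ i)/implyP/(_ Hi)/forallP/(_ j).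
  by move/implyP/(_ Hj).
rewrite /count_below count_card; transitivity #|S0|; last by rewrite -HE.
apply: eq_card => i; rewrite !inE.
apply/existsP/idP => [[j /andP[Hj /eqP /val_inj <-]]|Hi] //.
by exists i; rewrite Hi eqxx.
Qed.

Theorem theorem5 :
  exists P : cmd,
  forall k t : nat, 1 <= t ->
  exists C : nat,
  forall (n : nat) (G : sgraph n) (w : nat),
    iocp G <= k ->
    C * (trunc_log 2 n).+1 <= w ->
    let T := C * maxn n 1 ^ (k + 4) in
    let start : config := ([:: P], init_store w k t G) in
    prob w T start (fun s => independent G (output n s)) = 1%R /\
    (1 / 2%:R <=
       prob w T start (fun s =>
         (alpha G)%:R - n%:R / t%:R <= (#|output n s|%:R : rat)))%R.
Proof.
(* The first summand serves the word size, the second the running time. *)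
exists algorithm => k t t0; exists (40 * (pV k t + 19) + time_cst k t).
move=> n G w Hk Hw T start.
have HW : word_bound (pV k t * (n + 1) ^ 2) w.
  rewrite /word_bound; apply: (@leq_trans (2 ^ (40 * (pV k t + 19) * (trunc_log 2 n).+1))); last first.
    rewrite leq_exp2l //; apply: leq_trans Hw; by rewrite leq_mul2r leq_addr orbT.
  rewrite -[40 * _ * _]mulnA [40 * _]mulnC expnM leq_exp2r //.
  (* From n < 2^l and l >= 1: M + 17 <= (V + 17)(n + 1)^2 <= 2^(V + 17 + 2l) <= 2^((V + 19) l). *)
  set l := (trunc_log 2 n).+1.
  have Hn : n + 1 <= 2 ^ l by rewrite addn1 trunc_log_ltn.
  apply: (@leq_trans ((pV k t + 17) * (n + 1) ^ 2)).
    by rewrite mulnDl leq_add2l leq_pmulr // expn_gt0 addn1.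
  apply: (@leq_trans (2 ^ (pV k t + 17) * (2 ^ l) ^ 2)).
    by apply: leq_mul; [apply: ltnW; apply: ltn_expl | rewrite leq_exp2r].
  rewrite -expnM -expnD leq_exp2l //; have : 0 < l by [].
  clearbody l; clear; move: (pV k t) => a; nia.
have HT : time_cst k t * maxn n 1 ^ 4 <= T.
  apply: leq_mul; first exact: leq_addl.
  by rewrite leq_pexp2l ?leq_max ?orbT // leq_addl.
clearbody T; clear Hw; rewrite /start => {start}.
set B := maxn 1 (n * (2 * (n %/ pE k t)).+1 * pD k t).
have B0 : 0 < B by rewrite leq_max.
(* An event that holds for all draws is compared with the average of the constant 1. *)
have whp (E : pred store) : (forall l m,
    (forall v, v < n -> Defs.mem m v = ar (run pMain (hstM G k t w l)) 9 v) -> E m) ->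
    prob w T ([:: algorithm], init_store w k t G) E = 1%R.
  move=> HE; apply/eqP; rewrite eq_le prob_le1 andTb.
  have := @machine_run n G k t w t0 HW E T (fun=> 1%R) HT; rewrite avg_cst //; apply.
  by move=> l m _ _ Hm; rewrite (HE l m).
split; first by apply: whp => l m /(output_indep t0 HW)[].
have half : (1 / 2%:R <= 1 :> rat)%R by lra.
have tp : (0 < t%:R :> rat)%R by rewrite ltr0n.
have E_nat m : t * alpha G <= t * #|output n m| + n ->
    ((alpha G)%:R - n%:R / t%:R <= (#|output n m|%:R : rat))%R.
  move=> H; rewrite lerBlDr -(ler_pM2l tp) mulrDr mulrCA divff ?gt_eqF // mulr1.
  by rewrite -!natrM -natrD ler_nat.
(* Below n/t the required size is negative and any output will do; otherwise |I| >= n/t, as the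
   sampling bound requires. *)
case: (ltnP (t * alpha G) n) => Hta.
  rewrite whp // => l m _; apply: E_nat; lia.
case: (posnP n) => n0.
  rewrite whp // => l m _; apply: E_nat; subst n.
  by rewrite (_ : alpha G = 0) ?muln0 //; apply/eqP; rewrite -leqn0; apply/bigmax_leqP => A _; rewrite (leq_trans (max_card _)) ?card_ord.
have [I HI Ical] := alpha_pred G.
have HIbig : n <= t * count_below n I by rewrite Ical.
have BE : B = n * (2 * (n %/ pE k t)).+1 * pD k t.
  by apply/maxn_idPr; rewrite muln_gt0 (pD_gt0 k t0) andbT muln_gt0 n0.
have Htrial := @trial_prob n G (pD k t) (pL k t) (pE k t) (pS k t) t k B I n0 t0 (pD_gt0 k t0)
  erefl erefl erefl BE HI HIbig (iocp_leT Hk).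
rewrite -pR_inv // in Htrial.
have R0 : 0 < pR k t.
  rewrite /pR; move: (pS k t) (pD k t) (pD_gt0 k t0) => S D D0.
  by rewrite !muln_gt0 !expn_gt0 !muln_gt0 t0 D0.
have Rp : (0 < (pR k t)%:R :> rat)%R by rewrite ltr0n.
have R1 : ((pR k t)%:R^-1 <= 1 :> rat)%R by rewrite invf_le1 // ler1n.
have Hgood := pr_hasgood B0 R1 Htrial (pR k t).
apply: (@le_trans _ _ (pr B (pQ k t) (hasgood (pS k t + 3 * k)
    (goodb G (pD k t) (pL k t) (pE k t) (pS k t) k I) (pR k t)))).
  by apply: le_trans Hgood; have := pow_half R0; lra.
apply: (@machine_run n G k t w t0 HW _ T _ HT) => l m Hl _ Hm; rewrite ler_nat.
case Hg: (hasgood _ _ _ _) => //; rewrite E_nat // -Ical.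
exact: good_output Hm HI Hl Hg.
Qed.
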